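(* Fix a real number $\sigma$. There exists $W<U:=-\log|w_0|\approx0.068076$ such that $$\sum_{h/k\in\mathcal B(101,N)}Q_{hk\sigma}(N)=O(e^{WN})\quad(N\to\infty).$$ Moreover any $W>\mathrm{Cl}_2(\pi/3)/(6\pi)\approx0.0538$ may be taken, with the implied constant depending only on $\sigma$ and $W$.
   Context: $Q_{hk\sigma}(N):=2\pi i\,\operatorname{Res}_{z=h/k}\dfrac{e^{2\pi i\sigma z}}{\prod_{j=1}^N(1-e^{2\pi i jz})}$. $\mathcal B(K,N)$ is the set of fractions $h/k$ with $K\le k\le N$, $0\le h<k$, $\gcd(h,k)=1$, subject to the restrictions: $h\not\equiv\pm1\bmod k$ if $N/3<k\le N/2$; and $h\not\equiv\pm1,\pm2,(k\pm1)/2\bmod k$ if $N/2<k\le N$. $\mathrm{Cl}_2(\theta):=-\int_0^\theta\log|2\sin(x/2)|\,dx$. $\mathrm{Li}_2$ is the principal dilogarithm, $\log$ the principal logarithm, and $w_0\approx0.916198-0.182459i$ is the unique solution of $\mathrm{Li}_2(w)-2\pi i\log w=0$. *)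

(* Defs.v *)
From Stdlib Require Import Reals ZArith List Bool ClassicalEpsilon.
From Coquelicot Require Import Coquelicot.
Import ListNotations.
Open Scope R_scope.

Definition Cexp (z : C) : C :=
  (exp (Re z) * cos (Im z), exp (Re z) * sin (Im z)).

(* Principal argument, with values in (-PI, PI]; irrelevant at 0. *)
Definition Arg (z : C) : R :=
  if Rle_dec 0 (Im z) then acos (Re z / Cmod z) else - acos (Re z / Cmod z).

Definition Clog (z : C) : C := (ln (Cmod z), Arg z).

Definition CRInt (f : R -> C) (a b : R) : C :=
  (RInt (fun t => Re (f t)) a b, RInt (fun t => Im (f t)) a b).

(* Complement of the branch cut [1, +oo) of the principal dilogarithm. *)
Definition dilog_domain (w : C) : Prop := ~ (Im w = 0 /\ 1 <= Re w).

(* - \int_0^w log(1-u) du/u along the segment u = t w.  On dilog_domain the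
   integrand is continuous on (0,1] and has a finite limit at 0, so this is a
   proper Riemann integral; the value is not meaningful on the cut. *)
Definition Li2 (w : C) : C :=
  (- CRInt (fun t => Clog (1 - RtoC t * w) / RtoC t) 0 1)%C.

Definition is_dilog_zero (w : C) : Prop :=
  w <> RtoC 0 /\ dilog_domain w /\
  (Li2 w - 2 * RtoC PI * Ci * Clog w)%C = RtoC 0.

(* Improper at 0, where the integrand has a logarithmic singularity; meant for
   0 < theta < 2 PI. *)
Definition Cl2 (theta : R) : R :=
  - RInt_gen (fun x => ln (Rabs (2 * sin (x / 2)))) (at_right 0) (at_point theta).

(* f is meromorphic at z0 with Laurent expansion
   f z = \sum_n a_n (z - z0)^(n - m - 1), and c is its coefficient at
   (z - z0)^(-1), namely a_m. *)
Definition is_residue (f : C -> C) (z0 c : C) : Prop :=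
  exists (m : nat) (a : nat -> C) (r : R),
    0 < r /\
    (forall z : C, 0 < Cmod (z - z0)%C < r ->
       is_pseries a (z - z0)%C ((z - z0) ^ (S m) * f z)%C) /\
    c = a m.

Definition Res (f : C -> C) (z0 : C) : C :=
  epsilon (inhabits (RtoC 0)) (is_residue f z0).

Definition Csum {A : Type} (l : list A) (f : A -> C) : C :=
  fold_right Cplus (RtoC 0) (map f l).

Definition Cprod {A : Type} (l : list A) (f : A -> C) : C :=
  fold_right Cmult (RtoC 1) (map f l).

Definition Qfun (sigma : R) (N : nat) (z : C) : C :=
  (Cexp (2 * RtoC PI * Ci * RtoC sigma * z) /
   Cprod (seq 1 N) (fun j => 1 - Cexp (2 * RtoC PI * Ci * RtoC (INR j) * z)))%C.

Definition Q (h k : nat) (sigma : R) (N : nat) : C :=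
  (2 * RtoC PI * Ci * Res (Qfun sigma N) (RtoC (INR h / INR k)))%C.

Definition congr_mod (k : nat) (a b : Z) : bool :=
  ((a - b) mod Z.of_nat k =? 0)%Z.

Definition congr_any (h k : nat) (l : list Z) : bool :=
  existsb (congr_mod k (Z.of_nat h)) l.

(* (k-1)/2 and (k+1)/2, which are residues mod k only when k is odd *)
Definition half_residues (k : nat) : list Z :=
  if Nat.odd k then [(Z.of_nat k - 1) / 2; (Z.of_nat k + 1) / 2]%Z else [].

Definition inB (K N : nat) (hk : nat * nat) : bool :=
  let (h, k) := hk in
  (K <=? k)%nat && (k <=? N)%nat && (h <? k)%nat && (Nat.gcd h k =? 1)%nat &&
  (if (N <? 3 * k)%nat && (2 * k <=? N)%nat            (* N/3 < k <= N/2 *)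
   then negb (congr_any h k [1; -1]%Z) else true) &&
  (if (N <? 2 * k)%nat && (k <=? N)%nat                (* N/2 < k <= N *)
   then negb (congr_any h k ([1; -1; 2; -2]%Z ++ half_residues k)) else true).

(* The fraction h/k is represented by the pair (h, k). *)
Definition B (K N : nat) : list (nat * nat) :=
  filter (inB K N) (list_prod (seq 0 (S N)) (seq 0 (S N))).

Definition sum_is_O_exp (sigma W : R) : Prop :=
  exists (M : R) (N0 : nat), forall N : nat, (N0 <= N)%nat ->
    Cmod (Csum (B 101 N) (fun hk => Q (fst hk) (snd hk) sigma N)) <=
    M * exp (W * INR N).

(* Main.v *)
Require Import Defs.
From Stdlib Require Import Reals Lra Lia Psatz List ZArith ClassicalEpsilon Machin.
From Coquelicot Require Import Coquelicot.
Import ListNotations.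
Open Scope R_scope.

(* The residue at h/k is a coefficient of a power series in z - h/k, and it is
   bounded by majorant series instead of a contour integral.  With
   rho = 1/(2 pi N (k+1)), each factor of the product is majorized on the disc of
   radius rho; the product over a full period of j mod k is
   prod |1 - zeta^j| = k, which cancels the growth of rho^(-N/k) up to
   exp (N O(log k / k)), and there remains the partial period
   prod_(j <= N mod k) |2 sin (pi j h/k)|^(-1).  To bound that one, cut
   -log |2 sin (pi x)| off at -log tau (distinctness of the residues j h mod k
   makes the excess O(tau k)), take a Dirichlet approximation h/k = a/q + beta/(qk),
   and use prod_(r < q) |2 sin (pi (x + r a/q))| = |2 sin (pi q x)|: the sum becomes
   an integral that is at most k Cl_2(pi/3) / (2 pi q |beta|).  The exclusions in
   B(101, N) give q |beta| >= 2 for k > N/3 and q |beta| >= 3 for k > N/2.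

   The existence of W < -log |w_0| follows from Cl_2(pi/3)/(6 pi) < -log |w_0|,
   obtained by comparing the real and imaginary parts of
   Li_2(w) = 2 pi i log w: there is no zero in the closed upper half plane, and
   in the lower one Re Li_2 confines arg w, after which Im Li_2 is too large if
   |w| is close to 1. *)

(** * Absolutely convergent complex power series *)

(** Two costs compete for the exponent Cl_2(pi/3)/(6 pi). Majorizing a factor instead of evaluating
    it at the centre loses 1/(1 - 1/(4r)), where r is k times the distance from jh/k to the
    integers; over a period these losses multiply to about k^(1/2), and there are N/k periods. The
    partial period costs a multiple of k. The two are never large together: when k is large the
    first is o(N), and when k is bounded the second is O(1), so that the first may use up the whole
    allowance, which it respects from k = 101 on. The partial period obeys the same allowance
    because k/D <= N/3 in all three ranges of k, where D is the lower bound for q |beta|; so the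
    exponent is a third of the maximum of the integral of -log |2 sin(pi x)| over [0, Y]. The number
    w_0 is never computed. A zero with -log |w| <= Cl_2(pi/3)/(6 pi) is refuted with explicit
    constants. The margin is narrow, 0.345 against 0.34 in the decisive imaginary part, which is why
    one integral needs a genuine quadrature. *)

Lemma im_le_Cmod (z : C) : Rabs (Im z) <= Cmod z.
Proof.
  eapply Rle_trans; [apply Rmax_r | apply (Rmax_Cmod z)].
Qed.

Lemma sum_n_fst (a : nat -> C) (n : nat) :
  fst (sum_n (G := C_AbelianMonoid) a n) = sum_n (fun k => Re (a k)) n.
Proof.
  induction n as [|n IH]; [now rewrite !sum_O|].
  rewrite !sum_Sn, <- IH. reflexivity.
Qed.

Lemma sum_n_snd (a : nat -> C) (n : nat) :
  snd (sum_n (G := C_AbelianMonoid) a n) = sum_n (fun k => Im (a k)) n.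
Proof.
  induction n as [|n IH]; [now rewrite !sum_O|].
  rewrite !sum_Sn, <- IH. reflexivity.
Qed.

Notation Cis_series := (@is_series C_AbsRing C_NormedModule).

Lemma is_series_C (a : nat -> C) (l : C) :
  Cis_series a l <->
  is_series (fun n => Re (a n)) (Re l) /\ is_series (fun n => Im (a n)) (Im l).
Proof.
  split.
  - intros H. pose proof (proj1 (filterlim_locally _ _) H) as H'. clear H.
    split; apply (proj2 (filterlim_locally (U := R_UniformSpace) _ _));
      intros eps; destruct (H' eps) as [N HN]; exists N; intros n Hn; destruct (HN n Hn) as [H1 H2].
    + rewrite <- sum_n_fst. exact H1.
    + rewrite <- sum_n_snd. exact H2.
  - intros [H1 H2]. apply (proj2 (filterlim_locally (U := C_UniformSpace) _ _)). intros eps.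
    destruct (proj1 (filterlim_locally (U := R_UniformSpace) _ _) H1 eps) as [N1 HN1].
    destruct (proj1 (filterlim_locally (U := R_UniformSpace) _ _) H2 eps) as [N2 HN2].
    exists (N1 + N2)%nat. intros n Hn. split.
    + change (ball (Re l) eps (fst (sum_n (G := C_AbelianMonoid) a n))).
      rewrite sum_n_fst. apply HN1. lia.
    + change (ball (Im l) eps (snd (sum_n (G := C_AbelianMonoid) a n))).
      rewrite sum_n_snd. apply HN2. lia.
Qed.

Lemma pow_n_Cpow (z : C) (n : nat) : pow_n (K := C_Ring) z n = (z ^ n)%C.
Proof. induction n as [|n IH]; [reflexivity|]. simpl. now rewrite IH. Qed.

Lemma is_pseries_C (a : nat -> C) (z l : C) :
  @is_pseries C_AbsRing C_NormedModule a z l <-> Cis_series (fun n => a n * z ^ n)%C l.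
Proof.
  assert (E : forall n, scal (V := C_NormedModule) (pow_n (K := C_AbsRing) z n) (a n) = (a n * z ^ n)%C).
  { intros n. change (@pow_n C_AbsRing z n) with (pow_n (K := C_Ring) z n).
    rewrite pow_n_Cpow. apply Cmult_comm. }
  unfold is_pseries. split; apply is_series_ext; intros n; now rewrite E.
Qed.

Definition Cconv (a b : nat -> C) (n : nat) : C :=
  sum_n (G := C_AbelianMonoid) (fun i => a i * b (n - i)%nat)%C n.

Lemma Cmod_sum_n (a : nat -> C) (n : nat) :
  Cmod (sum_n (G := C_AbelianMonoid) a n) <= sum_f_R0 (fun k => Cmod (a k)) n.
Proof.
  induction n as [|n IH]; [rewrite sum_O; simpl; lra|].
  rewrite sum_Sn. simpl.
  eapply Rle_trans; [apply Cmod_triangle|]. lra.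
Qed.

Lemma ex_series_Cmod_Re (a : nat -> C) :
  ex_series (fun n => Cmod (a n)) -> ex_series (fun n => Rabs (Re (a n))).
Proof.
  apply (ex_series_le (fun n => Rabs (Re (a n))) (fun n => Cmod (a n))). intros n.
  change (Rabs (Rabs (Re (a n))) <= Cmod (a n)). rewrite Rabs_Rabsolu. apply re_le_Cmod.
Qed.

Lemma ex_series_Cmod_Im (a : nat -> C) :
  ex_series (fun n => Cmod (a n)) -> ex_series (fun n => Rabs (Im (a n))).
Proof.
  apply (ex_series_le (fun n => Rabs (Im (a n))) (fun n => Cmod (a n))). intros n.
  change (Rabs (Rabs (Im (a n))) <= Cmod (a n)). rewrite Rabs_Rabsolu. apply im_le_Cmod.
Qed.

(** Real and imaginary parts of the product are combinations of four real Cauchy products, each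
    covered by the real theorem for absolutely convergent series. *)
Lemma is_series_Cmult (u v : nat -> C) (lu lv : C) :
  Cis_series u lu -> Cis_series v lv ->
  ex_series (fun n => Cmod (u n)) -> ex_series (fun n => Cmod (v n)) ->
  Cis_series (Cconv u v) (lu * lv)%C.
Proof.
  intros Hu Hv Eu Ev.
  apply is_series_C in Hu. apply is_series_C in Hv.
  destruct Hu as [Hu1 Hu2]. destruct Hv as [Hv1 Hv2].
  pose proof (ex_series_Cmod_Re _ Eu) as Eu1. pose proof (ex_series_Cmod_Im _ Eu) as Eu2.
  pose proof (ex_series_Cmod_Re _ Ev) as Ev1. pose proof (ex_series_Cmod_Im _ Ev) as Ev2.
  apply is_series_C. split.
  - eapply is_series_ext; [|exact (is_series_minus _ _ _ _
      (is_series_mult _ _ _ _ Hu1 Hv1 Eu1 Ev1) (is_series_mult _ _ _ _ Hu2 Hv2 Eu2 Ev2))].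
    intros n. unfold Cconv. change Re with (@fst R R). rewrite sum_n_fst.
    rewrite sum_n_Reals.
    change (sum_f_R0 (fun k => Re (u k) * Re (v (n - k)%nat)) n -
            sum_f_R0 (fun k => Im (u k) * Im (v (n - k)%nat)) n =
            sum_f_R0 (fun i => Re (u i * v (n - i)%nat)%C) n).
    rewrite <- minus_sum. apply sum_eq. intros i _. reflexivity.
  - eapply is_series_ext; [|exact (is_series_plus _ _ _ _
      (is_series_mult _ _ _ _ Hu1 Hv2 Eu1 Ev2) (is_series_mult _ _ _ _ Hu2 Hv1 Eu2 Ev1))].
    intros n. unfold Cconv. change Im with (@snd R R). rewrite sum_n_snd.
    rewrite sum_n_Reals.
    change (sum_f_R0 (fun k => Re (u k) * Im (v (n - k)%nat)) n +
            sum_f_R0 (fun k => Im (u k) * Re (v (n - k)%nat)) n =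
            sum_f_R0 (fun i => Im (u i * v (n - i)%nat)%C) n).
    rewrite <- plus_sum. apply sum_eq. intros i _. reflexivity.
Qed.

(* The expansion is only required on the punctured disc, so that a removable
   singularity of [F] at 0, where [F] takes a junk value, is harmless. *)
Definition expands (F : C -> C) (rho : R) (a : nat -> C) (M : R) : Prop :=
  (exists S, S <= M /\ is_series (fun n => Cmod (a n) * rho ^ n) S) /\
  forall z, 0 < Cmod z <= rho -> Cis_series (fun n => a n * z ^ n)%C (F z).

(** The sum of [Cmod (a n) * rho ^ n] is a submultiplicative norm, so the factors of [Qfun] can be
    treated one at a time; it also dominates each single term, which takes the place of Cauchy's
    estimate. *)
Definition majorized (F : C -> C) (rho M : R) : Prop := exists a, expands F rho a M.

Lemma Cmod_pow_nonneg (c : C) (rho : R) (n : nat) : 0 < rho -> 0 <= Cmod c * rho ^ n.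
Proof. intros Hr. apply Rmult_le_pos; [apply Cmod_ge_0 | apply pow_le; lra]. Qed.

Lemma expands_coef (F : C -> C) (rho : R) (a : nat -> C) (M : R) (n : nat) :
  0 < rho -> expands F rho a M -> Cmod (a n) * rho ^ n <= M.
Proof.
  intros Hr [[S [HS H]] _].
  apply Rle_trans with S; [|exact HS].
  apply is_series_Reals in H.
  apply Rle_trans with (sum_f_R0 (fun n => Cmod (a n) * rho ^ n) n).
  - destruct n as [|n]; [simpl; lra|]. rewrite tech5.
    assert (0 <= sum_f_R0 (fun n => Cmod (a n) * rho ^ n) n); [|lra].
    apply cond_pos_sum. intros i. now apply Cmod_pow_nonneg.
  - apply sum_incr; [exact H|].
    intros i. now apply Cmod_pow_nonneg.
Qed.

Lemma ex_series_Cmod_pow (a : nat -> C) (rho : R) (z : C) :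
  ex_series (fun n => Cmod (a n) * rho ^ n) -> Cmod z <= rho ->
  ex_series (fun n => Cmod (a n * z ^ n)%C).
Proof.
  intros H Hz.
  apply (ex_series_le (fun n => Cmod (a n * z ^ n)%C) (fun n => Cmod (a n) * rho ^ n)); [|exact H].
  intros n. change (Rabs (Cmod (a n * z ^ n)%C) <= Cmod (a n) * rho ^ n).
  rewrite Rabs_pos_eq by apply Cmod_ge_0. rewrite Cmod_mult, Cmod_pow.
  apply Rmult_le_compat_l; [apply Cmod_ge_0|]. apply pow_incr. split; [apply Cmod_ge_0 | exact Hz].
Qed.

Lemma Cconv_pow (a b : nat -> C) (z : C) (n : nat) :
  Cconv (fun n => a n * z ^ n)%C (fun n => b n * z ^ n)%C n = (Cconv a b n * z ^ n)%C.
Proof.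
  unfold Cconv. rewrite <- (sum_n_mult_r (K := C_Ring)).
  apply sum_n_ext_loc. intros i Hi.
  change ((a i * z ^ i) * (b (n - i)%nat * z ^ (n - i)) = a i * b (n - i)%nat * z ^ n)%C.
  replace (z ^ n)%C with (z ^ (i + (n - i)))%C by (f_equal; lia).
  rewrite Cpow_add_r. ring.
Qed.

Lemma is_series_dominated (a b : nat -> R) (l : R) :
  (forall n, 0 <= a n <= b n) -> is_series b l -> exists S, S <= l /\ is_series a S.
Proof.
  intros H Hb.
  assert (Ea : ex_series a).
  { apply (ex_series_le a b).
    - intros n. change (Rabs (a n) <= b n). rewrite Rabs_pos_eq; apply H.
    - now exists l. }
  exists (Series a). split; [|now apply Series_correct].
  rewrite <- (is_series_unique _ _ Hb). apply Series_le; [exact H | now exists l].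
Qed.

Lemma is_series_nonneg (a : nat -> R) (l : R) :
  (forall n, 0 <= a n) -> is_series a l -> 0 <= l.
Proof.
  intros Ha H. apply is_series_Reals in H.
  apply Rle_trans with (sum_f_R0 a 0); [apply Ha | now apply sum_incr].
Qed.

Lemma expands_mult (F G : C -> C) (rho : R) (a b : nat -> C) (M M' : R) :
  0 < rho -> expands F rho a M -> expands G rho b M' ->
  expands (fun z => F z * G z)%C rho (Cconv a b) (M * M').
Proof.
  intros Hr [[S [HS Ha]] HF] [[S' [HS' Hb]] HG].
  assert (Pa : forall n, 0 <= Cmod (a n) * rho ^ n)
    by (intros n; now apply Cmod_pow_nonneg).
  assert (Pb : forall n, 0 <= Cmod (b n) * rho ^ n)
    by (intros n; now apply Cmod_pow_nonneg).
  assert (S0 : 0 <= S).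
  { now apply is_series_nonneg with (1 := Pa). }
  assert (S0' : 0 <= S').
  { now apply is_series_nonneg with (1 := Pb). }
  split.
  - pose proof (is_series_mult_pos _ _ _ _ Ha Hb Pa Pb) as Hab.
    edestruct (is_series_dominated (fun n => Cmod (Cconv a b n) * rho ^ n)) as [T [HT1 HT2]];
      [|exact Hab|].
    + intros n. split; [now apply Cmod_pow_nonneg|].
      eapply Rle_trans; [apply Rmult_le_compat_r; [apply pow_le; lra | apply Cmod_sum_n]|].
      rewrite Rmult_comm, scal_sum. apply Req_le, sum_eq. intros i Hi.
      rewrite Cmod_mult. replace (rho ^ n) with (rho ^ (i + (n - i))) by (f_equal; lia).
      rewrite pow_add. ring.
    + exists T. split; [|exact HT2]. apply Rle_trans with (S * S'); [exact HT1|].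
      apply Rmult_le_compat; assumption.
  - intros z Hz. eapply is_series_ext; [intros n; apply Cconv_pow|].
    apply is_series_Cmult.
    + now apply HF.
    + now apply HG.
    + apply ex_series_Cmod_pow with rho; [now exists S | apply Hz].
    + apply ex_series_Cmod_pow with rho; [now exists S' | apply Hz].
Qed.

Lemma majorized_mult (F G : C -> C) (rho M M' : R) :
  0 < rho -> majorized F rho M -> majorized G rho M' ->
  majorized (fun z => F z * G z)%C rho (M * M').
Proof.
  intros Hr [a Ha] [b Hb]. exists (Cconv a b). now apply expands_mult.
Qed.

Lemma majorized_ext (F G : C -> C) (rho M M' : R) :
  (forall z, 0 < Cmod z <= rho -> F z = G z) -> M <= M' ->
  majorized F rho M -> majorized G rho M'.
Proof.
  intros E HM [a [[S [HS Ha]] HF]]. exists a. split.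
  - exists S. split; [lra | exact Ha].
  - intros z Hz. rewrite <- E by exact Hz. now apply HF.
Qed.

Lemma is_series_singleton (c : R) : is_series (fun n => match n with O => c | S _ => 0 end) c.
Proof.
  apply is_series_Reals. intros eps He. exists 0%nat. intros n _.
  replace (sum_f_R0 _ n) with c; [now rewrite Rdist_eq|].
  induction n as [|n IH]; [reflexivity|]. rewrite tech5, <- IH. ring.
Qed.

Lemma is_series_Csingleton (c : C) :
  Cis_series (fun n => match n with O => c | S _ => RtoC 0 end) c.
Proof.
  apply is_series_C.
  split; (eapply is_series_ext; [|apply is_series_singleton]); intros [|n]; reflexivity.
Qed.

Lemma majorized_const (c : C) (rho : R) : majorized (fun _ => c) rho (Cmod c).
Proof.
  exists (fun n => match n with O => c | S _ => RtoC 0 end). split.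
  - exists (Cmod c). split; [lra|].
    eapply is_series_ext; [|apply (is_series_singleton (Cmod c))]. intros [|n]; simpl; [ring|].
    rewrite Cmod_0. ring.
  - intros z _. eapply is_series_ext; [|apply (is_series_Csingleton c)]. intros [|n]; simpl; ring.
Qed.

Lemma Cis_series_unique (a : nat -> C) (l l' : C) :
  Cis_series a l -> Cis_series a l' -> l = l'.
Proof.
  intros H H'. apply is_series_C in H. apply is_series_C in H'.
  destruct H as [H1 H2], H' as [H1' H2'].
  apply injective_projections.
  - change (Re l = Re l'). now rewrite <- (is_series_unique _ _ H1), <- (is_series_unique _ _ H1').
  - change (Im l = Im l'). now rewrite <- (is_series_unique _ _ H2), <- (is_series_unique _ _ H2').
Qed.

(** * Inversion of power series *)

(* b_n, ..., b_0, where sum b_n z^n is the inverse of 1 - sum g_n z^(n+1) *)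
Fixpoint inv_rev (g : nat -> C) (n : nat) : list C :=
  match n with
  | O => [RtoC 1]
  | S m => sum_n (G := C_AbelianMonoid) (fun i => g i * nth i (inv_rev g m) (RtoC 0))%C m :: inv_rev g m
  end.

Definition inv_coef (g : nat -> C) (n : nat) : C := nth 0 (inv_rev g n) (RtoC 0).

Lemma nth_inv_rev (g : nat -> C) (n i : nat) :
  (i <= n)%nat -> nth i (inv_rev g n) (RtoC 0) = inv_coef g (n - i).
Proof.
  revert i. induction n as [|n IH]; intros i Hi.
  - replace i with 0%nat by lia. reflexivity.
  - destruct i as [|i]; [reflexivity|]. simpl. apply IH. lia.
Qed.

Lemma inv_coef_S (g : nat -> C) (n : nat) : inv_coef g (S n) = Cconv g (inv_coef g) n.
Proof.
  unfold inv_coef at 1. simpl. unfold Cconv. apply sum_n_ext_loc. intros i Hi.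
  now rewrite nth_inv_rev.
Qed.

Lemma sum_conv_le (x y : nat -> R) (N : nat) :
  (forall n, 0 <= x n) -> (forall n, 0 <= y n) ->
  sum_f_R0 (fun k => sum_f_R0 (fun p => x p * y (k - p)%nat) k) N <= sum_f_R0 x N * sum_f_R0 y N.
Proof.
  intros Hx Hy. destruct N as [|N]; [simpl; lra|].
  rewrite cauchy_finite by lia.
  rewrite <- Rplus_0_r at 1. apply Rplus_le_compat_l.
  apply cond_pos_sum. intros k. apply cond_pos_sum. intros l. now apply Rmult_le_pos.
Qed.

(** The recursion [inv_coef_S] gives B_(N+1) <= 1 + q B_N for the partial sums B_N on the left, and
    1/(1 - q) is the fixed point of this map. *)
Lemma inv_coef_bound (g : nat -> C) (rho q : R) (N : nat) :
  0 < rho -> q < 1 -> (forall n, sum_f_R0 (fun n => Cmod (g n) * rho ^ S n) n <= q) ->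
  sum_f_R0 (fun n => Cmod (inv_coef g n) * rho ^ n) N <= / (1 - q).
Proof.
  intros Hr Hq Hg.
  assert (Hq0 : 0 <= q).
  { eapply Rle_trans; [|apply (Hg 0%nat)]. simpl.
    apply Rmult_le_pos; [apply Cmod_ge_0 | lra]. }
  assert (H1 : 1 <= / (1 - q)) by (rewrite <- Rinv_1 at 1; apply Rinv_le_contravar; lra).
  induction N as [|N IH].
  - simpl. unfold inv_coef; simpl. rewrite Cmod_1. lra.
  - rewrite decomp_sum by lia. simpl Init.Nat.pred.
    replace (Cmod (inv_coef g 0) * rho ^ 0) with 1
      by (unfold inv_coef; simpl; rewrite Cmod_1; ring).
    apply Rle_trans with (1 + q * / (1 - q)); [|apply Req_le; field; lra].
    apply Rplus_le_compat_l.
    apply Rle_trans with (sum_f_R0 (fun n => Cmod (g n) * rho ^ S n) N *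
                          sum_f_R0 (fun n => Cmod (inv_coef g n) * rho ^ n) N).
    + eapply Rle_trans; [|apply sum_conv_le].
      * apply sum_Rle. intros n Hn. rewrite inv_coef_S.
        eapply Rle_trans; [apply Rmult_le_compat_r; [apply pow_le; lra | apply Cmod_sum_n]|].
        rewrite Rmult_comm, scal_sum. apply Req_le, sum_eq. intros i Hi.
        rewrite Cmod_mult. replace (rho ^ S n) with (rho ^ (S i + (n - i))) by (f_equal; lia).
        rewrite pow_add. ring.
      * intros n. now apply Cmod_pow_nonneg.
      * intros n. now apply Cmod_pow_nonneg.
    + apply Rmult_le_compat; [| |apply Hg|exact IH];
        apply cond_pos_sum; intros n; now apply Cmod_pow_nonneg.
Qed.

Lemma is_series_bounded_pos (a : nat -> R) (M : R) :
  (forall n, 0 <= a n) -> (forall n, sum_f_R0 a n <= M) -> exists S, S <= M /\ is_series a S.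
Proof.
  intros Ha HM.
  destruct (ex_finite_lim_seq_incr (sum_n a) M) as [S HS].
  - intros n. rewrite sum_Sn. change (sum_n a n <= sum_n a n + a (S n)). specialize (Ha (S n)). lra.
  - intros n. rewrite sum_n_Reals. apply HM.
  - exists S. split; [|exact HS].
    change (Rbar_le (Finite S) (Finite M)).
    apply is_lim_seq_le with (2 := HS) (3 := is_lim_seq_const M).
    intros n. rewrite sum_n_Reals. apply HM.
Qed.

(** The Cauchy product of 1 - G with the series [inv_coef g] collapses to the constant 1, formally
    ([Hdb]) and hence for the sums. The product being 1 also shows that 1 - G z is nonzero, so that
    [/] is the true inverse. *)
Lemma majorized_inv (G : C -> C) (g : nat -> C) (rho q : R) :
  0 < rho -> q < 1 ->
  (exists l, l <= q /\ is_series (fun n => Cmod (g n) * rho ^ S n) l) ->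
  (forall z, 0 < Cmod z <= rho -> Cis_series (fun n => g n * z ^ S n)%C (G z)) ->
  majorized (fun z => / (1 - G z))%C rho (/ (1 - q)).
Proof.
  intros Hr Hq [l [Hl Hg]] HG.
  assert (Pg : forall n, 0 <= Cmod (g n) * rho ^ S n)
    by (intros n; now apply Cmod_pow_nonneg).
  assert (Hpart : forall n, sum_f_R0 (fun n => Cmod (g n) * rho ^ S n) n <= q).
  { intros n. apply Rle_trans with l; [|exact Hl]. apply is_series_Reals in Hg.
    now apply sum_incr. }
  set (b := inv_coef g).
  assert (Hb : exists l, l <= / (1 - q) /\ is_series (fun n => Cmod (b n) * rho ^ n) l).
  { apply is_series_bounded_pos.
    - intros n. now apply Cmod_pow_nonneg.
    - intros n. now apply inv_coef_bound. }
  set (d := fun n => match n with O => RtoC 1 | S n => (- g n)%C end).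
  assert (Ed : ex_series (fun n => Cmod (d n) * rho ^ n)).
  { apply ex_series_incr_1. exists l. eapply is_series_ext; [|exact Hg].
    intros n. simpl. now rewrite Cmod_opp. }
  assert (Hd : forall z, 0 < Cmod z <= rho -> Cis_series (fun n => d n * z ^ n)%C (1 - G z)%C).
  { intros z Hz. apply is_series_decr_1.
    eapply is_series_ext; [|replace (plus _ _) with (opp (G z : C_NormedModule));
                            [apply is_series_opp, (HG z Hz)|]].
    - intros n. change (- (g n * z ^ S n) = - g n * z ^ S n)%C. ring.
    - change (- G z = (1 - G z) + - (1 * 1))%C. ring. }
  assert (Hdb : forall n, Cconv d b n = match n with O => RtoC 1 | S _ => RtoC 0 end).
  { intros [|n].
    - unfold Cconv. rewrite sum_O. unfold d, b, inv_coef; simpl. ring.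
    - unfold Cconv, sum_n. rewrite sum_Sn_m by lia. rewrite <- sum_n_m_S.
      change (d 0%nat * b (S n - 0)%nat + sum_n_m (G := C_AbelianMonoid) (fun i => - g i * b (n - i)%nat) 0 n = 0)%C.
      rewrite Nat.sub_0_r. unfold b at 1. rewrite inv_coef_S. fold b. simpl d.
      rewrite (sum_n_m_ext _ (fun i => opp (g i * b (n - i)%nat)%C : C_Ring)).
      2:{ intros i. change (- g i * b (n - i)%nat = - (g i * b (n - i)%nat))%C. ring. }
      replace (sum_n_m _ 0 n) with (- Cconv g b n)%C; [ring|].
      unfold Cconv, sum_n.
      set (u := fun i => (g i * b (n - i)%nat)%C).
      change (- sum_n_m (G := C_AbelianMonoid) u 0 n = sum_n_m (G := C_AbelianMonoid) (fun i => - u i) 0 n)%C.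
      clearbody u.
      clear.
      induction n as [|n IH].
      + rewrite !sum_n_n. reflexivity.
      + rewrite !sum_n_Sm by lia. rewrite <- IH.
        change (- (sum_n_m (G := C_AbelianMonoid) u 0 n + u (S n)) =
                - sum_n_m (G := C_AbelianMonoid) u 0 n + - u (S n))%C. ring. }
  exists b. split; [exact Hb|].
  intros z Hz.
  assert (Eb : ex_series (fun n => Cmod (b n) * rho ^ n)) by (destruct Hb as [lb [_ Hb]]; now exists lb).
  pose proof (ex_series_Cmod_pow b rho z Eb (proj2 Hz)) as Ebz.
  destruct (ex_series_Rabs _ (ex_series_Cmod_Re _ Ebz)) as [l1 Hl1].
  destruct (ex_series_Rabs _ (ex_series_Cmod_Im _ Ebz)) as [l2 Hl2].
  assert (Hbz : Cis_series (fun n => b n * z ^ n)%C (l1, l2)) by (apply is_series_C; now split).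
  assert (E : ((1 - G z) * (l1, l2))%C = 1).
  { eapply Cis_series_unique; [|apply (is_series_Csingleton 1)].
    eapply is_series_ext; [|apply is_series_Cmult; [exact (Hd z Hz) | exact Hbz | | exact Ebz]].
    - intros n. rewrite Cconv_pow, Hdb. destruct n; simpl; ring.
    - apply ex_series_Cmod_pow with rho; [exact Ed | apply Hz]. }
  replace (/ (1 - G z))%C with ((l1, l2) : C); [exact Hbz|].
  assert (N : (1 - G z)%C <> 0).
  { intros Z. rewrite Z, Cmult_0_l in E. apply RtoC_inj in E. lra. }
  transitivity (/ (1 - G z) * ((1 - G z) * (l1, l2)))%C.
  - rewrite Cmult_assoc, Cinv_l by exact N. symmetry. apply Cmult_1_l.
  - rewrite E. apply Cmult_1_r.
Qed.

(** * The exponential series *)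

Lemma exp_le_compat (x y : R) : x <= y -> exp x <= exp y.
Proof. intros [H | ->]; [left; now apply exp_increasing | apply Rle_refl]. Qed.

Lemma is_series_exp (x : R) : is_series (fun n => x ^ n / INR (fact n)) (exp x).
Proof.
  pose proof (is_exp_Reals x) as E. unfold is_pseries in E.
  eapply is_series_ext; [|exact E]. intros n. now rewrite pow_n_pow.
Qed.

(** One term of a positive series is at most its sum. In the form n! >= x^n e^(-x) it stands in for
    Stirling's formula wherever a factorial is bounded below. *)
Lemma pow_fact_le_exp (x : R) (n : nat) : 0 <= x -> x ^ n / INR (fact n) <= exp x.
Proof.
  intros Hx.
  assert (T : forall m, 0 <= x ^ m / INR (fact m)).
  { intros m. apply Rmult_le_pos; [now apply pow_le|].
    left. apply Rinv_0_lt_compat, INR_fact_lt_0. }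
  pose proof (is_series_exp x) as E. apply is_series_Reals in E.
  eapply Rle_trans; [|apply (sum_incr _ n _ E T)].
  destruct n as [|n]; [apply Rle_refl|]. rewrite tech5.
  pose proof (cond_pos_sum _ n T). lra.
Qed.

Lemma CV_radius_factorial (a : nat -> R) (c r : R) :
  0 <= c -> 0 <= r -> (forall n, Rabs (a n) <= c ^ n / INR (fact n)) -> Rbar_lt r (CV_radius a).
Proof.
  intros Hc Hr Ha.
  apply Rbar_lt_le_trans with (Finite (r + 1)); [simpl; lra|].
  apply (proj1 (CV_radius_bounded a)). exists (exp (c * (r + 1))). intros n.
  rewrite Rabs_mult, <- RPow_abs, (Rabs_pos_eq (r + 1)) by lra.
  apply Rle_trans with (c ^ n / INR (fact n) * (r + 1) ^ n).
  - apply Rmult_le_compat_r; [apply pow_le; lra | apply Ha].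
  - eapply Rle_trans; [|apply (pow_fact_le_exp _ n); apply Rmult_le_pos; lra].
    rewrite Rpow_mult_distr. apply Req_le. unfold Rdiv. ring.
Qed.

Definition exp_coef (w : C) (n : nat) : C := (w ^ n / RtoC (INR (fact n)))%C.

Lemma Cmod_exp_coef (w : C) (n : nat) : Cmod (exp_coef w n) = Cmod w ^ n / INR (fact n).
Proof.
  unfold exp_coef. pose proof (INR_fact_lt_0 n).
  rewrite Cmod_div by (intros E; apply RtoC_inj in E; lra).
  rewrite Cmod_pow, Cmod_R, Rabs_pos_eq by lra. reflexivity.
Qed.

Lemma exp_coef_S (w : C) (n : nat) : (RtoC (INR (S n)) * exp_coef w (S n) = w * exp_coef w n)%C.
Proof.
  unfold exp_coef. rewrite fact_simpl, mult_INR, RtoC_mult, Cpow_S.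
  assert (RtoC (INR (fact n)) <> 0%C) by (intros E; apply RtoC_inj in E; pose proof (INR_fact_lt_0 n); lra).
  assert (RtoC (INR (S n)) <> 0%C) by (intros E; apply RtoC_inj in E; pose proof (pos_INR n); rewrite S_INR in E; lra).
  field. now split.
Qed.

(** [Cexp] is built from the real exponential, sine and cosine, so the series has to be summed. With
    A + iB the sum of (tw)^n/n! as a function of the real t, the derivative is w (A + iB); hence
    e^(-tw) (A + iB) is constant, and its values at t = 0 and t = 1 are compared. *)
Lemma is_series_Cexp (w : C) : Cis_series (exp_coef w) (Cexp w).
Proof.
  set (A := fun n => Re (exp_coef w n)). set (B := fun n => Im (exp_coef w n)).
  assert (HA : forall r, Rbar_lt (Rabs r) (CV_radius A)).
  { intros r. apply CV_radius_factorial with (Cmod w); [apply Cmod_ge_0 | apply Rabs_pos |].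
    intros n. rewrite <- Cmod_exp_coef. apply re_le_Cmod. }
  assert (HB : forall r, Rbar_lt (Rabs r) (CV_radius B)).
  { intros r. apply CV_radius_factorial with (Cmod w); [apply Cmod_ge_0 | apply Rabs_pos |].
    intros n. rewrite <- Cmod_exp_coef. apply im_le_Cmod. }
  set (x := Re w). set (y := Im w).
  assert (ES : forall n, INR (S n) * A (S n) = x * A n - y * B n /\ INR (S n) * B (S n) = x * B n + y * A n).
  { intros n. pose proof (exp_coef_S w n) as E. apply (f_equal (fun z : C => (Re z, Im z))) in E.
    unfold A, B, x, y. destruct (exp_coef w (S n)) as [p q]. destruct (exp_coef w n) as [p' q'].
    destruct w as [x' y']. simpl in E |- *. injection E. intros E1 E2. split; lra. }
  assert (CVx : forall a t, Rbar_lt (Rabs t) (CV_radius a) -> is_pseries a t (PSeries a t)).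
  { intros a t H. apply PSeries_correct. now apply CV_radius_inside. }
  assert (DA : forall t, is_derive (PSeries A) t (x * PSeries A t - y * PSeries B t)).
  { intros t. replace (x * PSeries A t - y * PSeries B t) with (PSeries (PS_derive A) t).
    - now apply is_derive_PSeries.
    - rewrite <- (PSeries_scal x), <- (PSeries_scal y), <- PSeries_minus;
        try (apply ex_pseries_scal; [apply Rmult_comm | now apply CV_radius_inside]).
      apply PSeries_ext. intros n.
      change (INR (S n) * A (S n) = x * A n + - (y * B n)). destruct (ES n); lra. }
  assert (DB : forall t, is_derive (PSeries B) t (x * PSeries B t + y * PSeries A t)).
  { intros t. replace (x * PSeries B t + y * PSeries A t) with (PSeries (PS_derive B) t).
    - now apply is_derive_PSeries.
    - rewrite <- (PSeries_scal x), <- (PSeries_scal y), <- PSeries_plus;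
        try (apply ex_pseries_scal; [apply Rmult_comm | now apply CV_radius_inside]).
      apply PSeries_ext. intros n.
      change (INR (S n) * B (S n) = x * B n + y * A n). destruct (ES n); lra. }
  (* Real and imaginary parts of e^(-tw) (A + iB). *)
  set (P := fun t => exp (- x * t) * (PSeries A t * cos (y * t) + PSeries B t * sin (y * t))).
  set (Q := fun t => exp (- x * t) * (PSeries B t * cos (y * t) - PSeries A t * sin (y * t))).
  assert (D : P 0 = P 1 /\ Q 0 = Q 1).
  { split; [apply (eq_is_derive P); [|lra] | apply (eq_is_derive Q); [|lra]]; intros t _; unfold P, Q;
      pose proof (DA t) as HDA; pose proof (DB t) as HDB;
      (auto_derive; [repeat split; (now eexists; eauto) |]);
      change (fun x0 : R => PSeries A x0) with (PSeries A);
      change (fun x0 : R => PSeries B x0) with (PSeries B);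
      rewrite (is_derive_unique _ _ _ HDA), (is_derive_unique _ _ _ HDB);
      unfold zero; simpl; ring. }
  destruct D as [DP DQ].
  assert (A0 : PSeries A 0 = 1).
  { rewrite PSeries_0. unfold A, exp_coef. simpl. field. }
  assert (B0 : PSeries B 0 = 0).
  { rewrite PSeries_0. unfold B, exp_coef. simpl. field. }
  unfold P in DP. unfold Q in DQ. rewrite A0, B0 in DP, DQ.
  rewrite !Rmult_0_r, exp_0, cos_0, sin_0, !Rmult_1_r in DP, DQ.
  assert (Ex : exp x * exp (- x) = 1) by (rewrite <- exp_plus, Rplus_opp_r; apply exp_0).
  assert (P1 : PSeries A 1 * cos y + PSeries B 1 * sin y = exp x).
  { transitivity (exp x * exp (- x) * (PSeries A 1 * cos y + PSeries B 1 * sin y)); [rewrite Ex; ring|].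
    rewrite Rmult_assoc, <- DP. ring. }
  assert (Q1 : PSeries B 1 * cos y - PSeries A 1 * sin y = 0).
  { transitivity (exp x * exp (- x) * (PSeries B 1 * cos y - PSeries A 1 * sin y)); [rewrite Ex; ring|].
    rewrite Rmult_assoc, <- DQ. ring. }
  pose proof (sin2_cos2 y) as SC. unfold Rsqr in SC.
  assert (EA : PSeries A 1 = exp x * cos y).
  { transitivity (PSeries A 1 * (sin y * sin y + cos y * cos y)); [rewrite SC; ring|].
    transitivity ((PSeries A 1 * cos y + PSeries B 1 * sin y) * cos y - (PSeries B 1 * cos y - PSeries A 1 * sin y) * sin y); [ring|].
    rewrite P1, Q1. ring. }
  assert (EB : PSeries B 1 = exp x * sin y).
  { transitivity (PSeries B 1 * (sin y * sin y + cos y * cos y)); [rewrite SC; ring|].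
    transitivity ((PSeries A 1 * cos y + PSeries B 1 * sin y) * sin y + (PSeries B 1 * cos y - PSeries A 1 * sin y) * cos y); [ring|].
    rewrite P1, Q1. ring. }
  apply is_series_C. split.
  - change (Re (Cexp w)) with (exp x * cos y). rewrite <- EA.
    eapply is_series_ext; [|exact (CVx A 1 (HA 1))]. intros n.
    transitivity (1 ^ n * A n); [now rewrite <- pow_n_pow|]. rewrite pow1. apply Rmult_1_l.
  - change (Im (Cexp w)) with (exp x * sin y). rewrite <- EB.
    eapply is_series_ext; [|exact (CVx B 1 (HB 1))]. intros n.
    transitivity (1 ^ n * B n); [now rewrite <- pow_n_pow|]. rewrite pow1. apply Rmult_1_l.
Qed.

(** * Residues *)

Lemma exp_coef_mult (u z : C) (n : nat) : (exp_coef u n * z ^ n)%C = exp_coef (u * z) n.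
Proof. unfold exp_coef, Cdiv. rewrite Cpow_mult_l. ring. Qed.

Lemma is_series_Cmod_exp_coef (u : C) (rho : R) :
  is_series (fun n => Cmod (exp_coef u n) * rho ^ n) (exp (Cmod u * rho)).
Proof.
  eapply is_series_ext; [|apply is_series_exp]. intros n.
  rewrite Cmod_exp_coef, Rpow_mult_distr. unfold Rdiv. rewrite Rmult_assoc, (Rmult_comm (rho ^ n)).
  symmetry. apply Rmult_assoc.
Qed.

Lemma majorized_Cexp (u : C) (rho : R) : majorized (fun z => Cexp (u * z)) rho (exp (Cmod u * rho)).
Proof.
  exists (exp_coef u). split.
  - exists (exp (Cmod u * rho)). split; [lra | apply is_series_Cmod_exp_coef].
  - intros z _. eapply is_series_ext; [|apply is_series_Cexp].
    intros n. symmetry. apply exp_coef_mult.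
Qed.

Lemma exp_coef_0 (u : C) : exp_coef u 0 = 1.
Proof. unfold exp_coef. simpl. field. Qed.

Lemma exp_coef_1 (u : C) : exp_coef u 1 = u.
Proof. unfold exp_coef. simpl. field. Qed.

Lemma Cis_series_shift (a : nat -> C) (l : C) :
  Cis_series a l -> Cis_series (fun n => a (S n)) (l - a 0%nat)%C.
Proof.
  intros H. apply is_series_incr_1.
  replace (plus _ _) with (l : C_NormedModule); [exact H|].
  change (l = (l - a 0%nat) + a 0%nat)%C. ring.
Qed.

Lemma is_series_shift (a : nat -> R) (l : R) :
  is_series a l -> is_series (fun n => a (S n)) (l - a 0%nat).
Proof.
  intros H. apply is_series_incr_1.
  replace (plus _ _) with (l : R_NormedModule); [exact H|].
  change (l = (l - a 0%nat) + a 0%nat). ring.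
Qed.

Lemma Cis_series_scal (c : C) (a : nat -> C) (l : C) :
  Cis_series a l -> Cis_series (fun n => c * a n)%C (c * l)%C.
Proof. apply (is_series_scal (V := C_NormedModule)). Qed.

Lemma Cis_series_ext (a b : nat -> C) (l l' : C) :
  (forall n, a n = b n) -> l = l' -> Cis_series a l -> Cis_series b l'.
Proof. intros E <-. now apply is_series_ext. Qed.

(** Factors without a pole take this form: 1 - zeta e^(uz) is (1 - zeta) (1 - c (e^(uz) - 1)) with c
    = zeta/(1 - zeta). *)
Lemma majorized_inv_exp (c u : C) (rho q : R) :
  0 < rho -> q < 1 -> Cmod c * (exp (Cmod u * rho) - 1) <= q ->
  majorized (fun z => / (1 - c * (Cexp (u * z) - 1)))%C rho (/ (1 - q)).
Proof.
  intros Hr Hq H.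
  apply (majorized_inv _ (fun n => c * exp_coef u (S n))%C); [exact Hr | exact Hq | |].
  - exists (Cmod c * (exp (Cmod u * rho) - 1)). split; [exact H|].
    pose proof (is_series_shift _ _ (is_series_Cmod_exp_coef u rho)) as E.
    apply (is_series_scal (Cmod c)) in E. cbv beta in E.
    rewrite exp_coef_0, Cmod_1 in E. simpl pow in E. rewrite Rmult_1_l in E.
    eapply is_series_ext; [|exact E].
    intros n. change (Cmod c * (Cmod (exp_coef u (S n)) * rho ^ S n) = Cmod (c * exp_coef u (S n)) * rho ^ S n).
    rewrite Cmod_mult. symmetry. apply Rmult_assoc.
  - intros z Hz.
    eapply Cis_series_ext; [| |apply (Cis_series_scal c), Cis_series_shift, (is_series_Cexp (u * z))].
    + intros n. cbv beta. rewrite <- exp_coef_mult. ring.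
    + now rewrite exp_coef_0.
Qed.

(** The quotient is -1/u times the inverse of 1 - g, where g = 1 - (e^(uz) - 1)/(uz) has no constant
    term. With y = |u| rho the coefficient norm of g is at most (y/2) e^y, by (n+2)! >= 2 n!, and
    this is at most y when e^y <= 2. *)
Lemma majorized_id_over_exp (u : C) (rho : R) :
  0 < rho -> u <> 0 -> Cmod u * rho < 1 -> exp (Cmod u * rho) <= 2 ->
  majorized (fun z => z / (1 - Cexp (u * z)))%C rho (/ Cmod u * / (1 - Cmod u * rho)).
Proof.
  intros Hr Hu Hq H2.
  assert (Hu0 : 0 < Cmod u) by now apply Cmod_gt_0.
  set (y := Cmod u * rho) in *.
  assert (Hy : 0 < y) by (apply Rmult_lt_0_compat; lra).
  apply majorized_ext with (F := (fun z => (- / u) * / (1 - (1 - (Cexp (u * z) - 1) / (u * z))))%C)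
    (M := Cmod (- / u) * / (1 - y)).
  { intros z [Hz _].
    assert (z <> 0) by (intros E; rewrite E, Cmod_0 in Hz; lra).
    (* If the exponential equals 1, both sides are 0 through the default [/ 0 = 0]. *)
    destruct (Ceq_dec (Cexp (u * z)) 1) as [E|E].
    - rewrite E. replace (1 - 1)%C with (RtoC 0) by ring.
      replace (1 - (1 - 0 / (u * z)))%C with (RtoC 0) by (field; now split).
      unfold Cdiv. replace (/ 0)%C with (RtoC 0); [ring|].
      unfold Cinv, RtoC. simpl. f_equal; unfold Rdiv; ring.
    - assert (E1 : (1 - Cexp (u * z))%C <> 0).
      { intros E'. apply E. transitivity (1 - (1 - Cexp (u * z)))%C; [ring | rewrite E'; ring]. }
      assert (E2 : (Cexp (u * z) - 1)%C <> 0).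
      { intros E'. apply E. transitivity (Cexp (u * z) - 1 + 1)%C; [ring | rewrite E'; ring]. }
      field. repeat split; try assumption.
      replace (u * z - (u * z - (Cexp (u * z) - 1)))%C with (Cexp (u * z) - 1)%C by ring. exact E2. }
  { rewrite Cmod_opp, Cmod_inv by exact Hu. lra. }
  apply majorized_mult; [exact Hr | apply majorized_const |].
  apply (majorized_inv _ (fun n => - / u * exp_coef u (S (S n)))%C); [exact Hr | exact Hq | |].
  - edestruct (is_series_dominated (fun n => Cmod (- / u * exp_coef u (S (S n))) * rho ^ S n)) as [l [Hl1 Hl2]].
    2:{ apply (is_series_scal (y / 2) (fun n => y ^ n / INR (fact n)) (exp y)), is_series_exp. }
    + intros n. split; [now apply Cmod_pow_nonneg|].
      rewrite Cmod_mult, Cmod_opp, Cmod_inv, Cmod_exp_coef by exact Hu.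
      change (/ Cmod u * (Cmod u ^ S (S n) / INR (fact (S (S n)))) * rho ^ S n <= y / 2 * (y ^ n / INR (fact n))).
      pose proof (INR_fact_lt_0 n). pose proof (INR_fact_lt_0 (S (S n))).
      replace (/ Cmod u * (Cmod u ^ S (S n) / INR (fact (S (S n)))) * rho ^ S n) with (y ^ S n * / INR (fact (S (S n)))).
      2:{ unfold y. rewrite Rpow_mult_distr. simpl. field. simpl in *. lra. }
      replace (y / 2 * (y ^ n / INR (fact n))) with (y ^ S n * / (2 * INR (fact n))) by (simpl; field; lra).
      apply Rmult_le_compat_l; [apply pow_le; lra|]. apply Rinv_le_contravar; [lra|].
      rewrite !fact_simpl, !mult_INR, !S_INR. pose proof (pos_INR n). nra.
    + exists l. split; [|exact Hl2]. eapply Rle_trans; [exact Hl1|].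
      change (y / 2 * exp y <= y). nra.
  - intros z [Hz _].
    assert (Hz0 : z <> 0) by (intros E; rewrite E, Cmod_0 in Hz; lra).
    eapply Cis_series_ext; [| |apply (Cis_series_scal (- / (u * z))), Cis_series_shift, Cis_series_shift, (is_series_Cexp (u * z))].
    + intros n. cbv beta. rewrite <- exp_coef_mult. rewrite (Cpow_S z (S n)). field. now split.
    + cbv beta. rewrite exp_coef_0, exp_coef_1. field. now split.
Qed.


(** * Uniqueness of the residue *)

Lemma CV_radius_ge (a : nat -> R) (x l : R) :
  is_series (fun n => a n * x ^ n) l -> Rbar_le (Rabs x) (CV_radius a).
Proof.
  intros H. apply Rbar_not_lt_le. intros H'.
  apply (CV_disk_outside a x H'). apply ex_series_lim_0. now exists l.
Qed.

Lemma is_series_PSeries (a : nat -> R) (x l : R) :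
  is_series (fun n => a n * x ^ n) l -> PSeries a x = l.
Proof.
  intros H. apply is_pseries_unique. unfold is_pseries.
  eapply is_series_ext; [|exact H]. intros n.
  transitivity (x ^ n * a n); [apply Rmult_comm | now rewrite <- pow_n_pow].
Qed.

Lemma CV_radius_incr_n (a : nat -> R) (n : nat) : CV_radius (PS_incr_n a n) = CV_radius a.
Proof. induction n as [|n IH]; [reflexivity|]. simpl. now rewrite CV_radius_incr_1. Qed.

(** In the application both products are x^(m + m' + 2) f(x), for one f expanded with pole orders
    [S m] and [S m']. As power series they agree coefficientwise, and the index [S m' + m] picks out
    the coefficient of x^(-1) in f. *)
Lemma series_shift_unique (a b : nat -> R) (m m' : nat) (r : R) (A B : R -> R) :
  0 < r ->
  (forall x, 0 < Rabs x < r -> is_series (fun n => a n * x ^ n) (A x) /\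
     is_series (fun n => b n * x ^ n) (B x) /\ x ^ S m' * A x = x ^ S m * B x) ->
  a m = b m'.
Proof.
  intros Hr H.
  assert (Hr2 : 0 < Rabs (r / 2) < r) by (rewrite Rabs_pos_eq; lra).
  destruct (H _ Hr2) as [Ha [Hb _]].
  apply CV_radius_ge in Ha. apply CV_radius_ge in Hb.
  assert (E : PS_incr_n a (S m') (S m' + m) = PS_incr_n b (S m) (S m' + m)).
  { apply PSeries_ext_recip.
    - rewrite CV_radius_incr_n. now apply Rbar_lt_le_trans with (2 := Ha).
    - rewrite CV_radius_incr_n. now apply Rbar_lt_le_trans with (2 := Hb).
    - exists (mkposreal r Hr). intros x Hx.
      change (Rabs (x - 0) < r) in Hx. rewrite Rminus_0_r in Hx.
      rewrite !PSeries_incr_n.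
      destruct (Req_dec x 0) as [-> | Hx0]; [simpl; ring|].
      destruct (H x) as [H1 [H2 H3]]; [split; [now apply Rabs_pos_lt | exact Hx]|].
      rewrite (is_series_PSeries _ _ _ H1), (is_series_PSeries _ _ _ H2). exact H3. }
  rewrite !PS_incr_n_simplify in E.
  destruct (Compare_dec.le_lt_dec (S m') (S m' + m)) as [_|]; [|lia].
  destruct (Compare_dec.le_lt_dec (S m) (S m' + m)) as [_|]; [|lia].
  replace (S m' + m - S m')%nat with m in E by lia.
  replace (S m' + m - S m)%nat with m' in E by lia. exact E.
Qed.

Lemma RtoC_Cpow_mult (x : R) (n : nat) (w : C) : (RtoC x ^ n * w)%C = (x ^ n * Re w, x ^ n * Im w).
Proof.
  rewrite <- RtoC_pow. destruct w as [p q]. unfold Cmult, RtoC; simpl. f_equal; ring.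
Qed.

(** Real displacements z - z0 already determine the coefficients, so the question splits into two
    about real power series. *)
Lemma is_residue_unique (f : C -> C) (z0 c c' : C) :
  is_residue f z0 c -> is_residue f z0 c' -> c = c'.
Proof.
  intros [m [a [r [Hr [Ha ->]]]]] [m' [a' [r' [Hr' [Ha' ->]]]]].
  assert (Hmin : 0 < Rmin r r') by now apply Rmin_glb_lt.
  assert (H : forall x, 0 < Rabs x < Rmin r r' ->
    Cis_series (fun n => RtoC x ^ n * a n)%C (RtoC x ^ S m * f (z0 + RtoC x))%C /\
    Cis_series (fun n => RtoC x ^ n * a' n)%C (RtoC x ^ S m' * f (z0 + RtoC x))%C).
  { intros x [Hx1 Hx2]. pose proof (Rmin_l r r'). pose proof (Rmin_r r r').
    assert (Ez : (z0 + RtoC x - z0)%C = RtoC x) by ring.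
    specialize (Ha (z0 + RtoC x)%C). specialize (Ha' (z0 + RtoC x)%C).
    rewrite Ez, Cmod_R in Ha, Ha'.
    specialize (Ha ltac:(lra)). specialize (Ha' ltac:(lra)).
    apply is_pseries_C in Ha. apply is_pseries_C in Ha'.
    split; (eapply Cis_series_ext; [intros n; apply Cmult_comm | reflexivity | assumption]). }
  assert (HC : forall x, 0 < Rabs x < Rmin r r' ->
    (is_series (fun n => Re (a n) * x ^ n) (x ^ S m * Re (f (z0 + RtoC x)%C)) /\
     is_series (fun n => Im (a n) * x ^ n) (x ^ S m * Im (f (z0 + RtoC x)%C))) /\
    (is_series (fun n => Re (a' n) * x ^ n) (x ^ S m' * Re (f (z0 + RtoC x)%C)) /\
     is_series (fun n => Im (a' n) * x ^ n) (x ^ S m' * Im (f (z0 + RtoC x)%C)))).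
  { intros x Hx. destruct (H x Hx) as [H1 H2].
    rewrite RtoC_Cpow_mult in H1, H2. apply is_series_C in H1. apply is_series_C in H2.
    destruct H1 as [H1 H1']. destruct H2 as [H2 H2'].
    repeat split; (eapply is_series_ext; [|eassumption]); intros n; cbv beta; rewrite RtoC_Cpow_mult; apply Rmult_comm. }
  apply injective_projections.
  - apply (series_shift_unique (fun n => Re (a n)) (fun n => Re (a' n)) m m' (Rmin r r')
      (fun x => x ^ S m * Re (f (z0 + RtoC x)%C)) (fun x => x ^ S m' * Re (f (z0 + RtoC x)%C)) Hmin).
    intros x Hx. destruct (HC x Hx) as [[H1 _] [H2 _]]. split; [exact H1|]. split; [exact H2 | ring].
  - apply (series_shift_unique (fun n => Im (a n)) (fun n => Im (a' n)) m m' (Rmin r r')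
      (fun x => x ^ S m * Im (f (z0 + RtoC x)%C)) (fun x => x ^ S m' * Im (f (z0 + RtoC x)%C)) Hmin).
    intros x Hx. destruct (HC x Hx) as [[_ H1] [_ H2]]. split; [exact H1|]. split; [exact H2 | ring].
Qed.

(** [Res] is a choice among residues, so uniqueness is what identifies it with the coefficient
    [a s]; that coefficient obeys |a_s| rho^s <= M. *)
Lemma Cmod_Res_le (f : C -> C) (z0 : C) (s : nat) (rho M : R) :
  0 < rho -> majorized (fun z => z ^ S s * f (z0 + z))%C rho M ->
  Cmod (Res f z0) <= M / rho ^ s.
Proof.
  intros Hr [a Ha].
  assert (Hres : is_residue f z0 (a s)).
  { exists s, a, rho. split; [exact Hr|]. split; [|reflexivity].
    intros z Hz. apply is_pseries_C. destruct Ha as [_ Ha].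
    specialize (Ha (z - z0)%C ltac:(lra)). cbv beta in Ha.
    replace (z0 + (z - z0))%C with z in Ha by ring. exact Ha. }
  rewrite (is_residue_unique f z0 (Res f z0) (a s)); [| |exact Hres].
  - apply (expands_coef _ _ _ _ s Hr) in Ha.
    assert (0 < rho ^ s) by now apply pow_lt.
    apply Rmult_le_reg_r with (rho ^ s); [assumption|].
    unfold Rdiv. rewrite Rmult_assoc, Rinv_l, Rmult_1_r by lra. exact Ha.
  - unfold Res. apply epsilon_spec. now exists (a s).
Qed.

(** * Products of chords of the unit circle *)

Definition peval (l : list C) (z : C) : C := fold_right (fun c acc => c + z * acc)%C (RtoC 0) l.

Lemma peval_div (l : list C) (a : C) :
  exists l', length l' = pred (length l) /\ forall z, peval l z = ((z - a) * peval l' z + peval l a)%C.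
Proof.
  induction l as [|c l IH].
  - exists []. split; [reflexivity|]. intros z. simpl. ring.
  - destruct l as [|d t].
    + exists []. split; [reflexivity|]. intros z. simpl. ring.
    + destruct IH as [l' [Hl' H]]. exists (peval (d :: t) a :: l'). split.
      * simpl in *. now rewrite Hl'.
      * intros z. change (peval (c :: d :: t) z) with (c + z * peval (d :: t) z)%C.
        change (peval (c :: d :: t) a) with (c + a * peval (d :: t) a)%C.
        change (peval (peval (d :: t) a :: l') z) with (peval (d :: t) a + z * peval l' z)%C.
        rewrite H. ring.
Qed.

Lemma peval_many_roots (r : list C) : NoDup r -> forall l, (length l <= length r)%nat ->
  (forall a, In a r -> peval l a = 0) -> forall z, peval l z = 0.
Proof.
  induction r as [|a r IH]; intros Hr l Hl H z.
  - destruct l; [reflexivity | simpl in Hl; lia].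
  - destruct (peval_div l a) as [l' [Hl' E]].
    rewrite E, (H a) by now left. rewrite (IH (proj2 (proj1 (NoDup_cons_iff _ _) Hr)) l'); [ring | simpl in Hl; lia |].
    intros b Hb. apply NoDup_cons_iff in Hr.
    assert (E' : ((b - a) * peval l' b)%C = 0).
    { rewrite <- (H b) by now right. rewrite (E b), (H a) by now left. ring. }
    destruct (Ceq_dec (peval l' b) 0) as [|N]; [assumption|].
    exfalso. assert (Hba : (b - a)%C <> 0).
    { intros Z. apply (proj1 Hr). replace a with b; [exact Hb|].
      transitivity (b - a + a)%C; [ring | rewrite Z; ring]. }
    exact (Cmult_neq_0 _ _ Hba N E').
Qed.

Definition poly_lt (n : nat) (f : C -> C) : Prop :=
  exists l, (length l <= n)%nat /\ forall z, f z = peval l z.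

Lemma poly_lt_le (n m : nat) (f : C -> C) : (n <= m)%nat -> poly_lt n f -> poly_lt m f.
Proof. intros H [l [Hl E]]. exists l. split; [lia | exact E]. Qed.

Lemma poly_lt_plus (n : nat) (f g : C -> C) :
  poly_lt n f -> poly_lt n g -> poly_lt n (fun z => f z + g z)%C.
Proof.
  assert (H : forall l l', exists l'', (length l'' <= max (length l) (length l'))%nat /\
              forall z, (peval l z + peval l' z)%C = peval l'' z).
  { induction l as [|c l IH]; intros l'.
    - exists l'. split; [simpl; lia|]. intros z. simpl. ring.
    - destruct l' as [|c' l'].
      + exists (c :: l). split; [simpl; lia|]. intros z. simpl. ring.
      + destruct (IH l') as [l'' [Hl E]]. exists ((c + c')%C :: l''). split; [simpl; lia|].
        intros z. simpl. rewrite <- E. ring. }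
  intros [l [Hl E]] [l' [Hl' E']]. destruct (H l l') as [l'' [Hl'' E'']].
  exists l''. split; [lia|]. intros z. now rewrite <- E'', E, E'.
Qed.

Lemma poly_lt_shift (n : nat) (f : C -> C) : poly_lt n f -> poly_lt (S n) (fun z => z * f z)%C.
Proof.
  intros [l [Hl E]]. exists (RtoC 0 :: l). split; [simpl; lia|].
  intros z. simpl. rewrite E. ring.
Qed.

Lemma poly_lt_scal (n : nat) (c : C) (f : C -> C) : poly_lt n f -> poly_lt n (fun z => c * f z)%C.
Proof.
  intros [l [Hl E]]. exists (map (Cmult c) l). split; [now rewrite length_map|].
  intros z. rewrite E. clear. induction l as [|d l IH]; simpl; [ring|]. rewrite <- IH. ring.
Qed.

Lemma poly_lt_ext (n : nat) (f g : C -> C) : (forall z, f z = g z) -> poly_lt n f -> poly_lt n g.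
Proof. intros E [l [Hl H]]. exists l. split; [exact Hl|]. intros z. now rewrite <- E. Qed.

Lemma poly_lt_pow (n : nat) : poly_lt (S n) (fun z => z ^ n)%C.
Proof.
  induction n as [|n IH].
  - exists [RtoC 1]. split; [simpl; lia|]. intros z. simpl. ring.
  - exact (poly_lt_shift _ _ IH).
Qed.

Lemma poly_lt_prod (r : list C) :
  poly_lt (length r) (fun z => Cprod r (fun a => z - a) - z ^ length r)%C.
Proof.
  induction r as [|a r IH].
  - exists []. split; [simpl; lia|]. intros z. unfold Cprod. simpl. ring.
  - eapply poly_lt_ext; [|apply poly_lt_plus; [exact (poly_lt_shift _ _ IH)|
      apply (poly_lt_scal _ (- a)), poly_lt_plus;
        [exact (poly_lt_le _ (length (a :: r)) _ (Nat.le_succ_diag_r _) IH) | exact (poly_lt_pow (length r))]]].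
    intros z. unfold Cprod. simpl. ring.
Qed.

(** Both sides are monic, so their difference has degree below the number of prescribed roots, yet
    it vanishes at all of them. *)
Lemma monic_factorization (r : list C) (g : C -> C) :
  NoDup r -> poly_lt (length r) g ->
  (forall a, In a r -> (a ^ length r + g a)%C = 0) ->
  forall z, (z ^ length r + g z)%C = Cprod r (fun a => z - a)%C.
Proof.
  intros Hr Hg H z.
  destruct (poly_lt_plus _ _ _ Hg (poly_lt_scal _ (-1) _ (poly_lt_prod r))) as [l [Hl E]].
  assert (Hz : forall a, In a r -> Cprod r (fun b => a - b)%C = 0).
  { intros a. clear. unfold Cprod. induction r as [|b r IH]; [easy|]. simpl. intros [->|Ha].
    - ring.
    - rewrite IH by exact Ha. ring. }
  assert (Z : peval l z = 0).
  { apply (peval_many_roots r Hr l Hl). intros a Ha. rewrite <- E, Hz by exact Ha.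
    transitivity (a ^ length r + g a)%C; [ring | now apply H]. }
  rewrite <- E in Z.
  transitivity (Cprod r (fun a => z - a) + (g z + -1 * (Cprod r (fun a => z - a) - z ^ length r)))%C;
    [ring | rewrite Z; ring].
Qed.

Definition Rsum {A : Type} (l : list A) (f : A -> R) : R := fold_right Rplus 0 (map f l).

Definition Rprod {A : Type} (l : list A) (f : A -> R) : R := fold_right Rmult 1 (map f l).

Lemma Cmod_Cprod {A : Type} (l : list A) (f : A -> C) : Cmod (Cprod l f) = Rprod l (fun a => Cmod (f a)).
Proof.
  induction l as [|a l IH]; unfold Cprod, Rprod in *; simpl.
  - apply Cmod_1.
  - now rewrite Cmod_mult, IH.
Qed.

Lemma Rprod_map {A B : Type} (g : A -> B) (l : list A) (f : B -> R) :
  Rprod (map g l) f = Rprod l (fun a => f (g a)).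
Proof. unfold Rprod. now rewrite map_map. Qed.

Lemma Rprod_ext_in {A : Type} (l : list A) (f g : A -> R) :
  (forall a, In a l -> f a = g a) -> Rprod l f = Rprod l g.
Proof. intros H. unfold Rprod. now rewrite (map_ext_in _ _ _ H). Qed.

(** * Points of the unit circle *)

Definition unit_root (x : R) : C := (cos (2 * PI * x), sin (2 * PI * x)).

(** The distance |1 - e(x)| from 1 to the point e(x) = e^(2 pi i x) of the unit circle. *)
Definition chord (x : R) : R := Rabs (2 * sin (PI * x)).

Lemma unit_root_plus (x y : R) : unit_root (x + y) = (unit_root x * unit_root y)%C.
Proof.
  unfold unit_root, Cmult. simpl. rewrite Rmult_plus_distr_l, cos_plus, sin_plus. f_equal. ring.
Qed.

Lemma unit_root_0 : unit_root 0 = 1.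
Proof. unfold unit_root. rewrite Rmult_0_r, cos_0, sin_0. reflexivity. Qed.

Lemma Cmod_unit_root (x : R) : Cmod (unit_root x) = 1.
Proof.
  unfold Cmod, unit_root. simpl. transitivity (sqrt 1); [f_equal | apply sqrt_1].
  pose proof (sin2_cos2 (2 * PI * x)) as H. unfold Rsqr in H. lra.
Qed.

Lemma unit_root_pow (x : R) (n : nat) : (unit_root x ^ n)%C = unit_root (INR n * x).
Proof.
  induction n as [|n IH].
  - simpl. now rewrite Rmult_0_l, unit_root_0.
  - rewrite Cpow_S, IH, <- unit_root_plus, S_INR. f_equal. ring.
Qed.

Lemma Cmod_1_minus_unit_root (x : R) : Cmod (1 - unit_root x)%C = chord x.
Proof.
  unfold Cmod, chord, unit_root. simpl. rewrite <- sqrt_Rsqr_abs. f_equal.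
  replace (2 * PI * x) with (2 * (PI * x)) by ring.
  rewrite cos_2a_sin, sin_2a.
  pose proof (sin2_cos2 (PI * x)) as H. unfold Rsqr in *.
  replace (cos (PI * x) * cos (PI * x)) with (1 - sin (PI * x) * sin (PI * x)) by lra.
  ring_simplify. nra.
Qed.

Lemma unit_root_IZR (n : Z) : unit_root (IZR n) = 1.
Proof.
  assert (H : forall m, unit_root (INR m) = 1).
  { intros m. rewrite <- (Rmult_1_r (INR m)), <- unit_root_pow.
    replace (unit_root 1) with (RtoC 1).
    - apply Cpow_1_l.
    - unfold unit_root. rewrite Rmult_1_r, cos_2PI, sin_2PI. reflexivity. }
  destruct (Z_le_gt_dec 0 n) as [Hn|Hn].
  - rewrite <- (Z2Nat.id n Hn), <- INR_IZR_INZ. apply H.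
  - transitivity (unit_root (IZR n) * unit_root (INR (Z.to_nat (- n))))%C; [rewrite H; ring|].
    rewrite <- unit_root_plus, INR_IZR_INZ, Z2Nat.id by lia.
    rewrite <- plus_IZR, Z.add_opp_diag_r. apply unit_root_0.
Qed.

Lemma unit_root_eq_1 (x : R) : unit_root x = 1 -> exists n : Z, x = IZR n.
Proof.
  intros H. pose proof (Cmod_1_minus_unit_root x) as E. rewrite H in E.
  replace (1 - 1)%C with (RtoC 0) in E by ring. rewrite Cmod_0 in E. unfold chord in E.
  assert (S : sin (PI * x) = 0).
  { symmetry in E. apply Rabs_eq_0 in E. lra. }
  apply sin_eq_0_0 in S. destruct S as [n Hn]. exists n.
  pose proof PI_RGT_0. apply Rmult_eq_reg_l with PI; lra.
Qed.

Lemma chord_IZR_period (x : R) (n : Z) : chord (x + IZR n) = chord x.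
Proof.
  now rewrite <- !Cmod_1_minus_unit_root, unit_root_plus, unit_root_IZR, Cmult_1_r.
Qed.

Lemma chord_opp (x : R) : chord (- x) = chord x.
Proof.
  unfold chord. replace (PI * - x) with (- (PI * x)) by ring. rewrite sin_neg.
  replace (2 * - sin (PI * x)) with (- (2 * sin (PI * x))) by ring. apply Rabs_Ropp.
Qed.

Lemma unit_root_inj_mod (a : Z) (q i j : nat) :
  (0 < q)%nat -> Z.gcd a (Z.of_nat q) = 1%Z -> (i < q)%nat -> (j < q)%nat ->
  unit_root (INR i * (IZR a / INR q)) = unit_root (INR j * (IZR a / INR q)) -> i = j.
Proof.
  intros Hq Hg Hi Hj H.
  assert (Q : 0 < INR q) by now apply lt_0_INR.
  assert (E : unit_root ((INR i - INR j) * (IZR a / INR q)) = 1).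
  { replace ((INR i - INR j) * (IZR a / INR q)) with
      (INR i * (IZR a / INR q) + - (INR j * (IZR a / INR q))) by ring.
    rewrite unit_root_plus, H, <- unit_root_plus, Rplus_opp_r. apply unit_root_0. }
  apply unit_root_eq_1 in E. destruct E as [n E].
  assert (E' : ((Z.of_nat i - Z.of_nat j) * a = n * Z.of_nat q)%Z).
  { apply eq_IZR. rewrite !mult_IZR, minus_IZR, <- !INR_IZR_INZ, <- E. field. lra. }
  assert (D : (Z.of_nat q | Z.of_nat i - Z.of_nat j)%Z).
  { apply Z.gauss with a; [|now rewrite Z.gcd_comm].
    exists n. now rewrite Z.mul_comm. }
  destruct D as [c Hc]. assert (c = 0)%Z by nia. lia.
Qed.

Lemma NoDup_unit_roots (a : Z) (q s n : nat) :
  (0 < q)%nat -> Z.gcd a (Z.of_nat q) = 1%Z -> (s + n <= q)%nat ->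
  NoDup (map (fun r => unit_root (INR r * (IZR a / INR q))) (seq s n)).
Proof.
  intros Hq Hg Hn. apply NoDup_map_NoDup_ForallPairs; [|apply seq_NoDup].
  intros i j Hi Hj H. apply in_seq in Hi. apply in_seq in Hj.
  apply unit_root_inj_mod with (5 := H); try assumption; lia.
Qed.

(** The numbers e(ra/q) are all the q-th roots of unity; take moduli in z^q - 1 = product of the z -
    e(ra/q) at z = e(-x). *)
Lemma prod_chord_translates (a : Z) (q : nat) (x : R) :
  (0 < q)%nat -> Z.gcd a (Z.of_nat q) = 1%Z ->
  Rprod (seq 0 q) (fun r => chord (x + INR r * (IZR a / INR q))) = chord (INR q * x).
Proof.
  intros Hq Hg. assert (Q : 0 < INR q) by now apply lt_0_INR.
  pose proof (monic_factorization (map (fun r => unit_root (INR r * (IZR a / INR q))) (seq 0 q)) (fun _ => -1)%C) as M.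
  rewrite length_map, length_seq in M.
  specialize (M (NoDup_unit_roots a q 0 q Hq Hg (le_n _))).
  assert (M1 : poly_lt q (fun _ => RtoC (-1))).
  { exists [RtoC (-1)]. split; [simpl; lia|]. intros z. simpl. ring. }
  specialize (M M1).
  assert (M2 : forall b, In b (map (fun r => unit_root (INR r * (IZR a / INR q))) (seq 0 q)) -> (b ^ q + -1)%C = 0).
  { intros b Hb. apply in_map_iff in Hb. destruct Hb as [r [<- _]].
    rewrite unit_root_pow. replace (INR q * (INR r * (IZR a / INR q))) with (IZR (Z.of_nat r * a)).
    - rewrite unit_root_IZR. ring.
    - rewrite mult_IZR, <- INR_IZR_INZ. field. lra. }
  specialize (M M2 (unit_root (- x))). apply (f_equal Cmod) in M.
  rewrite Cmod_Cprod, Rprod_map in M.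
  rewrite <- (Cmod_1_minus_unit_root (INR q * x)).
  transitivity (Cmod (unit_root (- x) ^ q + -1)%C).
  - rewrite M. apply Rprod_ext_in. intros r _.
    rewrite <- Cmod_1_minus_unit_root, unit_root_plus.
    match goal with |- Cmod ?w = _ => transitivity (Cmod (unit_root (- x)) * Cmod w);
      [rewrite Cmod_unit_root; symmetry; apply Rmult_1_l|] end.
    rewrite <- Cmod_mult. f_equal.
    transitivity (unit_root (- x) - (unit_root (- x) * unit_root x) * unit_root (INR r * (IZR a / INR q)))%C; [ring|].
    rewrite <- (unit_root_plus (- x) x), Rplus_opp_l, unit_root_0. ring.
  - rewrite unit_root_pow.
    transitivity (Cmod (unit_root (INR q * - x)) * Cmod (1 - unit_root (INR q * x))%C);
      [|rewrite Cmod_unit_root; apply Rmult_1_l].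
    rewrite <- Cmod_mult. f_equal.
    transitivity (unit_root (INR q * - x) - (unit_root (INR q * - x) * unit_root (INR q * x)))%C; [|ring].
    rewrite <- unit_root_plus. replace (INR q * - x + INR q * x) with 0 by ring. rewrite unit_root_0. ring.
Qed.

(** Evaluate (z^q - 1)/(z - 1) = 1 + z + ... + z^(q-1), the product over the nontrivial roots of
    unity, at z = 1. *)
Lemma prod_chord_nontrivial (a : Z) (q : nat) :
  (0 < q)%nat -> Z.gcd a (Z.of_nat q) = 1%Z ->
  Rprod (seq 1 (q - 1)) (fun r => chord (INR r * (IZR a / INR q))) = INR q.
Proof.
  intros Hq Hg. assert (Q : 0 < INR q) by now apply lt_0_INR.
  destruct q as [|n]; [lia|]. replace (S n - 1)%nat with n by lia.
  set (geom := fix geom (m : nat) (z : C) : C := match m with O => RtoC 0 | S m => (z ^ m + geom m z)%C end).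
  assert (G1 : forall m, poly_lt m (geom m)).
  { induction m as [|m IH].
    - exists []. split; [simpl; lia | reflexivity].
    - eapply poly_lt_ext; [|apply poly_lt_plus; [apply poly_lt_pow | exact (poly_lt_le _ _ _ (Nat.le_succ_diag_r _) IH)]].
      reflexivity. }
  assert (G2 : forall m z, ((z - 1) * geom m z = z ^ m - 1)%C).
  { induction m as [|m IH]; intros z; simpl; [ring|].
    transitivity ((z - 1) * z ^ m + (z - 1) * geom m z)%C; [ring|]. rewrite IH. ring. }
  assert (G3 : forall m, geom m 1 = RtoC (INR m)).
  { induction m as [|m IH]; [reflexivity|]. rewrite S_INR, RtoC_plus, <- IH. simpl. rewrite Cpow_1_l. ring. }
  set (l := map (fun r => unit_root (INR r * (IZR a / INR (S n)))) (seq 1 n)).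
  pose proof (monic_factorization l (geom n)) as M.
  assert (L : length l = n) by (unfold l; now rewrite length_map, length_seq).
  rewrite L in M.
  specialize (M (NoDup_unit_roots a (S n) 1 n Hq Hg (le_n _)) (G1 n)).
  assert (M2 : forall b, In b l -> (b ^ n + geom n b)%C = 0).
  { intros b Hb. apply in_map_iff in Hb. destruct Hb as [r [<- Hr]]. apply in_seq in Hr.
    set (b := unit_root _).
    assert (Hb : (b - 1)%C <> 0).
    { intros E. assert (r = 0)%nat; [|lia].
      apply (unit_root_inj_mod a (S n)); try assumption; try lia.
      fold b. simpl INR at 1. rewrite Rmult_0_l, unit_root_0.
      transitivity (b - 1 + 1)%C; [ring | rewrite E; ring]. }
    assert (E : ((b - 1) * (b ^ n + geom n b))%C = 0).
    { change (b ^ n + geom n b)%C with (geom (S n) b). rewrite G2. unfold b. rewrite unit_root_pow.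
      replace (INR (S n) * (INR r * (IZR a / INR (S n)))) with (IZR (Z.of_nat r * a)).
      - rewrite unit_root_IZR. ring.
      - rewrite mult_IZR, <- INR_IZR_INZ. field. lra. }
    destruct (Ceq_dec (b ^ n + geom n b) 0) as [|N]; [assumption|].
    exfalso. exact (Cmult_neq_0 _ _ Hb N E). }
  specialize (M M2 1%C).
  change (1 ^ n + geom n 1)%C with (geom (S n) 1) in M. rewrite G3 in M.
  apply (f_equal Cmod) in M. rewrite Cmod_R, Rabs_pos_eq in M by lra. etransitivity; [|symmetry; exact M].
  unfold l. rewrite Cmod_Cprod, Rprod_map. apply Rprod_ext_in.
  intros r _. symmetry; apply Cmod_1_minus_unit_root.
Qed.

(** * Residue classes and Dirichlet approximation *)

Lemma Rsum_cons {A : Type} (a : A) (l : list A) (f : A -> R) : Rsum (a :: l) f = f a + Rsum l f.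
Proof. reflexivity. Qed.

Lemma Rsum_app {A : Type} (l l' : list A) (f : A -> R) : Rsum (l ++ l') f = Rsum l f + Rsum l' f.
Proof.
  induction l as [|a l IH]; simpl.
  - change (Rsum l' f = 0 + Rsum l' f). ring.
  - rewrite !Rsum_cons, IH. ring.
Qed.

Lemma Rsum_map {A B : Type} (g : A -> B) (l : list A) (f : B -> R) :
  Rsum (map g l) f = Rsum l (fun a => f (g a)).
Proof. unfold Rsum. now rewrite map_map. Qed.

Lemma Rsum_ext_in {A : Type} (l : list A) (f g : A -> R) :
  (forall a, In a l -> f a = g a) -> Rsum l f = Rsum l g.
Proof. intros H. unfold Rsum. now rewrite (map_ext_in _ _ _ H). Qed.

Lemma Rsum_le {A : Type} (l : list A) (f g : A -> R) :
  (forall a, In a l -> f a <= g a) -> Rsum l f <= Rsum l g.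
Proof.
  induction l as [|a l IH]; intros H; [apply Rle_refl|].
  rewrite !Rsum_cons. apply Rplus_le_compat; [apply H; now left|].
  apply IH. intros b Hb. apply H. now right.
Qed.

Lemma Rsum_nonneg {A : Type} (l : list A) (f : A -> R) :
  (forall a, In a l -> 0 <= f a) -> 0 <= Rsum l f.
Proof.
  induction l as [|a l IH]; intros H; [apply Rle_refl|].
  rewrite Rsum_cons. apply Rplus_le_le_0_compat; [apply H; now left|].
  apply IH. intros b Hb. apply H. now right.
Qed.

Lemma Rsum_plus {A : Type} (l : list A) (f g : A -> R) :
  Rsum l (fun a => f a + g a) = Rsum l f + Rsum l g.
Proof.
  induction l as [|a l IH]; [unfold Rsum; simpl; ring|].
  rewrite !Rsum_cons, IH. ring.
Qed.

Lemma Rsum_scal {A : Type} (c : R) (l : list A) (f : A -> R) :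
  Rsum l (fun a => c * f a) = c * Rsum l f.
Proof.
  induction l as [|a l IH]; [unfold Rsum; simpl; ring|].
  rewrite !Rsum_cons, IH. ring.
Qed.

Lemma Rsum_const {A : Type} (c : R) (l : list A) : Rsum l (fun _ => c) = INR (length l) * c.
Proof.
  induction l as [|a l IH]; [unfold Rsum; simpl; ring|].
  rewrite Rsum_cons, IH. simpl length. rewrite S_INR. ring.
Qed.

Lemma Rsum_le_const {A : Type} (c : R) (l : list A) (f : A -> R) :
  (forall a, In a l -> f a <= c) -> Rsum l f <= INR (length l) * c.
Proof. intros H. rewrite <- Rsum_const. now apply Rsum_le. Qed.

Lemma Rsum_incl_le {A : Type} (l l' : list A) (f : A -> R) :
  NoDup l -> incl l l' -> (forall a, In a l' -> 0 <= f a) -> Rsum l f <= Rsum l' f.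
Proof.
  intros Hl. revert l'. induction Hl as [|a l Ha Hl IH]; intros l' Hi Hf.
  - now apply Rsum_nonneg.
  - destruct (in_split a l' (Hi a (or_introl eq_refl))) as [l1 [l2 ->]].
    rewrite Rsum_app, !Rsum_cons.
    assert (H : Rsum l f <= Rsum (l1 ++ l2) f).
    { apply IH.
      - intros b Hb.
        specialize (Hi b (or_intror Hb)). apply in_app_iff in Hi. apply in_app_iff.
        destruct Hi as [|[|]]; [now left | congruence | now right].
      - intros b Hb. apply Hf. apply in_app_iff in Hb. apply in_app_iff. simpl. tauto. }
    rewrite Rsum_app in H. lra.
Qed.

Lemma Rsum_exchange {A B : Type} (l : list A) (l' : list B) (f : A -> B -> R) :
  Rsum l (fun a => Rsum l' (f a)) = Rsum l' (fun b => Rsum l (fun a => f a b)).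
Proof.
  induction l as [|a l IH].
  - unfold Rsum at 1. simpl. rewrite (Rsum_const 0). ring.
  - rewrite Rsum_cons, IH, <- Rsum_plus. apply Rsum_ext_in. reflexivity.
Qed.

Lemma ln_Rprod {A : Type} (l : list A) (f : A -> R) :
  (forall a, In a l -> 0 < f a) -> 0 < Rprod l f /\ ln (Rprod l f) = Rsum l (fun a => ln (f a)).
Proof.
  induction l as [|a l IH]; intros H.
  - unfold Rprod, Rsum. simpl. split; [lra | apply ln_1].
  - destruct IH as [IH1 IH2]; [intros b Hb; apply H; now right|].
    assert (Ha : 0 < f a) by (apply H; now left).
    change (Rprod (a :: l) f) with (f a * Rprod l f). rewrite Rsum_cons, <- IH2.
    split; [now apply Rmult_lt_0_compat | now apply ln_mult].
Qed.

(* k times the distance from j h / k to the nearest integer *)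
Definition near (h k j : nat) : nat := Nat.min ((j * h) mod k) (k - (j * h) mod k).

Lemma Zgcd_of_nat_1 (h k : nat) :
  Nat.gcd h k = 1%nat -> Z.gcd (Z.of_nat h) (Z.of_nat k) = 1%Z.
Proof.
  intros H. set (g := Z.gcd (Z.of_nat h) (Z.of_nat k)).
  pose proof (Z.gcd_nonneg (Z.of_nat h) (Z.of_nat k)) as G0. fold g in G0.
  assert (D : forall n, (g | Z.of_nat n)%Z -> Nat.divide (Z.to_nat g) n).
  { intros n [c Hc]. destruct (Z.eq_dec g 0) as [G|G].
    - exists 0%nat. rewrite G, Z.mul_0_r in Hc. lia.
    - exists (Z.to_nat c). assert (0 <= c)%Z by nia. apply Nat2Z.inj.
      rewrite Nat2Z.inj_mul, !Z2Nat.id by assumption. exact Hc. }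
  assert (N : Nat.divide (Z.to_nat g) 1).
  { rewrite <- H. apply Nat.gcd_greatest; apply D.
    - apply Z.gcd_divide_l.
    - apply Z.gcd_divide_r. }
  apply Nat.divide_1_r in N. lia.
Qed.

Lemma mod_mult_inj (h k i j : nat) :
  Nat.gcd h k = 1%nat -> (i < k)%nat -> (j < k)%nat ->
  ((i * h) mod k = (j * h) mod k)%nat -> i = j.
Proof.
  intros Hg Hi Hj H.
  assert (D : (Z.of_nat k | Z.of_nat h * (Z.of_nat i - Z.of_nat j))%Z).
  { exists (Z.of_nat (i * h / k) - Z.of_nat (j * h / k))%Z.
    pose proof (Nat.div_mod_eq (i * h) k) as E1. pose proof (Nat.div_mod_eq (j * h) k) as E2.
    rewrite H in E1. nia. }
  apply Z.gauss in D.
  - destruct D as [c Hc]. assert (c = 0)%Z by nia. lia.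
  - rewrite Z.gcd_comm. now apply Zgcd_of_nat_1.
Qed.

Lemma near_pos (h k j : nat) :
  Nat.gcd h k = 1%nat -> (0 < j < k)%nat -> (0 < near h k j)%nat /\ (2 * near h k j <= k)%nat.
Proof.
  intros Hg Hj. unfold near.
  assert (N : ((j * h) mod k <> 0)%nat).
  { intros E. assert (j = 0)%nat; [|lia]. apply (mod_mult_inj h k); try assumption; try lia.
    rewrite E. now rewrite Nat.Div0.mod_0_l. }
  pose proof (Nat.mod_upper_bound (j * h) k). lia.
Qed.

(** Since j -> jh mod k is injective, each value of [near] is attained at most twice, from a residue
    r and from k - r. *)
Lemma Rsum_near_le (h k m : nat) (v : nat -> R) :
  Nat.gcd h k = 1%nat -> (m < k)%nat -> (forall r, 0 <= v r) ->
  Rsum (seq 1 m) (fun j => v (near h k j)) <= 2 * Rsum (seq 1 (k / 2)) v.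
Proof.
  intros Hg Hm Hv.
  (* Cutting v off beyond k/2 lets min(r, k - r) be charged to r or to k - r, whichever is at most
     k/2. *)
  set (w := fun r => if (2 * r <=? k)%nat then v r else 0).
  assert (Hw : forall r, 0 <= w r) by (intros r; unfold w; destruct (2 * r <=? k)%nat; [apply Hv | lra]).
  assert (Hk : (2 * (k / 2) <= k)%nat) by apply Nat.Div0.mul_div_le.
  assert (Hk' : (k < 2 * (k / 2) + 2)%nat).
  { pose proof (Nat.div_mod_eq k 2). pose proof (Nat.mod_upper_bound k 2). lia. }
  assert (W : Rsum (seq 1 (k - 1)) w <= Rsum (seq 1 (k / 2)) v).
  { destruct (Nat.eq_dec k 1) as [->|]; [apply Rle_refl|].
    replace (k - 1)%nat with (k / 2 + (k - 1 - k / 2))%nat by lia.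
    rewrite seq_app, Rsum_app.
    rewrite (Rsum_ext_in (seq (1 + k / 2) _) w (fun _ => 0)).
    - rewrite Rsum_const, Rmult_0_r, Rplus_0_r. apply Rsum_le. intros r Hr. unfold w.
      destruct (2 * r <=? k)%nat; [apply Rle_refl | apply Hv].
    - intros r Hr. apply in_seq in Hr. unfold w. destruct (Nat.leb_spec (2 * r) k); [lia | reflexivity]. }
  assert (W' : Rsum (seq 1 (k - 1)) (fun r => w (k - r)%nat) <= Rsum (seq 1 (k - 1)) w).
  { rewrite <- (Rsum_map (fun r => (k - r)%nat)). apply Rsum_incl_le; [| |intros r _; apply Hw].
    - apply NoDup_map_NoDup_ForallPairs; [|apply seq_NoDup].
      intros a b Ha Hb E. apply in_seq in Ha. apply in_seq in Hb. lia.
    - intros r Hr. apply in_map_iff in Hr. destruct Hr as [a [<- Ha]]. apply in_seq in Ha.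
      apply in_seq. lia. }
  apply Rle_trans with (Rsum (seq 1 (k - 1)) (fun r => v (Nat.min r (k - r)))).
  - unfold near. rewrite <- (Rsum_map (fun j => ((j * h) mod k)%nat) _ (fun r => v (Nat.min r (k - r)))).
    apply Rsum_incl_le; [| |intros r _; apply Hv].
    + apply NoDup_map_NoDup_ForallPairs; [|apply seq_NoDup].
      intros a b Ha Hb E. apply in_seq in Ha. apply in_seq in Hb.
      apply (mod_mult_inj h k); try assumption; lia.
    + intros r Hr. apply in_map_iff in Hr. destruct Hr as [a [<- Ha]]. apply in_seq in Ha.
      destruct (near_pos h k a Hg) as [N _]; [lia|]. unfold near in N.
      pose proof (Nat.mod_upper_bound (a * h) k). apply in_seq. lia.
  - apply Rle_trans with (Rsum (seq 1 (k - 1)) (fun r => w r + w (k - r)%nat)).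
    + apply Rsum_le. intros r Hr. apply in_seq in Hr.
      unfold w. destruct (Nat.leb_spec (2 * r) k).
      * rewrite Nat.min_l by lia. destruct (2 * (k - r) <=? k)%nat; [pose proof (Hv (k - r)%nat)|]; lra.
      * rewrite Nat.min_r by lia. destruct (Nat.leb_spec (2 * (k - r)) k); [lra | lia].
    + rewrite Rsum_plus. lra.
Qed.

(** * Lower bounds for chords, and Dirichlet's theorem *)

Lemma sin_Jordan (t : R) : 0 <= t <= PI / 2 -> 2 * t <= PI * sin t.
Proof.
  intros [H0 H1].
  destruct (Req_dec t 0) as [->|N0]; [rewrite sin_0; lra|].
  destruct (Req_dec t (PI / 2)) as [->|N1]; [rewrite sin_PI2; lra|].
  assert (D : forall x, derivable_pt_lim sin x (cos x)) by apply derivable_pt_lim_sin.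
  (* Concavity: the mean slopes of sine on [0, t] and [t, PI/2] are values of the decreasing cosine
     at ordered points. *)
  destruct (MVT_gen sin 0 t cos) as [c1 [Hc1 E1]].
  { intros x _. apply is_derive_Reals, D. }
  { intros x _. apply continuity_sin. }
  destruct (MVT_gen sin t (PI / 2) cos) as [c2 [Hc2 E2]].
  { intros x _. apply is_derive_Reals, D. }
  { intros x _. apply continuity_sin. }
  rewrite Rmin_left, Rmax_right in Hc1 by lra. rewrite Rmin_left, Rmax_right in Hc2 by lra.
  rewrite sin_0 in E1. rewrite sin_PI2 in E2.
  assert (C : cos c2 <= cos c1).
  { destruct (Req_dec c1 c2) as [->|]; [lra|]. left. apply cos_decreasing_1; lra. }
  assert (t * ((PI / 2 - t) * cos c2) <= t * ((PI / 2 - t) * cos c1)).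
  { apply Rmult_le_compat_l; [lra|]. apply Rmult_le_compat_l; lra. }
  nra.
Qed.

Lemma chord_lower (y : R) : 0 <= y <= 1 / 2 -> 4 * y <= chord y.
Proof.
  intros Hy. pose proof PI_RGT_0. unfold chord.
  eapply Rle_trans; [|apply Rle_abs].
  pose proof (sin_Jordan (PI * y)) as J. nra.
Qed.

Lemma chord_near (h k j : nat) :
  (0 < k)%nat -> chord (INR j * (INR h / INR k)) = chord (INR (near h k j) / INR k).
Proof.
  intros Hk. assert (K : 0 < INR k) by now apply lt_0_INR.
  assert (E : chord (INR j * (INR h / INR k)) = chord (INR ((j * h) mod k) / INR k)).
  { rewrite <- (chord_IZR_period (INR ((j * h) mod k) / INR k) (Z.of_nat (j * h / k))).
    f_equal. rewrite <- INR_IZR_INZ.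
    pose proof (f_equal INR (Nat.div_mod_eq (j * h) k)) as E. rewrite mult_INR, plus_INR, mult_INR in E.
    apply Rmult_eq_reg_r with (INR k); [|lra]. field_simplify; [|lra|lra]. lra. }
  rewrite E. unfold near.
  pose proof (Nat.mod_upper_bound (j * h) k ltac:(lia)).
  destruct (Nat.min_spec ((j * h) mod k) (k - (j * h) mod k)) as [[_ ->]|[_ ->]]; [reflexivity|].
  rewrite minus_INR by lia.
  replace ((INR k - INR ((j * h) mod k)) / INR k) with (- (INR ((j * h) mod k) / INR k) + IZR 1) by (field; lra).
  now rewrite chord_IZR_period, chord_opp.
Qed.

Lemma chord_fraction_lower (h k j : nat) :
  Nat.gcd h k = 1%nat -> (0 < j < k)%nat ->
  4 * INR (near h k j) / INR k <= chord (INR j * (INR h / INR k)).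
Proof.
  intros Hg Hj. rewrite chord_near by lia.
  destruct (near_pos h k j Hg Hj) as [_ N].
  assert (K : 0 < INR k) by (apply lt_0_INR; lia).
  unfold Rdiv. rewrite Rmult_assoc. apply chord_lower. split.
  - apply Rmult_le_pos; [apply pos_INR | left; now apply Rinv_0_lt_compat].
  - apply Rmult_le_reg_r with (INR k); [exact K|]. rewrite Rmult_assoc, Rinv_l by lra.
    apply le_INR in N. rewrite mult_INR in N. simpl in N. lra.
Qed.

(** Pigeonhole: two of the Q + 1 multiples jh/k, for j from 0 to Q, have fractional parts in the
    same of Q equal boxes. Dividing out the gcd makes the resulting fraction reduced and can only
    shrink the error. *)
Lemma Dirichlet_approximation (h k Q : nat) :
  (0 < k)%nat -> (0 < Q)%nat ->
  exists (q : nat) (a : Z), (1 <= q <= Q)%nat /\ Z.gcd a (Z.of_nat q) = 1%Z /\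
    (Z.abs (Z.of_nat h * Z.of_nat q - a * Z.of_nat k) * Z.of_nat Q <= Z.of_nat k)%Z.
Proof.
  intros Hk HQ.
  set (f := fun j => (Q * ((j * h) mod k) / k)%nat).
  assert (P : exists i j, (i < j <= Q)%nat /\ f i = f j).
  { apply NNPP. intros N.
    assert (ND : NoDup (map f (seq 0 (S Q)))).
    { apply NoDup_map_NoDup_ForallPairs; [|apply seq_NoDup].
      intros i j Hi Hj E. apply in_seq in Hi. apply in_seq in Hj.
      destruct (Nat.lt_trichotomy i j) as [H|[H|H]]; [|assumption|]; exfalso; apply N.
      - exists i, j. split; [lia | exact E].
      - exists j, i. split; [lia | easy]. }
    assert (I : incl (map f (seq 0 (S Q))) (seq 0 Q)).
    { intros r Hr. apply in_map_iff in Hr. destruct Hr as [j [<- _]]. apply in_seq. split; [lia|].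
      unfold f. simpl. apply Nat.Div0.div_lt_upper_bound.
      pose proof (Nat.mod_upper_bound (j * h) k). nia. }
    pose proof (NoDup_incl_length ND I) as L. rewrite length_map, !length_seq in L. lia. }
  destruct P as [i [j [Hij E]]].
  set (q := Z.of_nat (j - i)). set (a := (Z.of_nat (j * h / k) - Z.of_nat (i * h / k))%Z).
  assert (B : (Z.abs (Z.of_nat h * q - a * Z.of_nat k) * Z.of_nat Q <= Z.of_nat k)%Z).
  { unfold f in E. unfold q, a.
    pose proof (Nat.div_mod_eq (i * h) k) as E1. pose proof (Nat.div_mod_eq (j * h) k) as E2.
    pose proof (Nat.div_mod_eq (Q * ((i * h) mod k)) k) as E3.
    pose proof (Nat.div_mod_eq (Q * ((j * h) mod k)) k) as E4.
    pose proof (Nat.mod_upper_bound (Q * ((i * h) mod k)) k ltac:(lia)).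
    pose proof (Nat.mod_upper_bound (Q * ((j * h) mod k)) k ltac:(lia)).
    rewrite E in E3. 
    replace (Z.of_nat h * Z.of_nat (j - i) - (Z.of_nat (j * h / k) - Z.of_nat (i * h / k)) * Z.of_nat k)%Z
      with (Z.of_nat ((j * h) mod k) - Z.of_nat ((i * h) mod k))%Z by nia.
    nia. }
  set (g := Z.gcd q a).
  assert (Hg : (0 < g)%Z).
  { assert (g <> 0)%Z; [|pose proof (Z.gcd_nonneg q a); unfold g in *; lia].
    intros Z0. apply Z.gcd_eq_0_l in Z0. unfold q in Z0. lia. }
  destruct (Z.gcd_divide_l q a) as [q' Hq']. destruct (Z.gcd_divide_r q a) as [a' Ha'].
  fold g in Hq', Ha'.
  exists (Z.to_nat q'), a'. rewrite Z2Nat.id by lia.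
  split; [|split].
  - unfold q in Hq'. nia.
  - assert (G : Z.gcd q' a' = 1%Z); [|now rewrite Z.gcd_comm].
    pose proof (Z.gcd_mul_mono_r q' a' g) as M. rewrite <- Hq', <- Ha' in M. fold g in M. 
    pose proof (Z.gcd_nonneg q' a'). nia.
  - eapply Z.le_trans; [|exact B]. apply Z.mul_le_mono_nonneg_r; [lia|].
    rewrite Hq', Ha'.
    replace (Z.of_nat h * (q' * g) - a' * g * Z.of_nat k)%Z with ((Z.of_nat h * q' - a' * Z.of_nat k) * g)%Z by ring.
    rewrite Z.abs_mul. nia.
Qed.

(** * The Clausen integral *)

Lemma PI_bounds : 3.14 < PI < 3.15.
Proof.
  destruct (PI_2_3_7_ineq 1) as [H1 H2].
  unfold PI_2_3_7_tg, tg_alt, Ratan_seq in *. simpl in H1, H2. lra.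
Qed.

Lemma sin_lower (x : R) : 0 <= x <= PI -> x - x ^ 3 / 6 <= sin x.
Proof.
  intros Hx. destruct (sin_bound x 0) as [H _]; [lra | lra |].
  unfold sin_approx, sin_term in H. simpl in H. simpl. lra.
Qed.

Lemma sin_upper (x : R) : 0 <= x -> sin x <= x.
Proof.
  intros [H | <-]; [left; now apply sin_lt_x | rewrite sin_0; lra].
Qed.

Lemma ln_le_sub1 (x : R) : 0 < x -> ln x <= x - 1.
Proof.
  intros H. rewrite <- (exp_ln x H) at 2. pose proof (exp_ineq1_le (ln x)). lra.
Qed.

(** Raising 1 + 1/4 <= e^(1/4) to the n-th power is sharp enough for 35 <= e^4 and 14 <= e^3. *)
Lemma exp_quarter_lower (n : nat) : 1.25 ^ n <= exp (INR n / 4).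
Proof.
  induction n as [|n IH].
  - simpl. unfold Rdiv. rewrite Rmult_0_l, exp_0. lra.
  - rewrite S_INR. replace ((INR n + 1) / 4) with (1 / 4 + INR n / 4) by field. rewrite exp_plus. simpl pow.
    apply Rmult_le_compat; [lra | apply pow_le; lra | | exact IH]. pose proof (exp_ineq1_le (1 / 4)). lra.
Qed.

Definition Cl2_integrand (x : R) : R := - ln (Rabs (2 * sin (x / 2))).

Lemma half_sin_pos (x : R) : 0 < x <= PI / 3 -> 0 < 2 * sin (x / 2).
Proof.
  intros Hx. pose proof PI_RGT_0. assert (0 < sin (x / 2)) by (apply sin_gt_0; lra). lra.
Qed.

Lemma Cl2_integrand_lower (x : R) : 0 < x <= PI / 3 -> - ln x <= Cl2_integrand x.
Proof.
  intros Hx. pose proof (half_sin_pos x Hx). unfold Cl2_integrand.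
  rewrite Rabs_pos_eq by lra. apply Ropp_le_contravar, ln_le; [assumption|].
  pose proof (sin_upper (x / 2)). lra.
Qed.

Lemma Cl2_integrand_nonneg (x : R) : 0 < x <= PI / 3 -> 0 <= Cl2_integrand x.
Proof.
  intros Hx. pose proof (half_sin_pos x Hx). pose proof PI_RGT_0. unfold Cl2_integrand.
  rewrite Rabs_pos_eq by lra. rewrite <- Ropp_0, <- ln_1.
  apply Ropp_le_contravar, ln_le; [assumption|].
  replace 1 with (2 * sin (PI / 6)) by (rewrite sin_PI6; lra).
  apply Rmult_le_compat_l; [lra|]. apply sin_incr_1; lra.
Qed.

(** From sin(x/2) >= (x/2) (1 - x^2/24): the logarithm of the bracket costs at most v/(1 - v) with v
    = x^2/24, and x^2 <= 1.2 makes this at most x^2/22. *)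
Lemma Cl2_integrand_upper (x : R) : 0 < x <= PI / 3 -> Cl2_integrand x <= - ln x + x ^ 2 / 22.
Proof.
  intros Hx. pose proof (half_sin_pos x Hx). pose proof PI_bounds. unfold Cl2_integrand.
  rewrite Rabs_pos_eq by lra.
  assert (Hx2 : 0 < 1 - x ^ 2 / 24) by (simpl; nra).
  apply Rle_trans with (- ln (x * (1 - x ^ 2 / 24))).
  - apply Ropp_le_contravar, ln_le; [nra|].
    pose proof (sin_lower (x / 2)). simpl in *. lra.
  - rewrite ln_mult by lra.
    assert (L : ln (/ (1 - x ^ 2 / 24)) <= / (1 - x ^ 2 / 24) - 1) by (apply ln_le_sub1, Rinv_0_lt_compat, Hx2).
    rewrite ln_Rinv in L by assumption.
    assert (/ (1 - x ^ 2 / 24) - 1 <= x ^ 2 / 22); [|lra].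
    apply Rmult_le_reg_r with (1 - x ^ 2 / 24); [exact Hx2|].
    rewrite Rmult_minus_distr_r, Rinv_l by lra.
    assert (x ^ 2 <= 1.2) by (simpl; nra). assert (0 <= x ^ 2) by (simpl; nra). nra.
Qed.

Lemma Cl2_integrand_continuous (x : R) : 0 < x <= PI / 3 -> continuous Cl2_integrand x.
Proof.
  intros Hx. pose proof (half_sin_pos x Hx).
  apply continuous_ext_loc with (fun x => - ln (2 * sin (x / 2))).
  - assert (L : locally x (fun y => 0 < 2 * sin (y / 2))).
    { apply (continuous_comp (fun x => x) (fun x => 2 * sin (x / 2)) x) ; [apply continuous_id| |].
      - apply (ex_derive_continuous (fun x => 2 * sin (x / 2))). auto_derive. trivial.
      - apply open_gt. exact H. }
    apply filter_imp with (2 := L). intros y Hy. unfold Cl2_integrand. now rewrite Rabs_pos_eq by lra.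
  - apply (ex_derive_continuous (fun x => - ln (2 * sin (x / 2)))). auto_derive. lra.
Qed.

Lemma ex_RInt_Cl2_integrand (a b : R) : 0 < a -> a <= b <= PI / 3 -> ex_RInt Cl2_integrand a b.
Proof.
  intros Ha Hb. apply (ex_RInt_continuous (V := R_CompleteNormedModule)). intros x Hx.
  rewrite Rmin_left, Rmax_right in Hx by lra. apply Cl2_integrand_continuous. lra.
Qed.

Lemma RInt_log (k a b : R) : 0 < a -> a <= b ->
  is_RInt (fun x => - ln x + k * x ^ 2) a b ((b - b * ln b + k * b ^ 3 / 3) - (a - a * ln a + k * a ^ 3 / 3)).
Proof.
  intros Ha Hb.
  apply (is_RInt_derive (fun x => x - x * ln x + k * x ^ 3 / 3)); intros x Hx;
    rewrite Rmin_left, Rmax_right in Hx by lra.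
  - auto_derive; [lra|]. field. lra.
  - apply (ex_derive_continuous (fun x => - ln x + k * x ^ 2)). auto_derive. lra.
Qed.

(** For b = PI/3 the antiderivative contributes b - b ln b <= 1 and a cubic term of at most
    1.16/66. *)
Lemma RInt_Cl2_integrand_upper (a : R) : 0 < a <= PI / 3 -> RInt Cl2_integrand a (PI / 3) <= 1.02.
Proof.
  intros Ha. pose proof PI_bounds as HP.
  pose proof (RInt_log (/ 22) a (PI / 3) (proj1 Ha) (proj2 Ha)) as I.
  apply Rle_trans with (RInt (fun x => - ln x + / 22 * x ^ 2) a (PI / 3)).
  - apply RInt_le; [lra | apply ex_RInt_Cl2_integrand; lra | eexists; exact I |].
    intros x Hx. pose proof (Cl2_integrand_upper x). lra.
  - rewrite (is_RInt_unique _ _ _ _ I).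
    assert (a * ln a <= a * (a - 1)) by (apply Rmult_le_compat_l; [lra | apply ln_le_sub1; lra]).
    assert (0 <= a - a * ln a).
    { assert (ln a <= 1); [|nra].
      pose proof (ln_le_sub1 a). lra. }
    assert (0 <= a ^ 3) by (apply pow_le; lra).
    assert (L : ln (/ (PI / 3)) <= / (PI / 3) - 1) by (apply ln_le_sub1, Rinv_0_lt_compat; lra).
    rewrite ln_Rinv in L by lra.
    assert (PI / 3 * (- ln (PI / 3)) <= PI / 3 * (/ (PI / 3) - 1)) by (apply Rmult_le_compat_l; lra).
    rewrite Rmult_minus_distr_l, Rinv_r in H2 by lra.
    assert ((PI / 3) ^ 3 <= 1.16) by (replace 1.16 with (1.16 * 1) by lra; simpl; nra).
    lra.
Qed.

Lemma RInt_Cl2_integrand_decr (a b : R) : 0 < a -> a <= b <= PI / 3 ->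
  RInt Cl2_integrand b (PI / 3) <= RInt Cl2_integrand a (PI / 3).
Proof.
  intros Ha Hb.
  rewrite <- (RInt_Chasles Cl2_integrand a b (PI / 3)) by (apply ex_RInt_Cl2_integrand; lra).
  change (RInt Cl2_integrand b (PI / 3) <= RInt Cl2_integrand a b + RInt Cl2_integrand b (PI / 3)).
  assert (0 <= RInt Cl2_integrand a b); [|lra].
  apply RInt_ge_0; [lra | apply ex_RInt_Cl2_integrand; lra |].
  intros x Hx. apply Cl2_integrand_nonneg. lra.
Qed.

(** The integrand is nonnegative up to PI/3, so the integrals over [a, PI/3] grow as a decreases,
    and the improper integral is their supremum. Estimates of [Cl2 (PI / 3)] thereby reduce to
    proper integrals. *)
Lemma Cl2_is_lub :
  is_lub (fun y => exists a, 0 < a <= PI / 3 /\ y = RInt Cl2_integrand a (PI / 3)) (Cl2 (PI / 3)).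
Proof.
  pose proof PI_RGT_0 as HP.
  destruct (completeness (fun y => exists a, 0 < a <= PI / 3 /\ y = RInt Cl2_integrand a (PI / 3))) as [l Hl].
  - exists 1.02. intros y [a [Ha ->]]. now apply RInt_Cl2_integrand_upper.
  - exists (RInt Cl2_integrand (PI / 3) (PI / 3)), (PI / 3). split; [lra | reflexivity].
  - enough (E : Cl2 (PI / 3) = l) by now rewrite E.
    unfold Cl2. enough (E : RInt_gen (fun x => ln (Rabs (2 * sin (x / 2)))) (at_right 0) (at_point (PI / 3)) = - l)
      by (rewrite E; ring).
    apply is_RInt_gen_unique. unfold is_RInt_gen, filterlimi, filter_le, filtermapi.
    intros P [eps HP'].
    assert (X : exists a0, 0 < a0 <= PI / 3 /\ l - eps < RInt Cl2_integrand a0 (PI / 3)).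
    { apply NNPP. intros N.
      assert (l <= l - eps); [|pose proof (cond_pos eps); lra].
      apply (proj2 Hl). intros y [a [Ha ->]]. apply Rnot_lt_le. intros L. apply N. now exists a. }
    destruct X as [a0 [Ha0 L0]].
    apply (Filter_prod (at_right 0) (at_point (PI / 3)) _ (fun a => 0 < a < a0) (fun b => b = PI / 3)).
    + exists (mkposreal a0 (proj1 Ha0)). intros y Hy H0. split; [exact H0|].
      change (Rabs (y - 0) < a0) in Hy. rewrite Rminus_0_r, Rabs_pos_eq in Hy; lra.
    + reflexivity.
    + intros a b [Ha1 Ha2] ->. simpl. exists (- RInt Cl2_integrand a (PI / 3)). split.
      * assert (E : ex_RInt Cl2_integrand a (PI / 3)) by (apply ex_RInt_Cl2_integrand; lra).
        apply (RInt_correct (V := R_CompleteNormedModule)) in E. apply is_RInt_opp in E.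
        eapply is_RInt_ext; [|exact E]. intros x _. unfold Cl2_integrand. 
        change (- - ln (Rabs (2 * sin (x / 2))) = ln (Rabs (2 * sin (x / 2)))). ring.
      * apply HP'. 
        change (Rabs (- RInt Cl2_integrand a (PI / 3) - - l) < eps).
        pose proof (RInt_Cl2_integrand_decr a a0 Ha1 ltac:(lra)).
        assert (RInt Cl2_integrand a (PI / 3) <= l).
        { apply (proj1 Hl). exists a. split; [lra | reflexivity]. }
        apply Rabs_def1; lra.
Qed.

Lemma Cl2_ge_RInt (a : R) : 0 < a <= PI / 3 -> RInt Cl2_integrand a (PI / 3) <= Cl2 (PI / 3).
Proof. intros Ha. apply (proj1 Cl2_is_lub). now exists a. Qed.

Lemma Cl2_upper : Cl2 (PI / 3) <= 1.02.
Proof. apply (proj2 Cl2_is_lub). intros y [a [Ha ->]]. now apply RInt_Cl2_integrand_upper. Qed.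

Lemma Cl2_lower : 0.8 <= Cl2 (PI / 3).
Proof.
  pose proof PI_bounds as HP.
  assert (E4 : 35 <= exp 4).
  { pose proof (exp_quarter_lower 16) as E. simpl in E. replace (_ / 4) with 4 in E by field. lra. }
  (* The integral below this cut is discarded; the logarithm of the cut is exactly -4. *)
  set (a := exp (- 4)).
  assert (Ha : 0 < a <= / 35).
  { unfold a. replace (exp (- 4)) with (/ exp 4) by (rewrite <- exp_Ropp; f_equal; lra). split; [apply Rinv_0_lt_compat; lra | apply Rinv_le_contravar; lra]. }
  apply Rle_trans with (RInt Cl2_integrand a (PI / 3)); [|apply Cl2_ge_RInt; lra].
  pose proof (RInt_log 0 a (PI / 3) ltac:(lra) ltac:(lra)) as I.
  apply Rle_trans with (RInt (fun x => - ln x + 0 * x ^ 2) a (PI / 3)).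
  - rewrite (is_RInt_unique _ _ _ _ I). rewrite (ln_exp (- 4) : ln a = - 4).
    assert (PI / 3 * ln (PI / 3) <= PI / 3 * (PI / 3 - 1)) by (apply Rmult_le_compat_l; [lra | apply ln_le_sub1; lra]).
    nra.
  - apply RInt_le; [lra | eexists; exact I | apply ex_RInt_Cl2_integrand; lra |].
    intros x Hx. pose proof (Cl2_integrand_lower x). lra.
Qed.

(** * Sine products *)

(** The cut-off makes the function Lipschitz, so that Riemann sums approach its integrals at an
    explicit rate. *)
Definition tlog (tau x : R) : R := - ln (Rmax tau (chord x)).

(** * Lipschitz functions and Riemann sums *)

Definition lipschitz (L : R) (f : R -> R) : Prop := forall x y, Rabs (f x - f y) <= L * Rabs (x - y).

Lemma lipschitz_continuous (L : R) (f : R -> R) (x : R) : lipschitz L f -> continuous f x.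
Proof.
  intros H. apply (filterlim_locally (U := R_UniformSpace)). intros eps.
  assert (HL : 0 < Rabs L + 1) by (pose proof (Rabs_pos L); lra).
  assert (He : 0 < eps / (Rabs L + 1)) by (apply Rdiv_lt_0_compat; [apply cond_pos | exact HL]).
  exists (mkposreal _ He). intros y Hy. change (Rabs (y - x) < eps / (Rabs L + 1)) in Hy.
  change (Rabs (f y - f x) < eps).
  apply Rle_lt_trans with ((Rabs L + 1) * Rabs (y - x)).
  - eapply Rle_trans; [apply H|]. apply Rmult_le_compat_r; [apply Rabs_pos|].
    pose proof (Rle_abs L). lra.
  - apply Rlt_le_trans with ((Rabs L + 1) * (eps / (Rabs L + 1))); [now apply Rmult_lt_compat_l|].
    apply Req_le. field. lra.
Qed.

Lemma lipschitz_ex_RInt (L : R) (f : R -> R) (a b : R) : lipschitz L f -> ex_RInt f a b.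
Proof.
  intros H. apply (ex_RInt_continuous (V := R_CompleteNormedModule)). intros x _.
  now apply lipschitz_continuous with L.
Qed.

Lemma sin_lipschitz (x y : R) : Rabs (sin x - sin y) <= Rabs (x - y).
Proof.
  destruct (MVT_gen sin y x cos) as [c [_ E]].
  { intros z _. apply is_derive_Reals, derivable_pt_lim_sin. }
  { intros z _. apply continuity_sin. }
  rewrite E, Rabs_mult. rewrite <- (Rmult_1_l (Rabs (x - y))) at 2.
  apply Rmult_le_compat_r; [apply Rabs_pos|]. apply Rabs_le. apply COS_bound.
Qed.

Lemma chord_lipschitz : lipschitz (2 * PI) chord.
Proof.
  intros x y. unfold chord. pose proof PI_RGT_0.
  eapply Rle_trans; [apply Rabs_triang_inv2|].
  replace (2 * sin (PI * x) - 2 * sin (PI * y)) with (2 * (sin (PI * x) - sin (PI * y))) by ring.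
  rewrite Rabs_mult, (Rabs_pos_eq 2) by lra. rewrite Rmult_assoc. apply Rmult_le_compat_l; [lra|].
  eapply Rle_trans; [apply sin_lipschitz|].
  rewrite <- Rmult_minus_distr_l, Rabs_mult, (Rabs_pos_eq PI) by lra. apply Rle_refl.
Qed.

Lemma ln_lipschitz (tau a b : R) : 0 < tau -> tau <= a -> tau <= b ->
  Rabs (ln a - ln b) <= / tau * Rabs (a - b).
Proof.
  intros Ht. assert (W : forall a b, tau <= a -> a <= b -> Rabs (ln a - ln b) <= / tau * Rabs (a - b)).
  { clear a b. intros a b Ha Hb. rewrite Rabs_left1 by (pose proof (ln_le a b); lra).
    rewrite Rabs_left1 by lra.
    assert (E : - (ln a - ln b) = ln (b / a)) by (rewrite ln_div; lra).
    rewrite E. eapply Rle_trans; [apply ln_le_sub1, Rdiv_lt_0_compat; lra|].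
    replace (b / a - 1) with (/ a * (b - a)) by (field; lra).
    replace (- (a - b)) with (b - a) by ring.
    apply Rmult_le_compat_r; [lra|]. apply Rinv_le_contravar; lra. }
  intros Ha Hb. destruct (Rle_dec a b) as [H|H].
  - now apply W.
  - rewrite Rabs_minus_sym, (Rabs_minus_sym a). apply W; lra.
Qed.

Lemma Rmax_lipschitz (t a b : R) : Rabs (Rmax t a - Rmax t b) <= Rabs (a - b).
Proof.
  unfold Rmax. destruct (Rle_dec t a), (Rle_dec t b); unfold Rabs;
    repeat destruct Rcase_abs; lra.
Qed.

Lemma tlog_lipschitz (tau : R) : 0 < tau -> lipschitz (2 * PI / tau) (tlog tau).
Proof.
  intros Ht x y. unfold tlog.
  replace (- ln (Rmax tau (chord x)) - - ln (Rmax tau (chord y)))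
    with (- (ln (Rmax tau (chord x)) - ln (Rmax tau (chord y)))) by ring.
  rewrite Rabs_Ropp.
  eapply Rle_trans; [apply (ln_lipschitz tau _ _ Ht); apply Rmax_l|].
  unfold Rdiv. rewrite (Rmult_comm (2 * PI)), Rmult_assoc.
  apply Rmult_le_compat_l; [left; now apply Rinv_0_lt_compat|].
  eapply Rle_trans; [apply Rmax_lipschitz | apply chord_lipschitz].
Qed.

Lemma tlog_period (tau x : R) (n : Z) : tlog tau (x + IZR n) = tlog tau x.
Proof. unfold tlog. now rewrite chord_IZR_period. Qed.

Lemma tlog_opp (tau x : R) : tlog tau (- x) = tlog tau x.
Proof. unfold tlog. now rewrite chord_opp. Qed.

Lemma tlog_le (tau x : R) : 0 < tau -> tlog tau x <= - ln tau.
Proof.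
  intros H. unfold tlog. apply Ropp_le_contravar, ln_le; [exact H | apply Rmax_l].
Qed.

Lemma riemann_sum_lipschitz (L delta : R) (f : R -> R) (p : nat -> R) (n : nat) :
  0 <= L -> 0 < delta -> lipschitz L f ->
  (forall l, (l < n)%nat -> INR l * delta <= p l <= INR (S l) * delta) ->
  Rabs (delta * Rsum (seq 0 n) (fun l => f (p l)) - RInt f 0 (INR n * delta)) <= INR n * (L * delta * delta).
Proof.
  intros HL Hd Hf. induction n as [|n IH]; intros Hp.
  - simpl INR. rewrite !Rmult_0_l, RInt_point. unfold Rsum, zero; simpl.
    rewrite Rmult_0_r, Rminus_0_r, Rabs_R0. apply Rle_refl.
  - rewrite seq_S, Rsum_app. change (Rsum [(0 + n)%nat] (fun l => f (p l))) with (f (p n) + 0).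
    rewrite <- (RInt_Chasles f 0 (INR n * delta)) by (now apply lipschitz_ex_RInt with L).
    match goal with |- context [plus ?a ?b] => change (plus a b) with (a + b) end.
    assert (IH' := IH ltac:(intros l Hl; apply Hp; lia)). clear IH.
    assert (H : Rabs (delta * f (p n) - RInt f (INR n * delta) (INR (S n) * delta)) <= L * delta * delta).
    { assert (Hn := Hp n (Nat.lt_succ_diag_r n)). rewrite S_INR in *.
      assert (E : delta * f (p n) = RInt (fun _ => f (p n)) (INR n * delta) ((INR n + 1) * delta)).
      { rewrite RInt_const. change (delta * f (p n) = ((INR n + 1) * delta - INR n * delta) * f (p n)). ring. }
      rewrite E.
      rewrite <- (RInt_minus (V := R_CompleteNormedModule)) by (apply ex_RInt_const || now apply lipschitz_ex_RInt with L).
      replace (L * delta * delta) with (((INR n + 1) * delta - INR n * delta) * (L * delta)) by ring.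
      apply abs_RInt_le_const; [lra | |].
      - apply (ex_RInt_minus (V := R_NormedModule)); [apply ex_RInt_const | now apply lipschitz_ex_RInt with L].
      - intros t Ht. change (Rabs (f (p n) - f t) <= L * delta).
        eapply Rle_trans; [apply Hf|]. apply Rmult_le_compat_l; [exact HL|]. apply Rabs_le. lra. }
    replace (INR (S n) * (L * delta * delta)) with (INR n * (L * delta * delta) + L * delta * delta) by (rewrite S_INR; ring).
    replace (delta * (Rsum (seq 0 n) (fun l => f (p l)) + (f (p n) + 0)) -
      (RInt f 0 (INR n * delta) + RInt f (INR n * delta) (INR (S n) * delta))) with
      ((delta * Rsum (seq 0 n) (fun l => f (p l)) - RInt f 0 (INR n * delta)) +
       (delta * f (p n) - RInt f (INR n * delta) (INR (S n) * delta))) by ring.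
    eapply Rle_trans; [apply Rabs_triang|]. lra.
Qed.

(** A product of maxima is at least tau^q and at least the product of the chords, which
    [prod_chord_translates] evaluates. The price is a lower cut-off, tau^q in place of tau. *)
Lemma Rsum_tlog_le (tau : R) (a : Z) (q : nat) (x : R) :
  0 < tau < 1 -> (0 < q)%nat -> Z.gcd a (Z.of_nat q) = 1%Z ->
  Rsum (seq 0 q) (fun r => tlog tau (x + INR r * (IZR a / INR q))) <= tlog (tau ^ q) (INR q * x).
Proof.
  intros Ht Hq Hg. unfold tlog.
  set (u := fun r => Rmax tau (chord (x + INR r * (IZR a / INR q)))).
  assert (Hu : forall r, In r (seq 0 q) -> 0 < u r).
  { intros r _. unfold u. apply Rlt_le_trans with tau; [lra | apply Rmax_l]. }
  destruct (ln_Rprod (seq 0 q) u Hu) as [P E].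
  change (Rsum (seq 0 q) (fun r => - ln (u r)) <= - ln (Rmax (tau ^ q) (chord (INR q * x)))).
  replace (Rsum (seq 0 q) (fun r => - ln (u r))) with (- ln (Rprod (seq 0 q) u)).
  2:{ rewrite E. rewrite <- (Rmult_1_l (Rsum _ _)), Ropp_mult_distr_l, <- Rsum_scal.
      apply Rsum_ext_in. intros r _. ring. }
  apply Ropp_le_contravar, ln_le.
  - apply Rlt_le_trans with (tau ^ q); [apply pow_lt; lra | apply Rmax_l].
  - rewrite <- (prod_chord_translates a q x Hq Hg).
    assert (M : forall l v w, (forall r, 0 <= v r <= w r) -> 0 <= Rprod l v <= Rprod (A := nat) l w).
    { intros l v w Hvw. induction l as [|b l IH]; [unfold Rprod; simpl; lra|].
      change (0 <= v b * Rprod l v <= w b * Rprod l w). specialize (Hvw b).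
      split; [now apply Rmult_le_pos | now apply Rmult_le_compat]. }
    apply Rmax_lub.
    + replace (tau ^ q) with (Rprod (seq 0 q) (fun _ => tau)).
      * apply M. intros r. split; [lra | apply Rmax_l].
      * rewrite <- (length_seq q 0) at 2. generalize (seq 0 q) as l.
        induction l as [|b l IH]; [reflexivity|].
        change (tau * Rprod l (fun _ => tau) = tau * tau ^ length l). now rewrite IH.
    + apply M. intros r. split; [unfold chord; apply Rabs_pos | apply Rmax_r].
Qed.

(** This reflects the vanishing of the integral of log |2 sin(pi x)| over a period. At the midpoints
    (2r + 1)/(2n), [Rsum_tlog_le] with q = n compares the sum with a value at 1/2 that is not
    positive, and the Riemann error L/n tends to 0. *)
Lemma RInt_tlog_period_le_0 (tau : R) : 0 < tau < 1 -> RInt (tlog tau) 0 1 <= 0.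
Proof.
  intros Ht. pose proof PI_RGT_0 as HP.
  set (L := 2 * PI / tau). assert (HL : 0 < L) by (apply Rdiv_lt_0_compat; lra).
  assert (H : forall n, (0 < n)%nat -> RInt (tlog tau) 0 1 <= L * / INR n).
  { intros n Hn. assert (N : 0 < INR n) by now apply lt_0_INR.
    pose proof (riemann_sum_lipschitz L (/ INR n) (tlog tau)
      (fun r => / (2 * INR n) + INR r * (IZR 1 / INR n)) n) as S.
    specialize (S ltac:(lra) ltac:(now apply Rinv_0_lt_compat) (tlog_lipschitz tau (proj1 Ht))).
    assert (I : 0 < / INR n) by now apply Rinv_0_lt_compat.
    assert (I2 : / (2 * INR n) = / 2 * / INR n) by (field; lra).
    specialize (S ltac:(intros l _; rewrite S_INR, I2; unfold Rdiv; nra)).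
    pose proof (Rsum_tlog_le tau 1 n (/ (2 * INR n)) Ht Hn (Z.gcd_1_l _)) as S2.
    replace (INR n * / (2 * INR n)) with (1 / 2) in S2 by (field; lra).
    assert (S3 : tlog (tau ^ n) (1 / 2) <= 0).
    { unfold tlog. rewrite <- Ropp_0, <- ln_1. apply Ropp_le_contravar, ln_le; [lra|].
      apply Rle_trans with (chord (1 / 2)); [|apply Rmax_r].
      unfold chord. replace (PI * (1 / 2)) with (PI / 2) by field. rewrite sin_PI2, Rabs_pos_eq; lra. }
    rewrite Rinv_r in S by lra.
    replace (INR n * (L * / INR n * / INR n)) with (L * / INR n) in S by (field; lra).
    apply Rabs_le_between in S. destruct S as [S _].
    assert (/ INR n * Rsum (seq 0 n) (fun l => tlog tau (/ (2 * INR n) + INR l * (IZR 1 / INR n))) <= 0).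
    { rewrite <- (Rmult_0_r (/ INR n)). apply Rmult_le_compat_l; lra. }
    lra. }
  apply Rnot_lt_le. intros Hpos.
  destruct (archimed_cor1 (RInt (tlog tau) 0 1 / L)) as [n [Hn1 Hn2]]; [now apply Rdiv_lt_0_compat|].
  specialize (H n Hn2).
  assert (L * / INR n < L * (RInt (tlog tau) 0 1 / L)) by now apply Rmult_lt_compat_l.
  assert (E : forall t, L * (t / L) = t) by (intros t; field; lra).
  rewrite E in H0. lra.
Qed.

(** The integral of -log(2 sin(pi x)) over [0, 1/6], the interval on which the integrand starts out
    nonnegative. The exponent of the theorem is a third of it. *)
Definition ksine : R := Cl2 (PI / 3) / (2 * PI).

(** * The integral of the truncated logarithm *)

Lemma chord_small (x : R) : 0 < x <= 1 / 6 -> 0 < chord x <= 1.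
Proof.
  intros Hx. pose proof PI_RGT_0. unfold chord.
  assert (0 < sin (PI * x)) by (apply sin_gt_0; nra).
  rewrite Rabs_pos_eq by lra. split; [lra|].
  assert (sin (PI * x) <= sin (PI / 6)) by (apply sin_incr_1; nra).
  rewrite sin_PI6 in H1. lra.
Qed.

Lemma tlog_nonneg_small (tau x : R) : 0 < tau < 1 -> 0 <= x <= 1 / 6 -> 0 <= tlog tau x.
Proof.
  intros Ht Hx. unfold tlog. rewrite <- Ropp_0, <- ln_1. apply Ropp_le_contravar, ln_le.
  - apply Rlt_le_trans with tau; [lra | apply Rmax_l].
  - apply Rmax_lub; [lra|]. destruct (Req_dec x 0) as [->|N].
    + unfold chord. rewrite Rmult_0_r, sin_0, Rmult_0_r, Rabs_R0. lra.
    + apply chord_small. lra.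
Qed.

Lemma tlog_nonpos_middle (tau x : R) : 1 / 6 <= x <= 5 / 6 -> tlog tau x <= 0.
Proof.
  intros Hx. pose proof PI_RGT_0. unfold tlog. rewrite <- Ropp_0, <- ln_1.
  apply Ropp_le_contravar, ln_le; [lra|].
  apply Rle_trans with (chord x); [|apply Rmax_r].
  assert (W : forall y, 1 / 6 <= y <= 1 / 2 -> 1 <= chord y).
  { intros y Hy. unfold chord. eapply Rle_trans; [|apply Rle_abs].
    assert (sin (PI / 6) <= sin (PI * y)) by (apply sin_incr_1; nra).
    rewrite sin_PI6 in H0. lra. }
  destruct (Rle_dec x (1 / 2)); [apply W; lra|].
  rewrite <- (chord_opp x), <- (chord_IZR_period (- x) 1). apply W. lra.
Qed.

Lemma tlog_le_Cl2_integrand (tau x : R) : 0 < x <= 1 / 6 -> tlog tau x <= Cl2_integrand (2 * PI * x).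
Proof.
  intros Hx. unfold tlog, Cl2_integrand. apply Ropp_le_contravar, ln_le.
  - pose proof (chord_small x Hx). unfold chord in *. replace (2 * PI * x / 2) with (PI * x) by field. lra.
  - replace (2 * PI * x / 2) with (PI * x) by field. apply Rmax_r.
Qed.

Lemma is_RInt_dilate (f : R -> R) (c a b : R) :
  c <> 0 -> ex_RInt f (c * a) (c * b) ->
  is_RInt (fun y => f (c * y)) a b (/ c * RInt f (c * a) (c * b)).
Proof.
  intros Hc E. apply (RInt_correct (V := R_CompleteNormedModule)) in E.
  rewrite <- (Rplus_0_r (c * a)), <- (Rplus_0_r (c * b)) in E at 1.
  apply (is_RInt_comp_lin (V := R_NormedModule) f c 0) in E.
  apply (is_RInt_scal (V := R_NormedModule)) with (k := / c) in E.
  eapply is_RInt_ext; [|exact E]. intros x _.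
  change (/ c * (c * f (c * x + 0)) = f (c * x)). rewrite Rplus_0_r. field. exact Hc.
Qed.

(** The truncated function is at most -ln tau near 0, and elsewhere at most the Clausen integrand
    rescaled by 2 PI. A hypothetical excess d is refuted by a cut a so small that a (-ln tau) <=
    d/2. *)
Lemma RInt_tlog_sixth (tau : R) : 0 < tau < 1 -> RInt (tlog tau) 0 (1 / 6) <= ksine.
Proof.
  intros Ht. pose proof PI_RGT_0 as HP.
  assert (EX : forall a b, ex_RInt (tlog tau) a b) by (intros a b; eapply lipschitz_ex_RInt, tlog_lipschitz; lra).
  assert (T : 0 < - ln tau) by (pose proof (ln_le_sub1 tau); lra).
  apply Rnot_lt_le. intros Hlt.
  set (d := RInt (tlog tau) 0 (1 / 6) - ksine) in *.
  assert (Hd : 0 < d) by (unfold d; lra).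
  set (a := Rmin (1 / 6) (d / 2 / - ln tau)).
  assert (Ha : 0 < a) by (apply Rmin_glb_lt; [lra | apply Rdiv_lt_0_compat; lra]).
  assert (Ha6 : a <= 1 / 6) by apply Rmin_l.
  assert (HaT : a * - ln tau <= d / 2).
  { apply Rle_trans with (d / 2 / - ln tau * - ln tau); [|apply Req_le; field; lra].
    apply Rmult_le_compat_r; [lra | apply Rmin_r]. }
  assert (I1 : RInt (tlog tau) 0 a <= a * - ln tau).
  { replace (a * - ln tau) with (RInt (fun _ => - ln tau) 0 a).
    - apply RInt_le; [lra | apply EX | apply ex_RInt_const |]. intros x _. apply tlog_le. lra.
    - rewrite RInt_const. change ((a - 0) * - ln tau = a * - ln tau). ring. }
  assert (I2 : RInt (tlog tau) a (1 / 6) <= ksine).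
  { assert (E : ex_RInt Cl2_integrand (2 * PI * a) (2 * PI * (1 / 6))) by (apply ex_RInt_Cl2_integrand; nra).
    pose proof (is_RInt_dilate _ (2 * PI) a (1 / 6) ltac:(lra) E) as E2.
    apply Rle_trans with (RInt (fun y => Cl2_integrand (2 * PI * y)) a (1 / 6)).
    - apply RInt_le; [lra | apply EX | eexists; exact E2 |].
      intros x Hx. apply tlog_le_Cl2_integrand. lra.
    - rewrite (is_RInt_unique _ _ _ _ E2). unfold ksine, Rdiv at 2. rewrite Rmult_comm.
      apply Rmult_le_compat_r; [left; apply Rinv_0_lt_compat; lra|].
      replace (2 * PI * (1 / 6)) with (PI / 3) by field.
      apply Cl2_ge_RInt. nra. }
  pose proof (RInt_Chasles (tlog tau) 0 a (1 / 6) (EX _ _) (EX _ _)) as CH.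
  change (RInt (tlog tau) 0 a + RInt (tlog tau) a (1 / 6) = RInt (tlog tau) 0 (1 / 6)) in CH.
  unfold d in *. lra.
Qed.

(** The signs on a period are +, -, + with changes at 1/6 and 5/6, and the whole period contributes
    at most 0. So within the first period the primitive is at most its value at 1/6, and later
    periods do not raise it. *)
Lemma RInt_tlog_le (tau Y : R) : 0 < tau < 1 -> 0 <= Y -> RInt (tlog tau) 0 Y <= ksine.
Proof.
  intros Ht.
  assert (EX : forall a b, ex_RInt (tlog tau) a b) by (intros a b; eapply lipschitz_ex_RInt, tlog_lipschitz; lra).
  assert (CH : forall a b c, RInt (tlog tau) a b + RInt (tlog tau) b c = RInt (tlog tau) a c)
    by (intros a b c; apply (RInt_Chasles (tlog tau) a b c (EX _ _) (EX _ _))).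
  assert (POS : forall a b, a <= b -> (forall x, a < x < b -> 0 <= tlog tau x) -> 0 <= RInt (tlog tau) a b)
    by (intros a b Hab H; apply RInt_ge_0; [exact Hab | apply EX | exact H]).
  assert (NEG : forall a b, a <= b -> (forall x, a < x < b -> tlog tau x <= 0) -> RInt (tlog tau) a b <= 0).
  { intros a b Hab H. replace 0 with (RInt (fun _ => 0) a b).
    - apply RInt_le; [exact Hab | apply EX | apply ex_RInt_const | exact H].
    - rewrite RInt_const. apply Rmult_0_r. }
  pose proof (RInt_tlog_sixth tau Ht) as H6.
  assert (Base : forall Y, 0 <= Y <= 1 -> RInt (tlog tau) 0 Y <= ksine).
  { clear Y. intros Y HY. destruct (Rle_dec Y (1 / 6)).
    - assert (0 <= RInt (tlog tau) Y (1 / 6)) by (apply POS; [assumption | intros x Hx; apply tlog_nonneg_small; lra]).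
      pose proof (CH 0 Y (1 / 6)). lra.
    - destruct (Rle_dec Y (5 / 6)).
      + assert (RInt (tlog tau) (1 / 6) Y <= 0) by (apply NEG; [lra | intros x Hx; apply tlog_nonpos_middle; lra]).
        pose proof (CH 0 (1 / 6) Y). lra.
      + assert (0 <= RInt (tlog tau) Y 1).
        { apply POS; [lra|]. intros x Hx.
          rewrite <- (tlog_opp tau x), <- (tlog_period tau (- x) 1). apply tlog_nonneg_small; lra. }
        assert (0 <= RInt (tlog tau) 0 (1 / 6)) by (apply POS; [lra | intros x Hx; apply tlog_nonneg_small; lra]).
        pose proof (CH 0 Y 1). pose proof (RInt_tlog_period_le_0 tau Ht). lra. }
  assert (Shift : forall Z, RInt (tlog tau) 1 (Z + 1) = RInt (tlog tau) 0 Z).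
  { intros Z.
    transitivity (RInt (fun y => scal 1 (tlog tau (1 * y + 1))) 0 Z).
    - symmetry. apply is_RInt_unique.
      apply (is_RInt_comp_lin (V := R_NormedModule) (tlog tau) 1 1 0 Z).
      replace (1 * 0 + 1) with 1 by ring. replace (1 * Z + 1) with (Z + 1) by ring.
      apply (RInt_correct (V := R_CompleteNormedModule)), EX.
    - apply (RInt_ext (V := R_CompleteNormedModule)). intros x _.
      change (1 * tlog tau (1 * x + 1) = tlog tau x).
      rewrite (tlog_period tau (1 * x) 1), !Rmult_1_l. reflexivity. }
  assert (Step : forall n Y, 0 <= Y <= INR n + 1 -> RInt (tlog tau) 0 Y <= ksine).
  { clear Y. induction n as [|n IH]; intros Y HY.
    - apply Base. simpl in HY. lra.
    - rewrite S_INR in HY. destruct (Rle_dec Y 1); [apply Base; lra|].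
      specialize (IH (Y - 1) ltac:(lra)). pose proof (Shift (Y - 1)) as S.
      replace (Y - 1 + 1) with Y in S by ring.
      pose proof (CH 0 1 Y). pose proof (RInt_tlog_period_le_0 tau Ht). lra. }
  intros HY. destruct (INR_unbounded Y) as [n Hn]. apply (Step n). lra.
Qed.

(** Only terms with r < Y are nonzero, and for n <= Y the sum is exactly ln(Y^n/n!), which the
    exponential series bounds by Y. *)
Lemma Rsum_ln_excess (Y : R) (n : nat) :
  0 <= Y -> Rsum (seq 1 n) (fun r => ln (Rmax 1 (Y / INR r))) <= Y.
Proof.
  intros HY.
  enough (H : Rsum (seq 1 n) (fun r => ln (Rmax 1 (Y / INR r))) <= Y /\
    (INR n <= Y -> Rsum (seq 1 n) (fun r => ln (Rmax 1 (Y / INR r))) = ln (Y ^ n / INR (fact n)))) by apply H.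
  induction n as [|n [IH1 IH2]].
  - split; [exact HY|]. intros _. unfold Rsum; simpl. replace (1 / 1) with 1 by field. now rewrite ln_1.
  - rewrite seq_S, Rsum_app.
    change (Rsum [(1 + n)%nat] (fun r => ln (Rmax 1 (Y / INR r)))) with (ln (Rmax 1 (Y / INR (S n))) + 0).
    assert (Hn : 0 < INR (S n)) by (apply lt_0_INR; lia).
    pose proof (INR_fact_lt_0 n) as F1. pose proof (INR_fact_lt_0 (S n)) as F2.
    destruct (Rle_dec (INR (S n)) Y) as [H|H].
    + assert (H1 : 1 <= Y / INR (S n)).
      { apply Rmult_le_reg_r with (INR (S n)); [exact Hn|]. unfold Rdiv.
        rewrite Rmult_assoc, Rinv_l; lra. }
      assert (E : Rsum (seq 1 n) (fun r => ln (Rmax 1 (Y / INR r))) + (ln (Rmax 1 (Y / INR (S n))) + 0)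
                  = ln (Y ^ S n / INR (fact (S n)))).
      { rewrite IH2 by (rewrite S_INR in H; lra). rewrite Rmax_right by exact H1.
        rewrite Rplus_0_r, <- ln_mult.
        - f_equal. rewrite fact_simpl, mult_INR. simpl pow. field. lra.
        - apply Rdiv_lt_0_compat; [apply pow_lt|]; lra.
        - apply Rdiv_lt_0_compat; lra. }
      split; [|intros _; exact E]. rewrite E.
      rewrite <- (ln_exp Y) at 2. apply ln_le.
      * apply Rdiv_lt_0_compat; [apply pow_lt|]; lra.
      * now apply pow_fact_le_exp.
    + split; [|lra].
      rewrite Rmax_left.
      * rewrite ln_1. lra.
      * apply Rmult_le_reg_r with (INR (S n)); [exact Hn|]. unfold Rdiv.
        rewrite Rmult_assoc, Rinv_l; lra.
Qed.

(** Where the chord is below tau, the error of the truncation is ln(tau/chord), and the chord is at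
    least 4 [near]/k. *)
Lemma neg_ln_chord_le (tau : R) (h k j : nat) :
  0 < tau -> Nat.gcd h k = 1%nat -> (0 < j < k)%nat ->
  - ln (chord (INR j * (INR h / INR k))) <=
  tlog tau (INR j * (INR h / INR k)) + ln (Rmax 1 (tau * INR k / 4 / INR (near h k j))).
Proof.
  intros Ht Hg Hj. pose proof (chord_fraction_lower h k j Hg Hj) as Hc.
  destruct (near_pos h k j Hg Hj) as [N _]. apply lt_0_INR in N.
  assert (K : 0 < INR k) by (apply lt_0_INR; lia).
  assert (P : 0 < 4 * INR (near h k j) / INR k) by (apply Rdiv_lt_0_compat; lra).
  set (c := chord (INR j * (INR h / INR k))) in *. unfold tlog. fold c.
  destruct (Rle_dec tau c) as [H|H].
  - rewrite Rmax_right by exact H.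
    assert (0 <= ln (Rmax 1 (tau * INR k / 4 / INR (near h k j)))); [|lra].
    rewrite <- ln_1. apply ln_le; [lra | apply Rmax_l].
  - rewrite Rmax_left by lra.
    assert (ln (tau / c) <= ln (Rmax 1 (tau * INR k / 4 / INR (near h k j)))).
    { apply ln_le; [apply Rdiv_lt_0_compat; lra|].
      eapply Rle_trans; [|apply Rmax_r].
      replace (tau * INR k / 4 / INR (near h k j)) with (tau / (4 * INR (near h k j) / INR k)) by (field; lra).
      apply Rmult_le_compat_l; [lra|]. apply Rinv_le_contravar; assumption. }
    rewrite ln_div in H0 by lra. lra.
Qed.

(** * Partial products at a fraction h/k *)

Lemma map_add_seq (c s n : nat) : map (fun r => (c + r)%nat) (seq s n) = seq (c + s) n.
Proof.
  revert s. induction n as [|n IH]; intros s; [reflexivity|]. simpl. rewrite IH.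
  do 2 f_equal. lia.
Qed.

Lemma Rsum_blocks (q M : nat) (F : nat -> R) :
  Rsum (seq 0 (q * M)) F = Rsum (seq 0 M) (fun l => Rsum (seq 0 q) (fun r => F (l * q + r)%nat)).
Proof.
  induction M as [|M IH].
  - rewrite Nat.mul_0_r. reflexivity.
  - rewrite Nat.mul_succ_r, seq_app, Rsum_app, IH, seq_S, Rsum_app.
    f_equal. rewrite Rsum_cons. unfold Rsum at 3. simpl. rewrite Rplus_0_r.
    replace (seq (q * M) q) with (map (fun r => (M * q + r)%nat) (seq 0 q)).
    + apply Rsum_map.
    + rewrite map_add_seq, Nat.add_0_r. f_equal. apply Nat.mul_comm.
Qed.

Lemma RInt_Rsum {A : Type} (l : list A) (f : A -> R -> R) (a b : R) :
  (forall i, ex_RInt (f i) a b) -> is_RInt (fun x => Rsum l (fun i => f i x)) a b (Rsum l (fun i => RInt (f i) a b)).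
Proof.
  intros H. induction l as [|i l IH].
  - replace (Rsum [] (fun i => RInt (f i) a b)) with ((b - a) * 0) by (unfold Rsum; simpl; ring).
    apply (is_RInt_const (V := R_NormedModule) a b 0).
  - apply (is_RInt_plus (V := R_NormedModule) (f i) (fun x => Rsum l (fun i => f i x))); [|exact IH].
    apply (RInt_correct (V := R_CompleteNormedModule)), H.
Qed.

Lemma lipschitz_translate (L : R) (f : R -> R) (c : R) : lipschitz L f -> lipschitz L (fun x => f (x + c)).
Proof. intros H x y. replace (x - y) with (x + c - (y + c)) by ring. apply H. Qed.

(** Exchange sum and integral, collapse the q translates to a single function of qx, and rescale:
    the dilation by q yields the factor 1/q. *)
Lemma Rsum_RInt_tlog_le (tau : R) (a : Z) (q : nat) (X : R) :
  0 < tau < 1 -> (0 < q)%nat -> Z.gcd a (Z.of_nat q) = 1%Z -> 0 <= X ->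
  Rsum (seq 0 q) (fun r => RInt (fun x => tlog tau (x + INR r * (IZR a / INR q))) 0 X) <= ksine / INR q.
Proof.
  intros Ht Hq Hg HX. assert (Q : 0 < INR q) by now apply lt_0_INR.
  assert (EX : forall r : nat, ex_RInt (fun x => tlog tau (x + INR r * (IZR a / INR q))) 0 X).
  { intros r. apply lipschitz_ex_RInt with (2 * PI / tau). apply lipschitz_translate, tlog_lipschitz. lra. }
  pose proof (RInt_Rsum (seq 0 q) _ 0 X EX) as I. cbv beta in I.
  rewrite <- (is_RInt_unique _ _ _ _ I).
  assert (Tq : 0 < tau ^ q < 1).
  { split; [apply pow_lt; lra|]. apply pow_lt_1_compat; [lra | exact Hq]. }
  assert (E1 : ex_RInt (tlog (tau ^ q)) (INR q * 0) (INR q * X)) by (eapply lipschitz_ex_RInt, tlog_lipschitz; lra).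
  pose proof (is_RInt_dilate _ (INR q) 0 X ltac:(lra) E1) as E2. rewrite Rmult_0_r in E2.
  apply Rle_trans with (RInt (fun y => tlog (tau ^ q) (INR q * y)) 0 X).
  - apply RInt_le; [exact HX | eexists; exact I | eexists; exact E2 |].
    intros x _. now apply Rsum_tlog_le.
  - rewrite (is_RInt_unique _ _ _ _ E2). unfold Rdiv. rewrite Rmult_comm.
    apply Rmult_le_compat_r; [left; now apply Rinv_0_lt_compat|].
    apply RInt_tlog_le; [exact Tq|]. apply Rmult_le_pos; lra.
Qed.

(** Put delta = |beta|/k. For j = lq + r the point jh/k is, modulo 1 and up to sign, a translate
    depending on r only of a point in the l-th cell of mesh delta, so each class r gives a Riemann
    sum. The second term of the bound covers the Riemann errors, by delta <= 1/Q; the third covers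
    the last n mod q terms. *)
Lemma Rsum_tlog_fraction_le (tau : R) (h k n q Q : nat) (a : Z) :
  0 < tau < 1 -> (0 < k)%nat -> (1 <= q <= Q)%nat -> Z.gcd a (Z.of_nat q) = 1%Z ->
  (Z.of_nat h * Z.of_nat q - a * Z.of_nat k <> 0)%Z ->
  (Z.abs (Z.of_nat h * Z.of_nat q - a * Z.of_nat k) * Z.of_nat Q <= Z.of_nat k)%Z ->
  Rsum (seq 0 n) (fun j => tlog tau (INR j * (INR h / INR k))) <=
  ksine * INR k / (INR q * IZR (Z.abs (Z.of_nat h * Z.of_nat q - a * Z.of_nat k))) +
  INR n * (2 * PI / tau) / INR Q + INR Q * - ln tau.
Proof.
  intros Ht Hk Hq Hg Hb HbQ.
  set (beta := (Z.of_nat h * Z.of_nat q - a * Z.of_nat k)%Z) in *.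
  assert (K : 0 < INR k) by now apply lt_0_INR.
  assert (Hq0 : 0 < INR q) by (apply lt_0_INR; lia).
  assert (HQ0 : 0 < INR Q) by (apply lt_0_INR; lia).
  pose proof PI_RGT_0 as HP.
  set (L := 2 * PI / tau). assert (HL : 0 < L) by (apply Rdiv_lt_0_compat; lra).
  assert (T : 0 < - ln tau) by (pose proof (ln_le_sub1 tau); lra).
  set (B := IZR (Z.abs beta)). assert (HB : 0 < B) by (apply IZR_lt; lia).
  set (delta := B / INR k). assert (Hd : 0 < delta) by (apply Rdiv_lt_0_compat; lra).
  assert (HdQ : delta <= / INR Q).
  { apply IZR_le in HbQ. rewrite mult_IZR, <- !INR_IZR_INZ in HbQ. fold B in HbQ.
    apply Rmult_le_reg_r with (INR k * INR Q); [nra|]. unfold delta. field_simplify; lra. }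
  (* [tlog] is even, so the sign of beta can be moved into a, which leaves the positive mesh
     delta. *)
  set (sg := Z.sgn beta).
  assert (Hsg : (sg = 1 \/ sg = -1)%Z) by (unfold sg; destruct (Z.sgn_spec beta) as [[? ->]|[[? ->]|[? ->]]]; lia).
  assert (Hga : Z.gcd (sg * a) (Z.of_nat q) = 1%Z).
  { destruct Hsg as [-> | ->]; [now rewrite Z.mul_1_l|].
    replace (-1 * a)%Z with (- a)%Z by ring. now rewrite Z.gcd_opp_l. }
  assert (Hx : forall j, tlog tau (INR j * (INR h / INR k)) =
                    tlog tau (INR j * delta / INR q + INR j * (IZR (sg * a) / INR q))).
  { intros j.
    assert (E : IZR sg * (INR j * (INR h / INR k)) = INR j * delta / INR q + INR j * (IZR (sg * a) / INR q)).
    { unfold delta, B. rewrite <- Z.sgn_abs. fold sg.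
      rewrite (Z.mul_comm beta sg). unfold beta.
      rewrite !mult_IZR, minus_IZR, !mult_IZR, <- !INR_IZR_INZ. field. lra. }
    rewrite <- E. destruct Hsg as [-> | ->]; [now rewrite Rmult_1_l|].
    replace (-1 * (INR j * (INR h / INR k))) with (- (INR j * (INR h / INR k))) by ring.
    now rewrite tlog_opp. }
  set (M := (n / q)%nat). set (t := (n mod q)%nat).
  assert (En : n = (q * M + t)%nat) by apply Nat.div_mod_eq.
  assert (Htq : (t < q)%nat) by (apply Nat.mod_upper_bound; lia).
  rewrite En at 1. rewrite seq_app, Rsum_app.
  assert (R2 : Rsum (seq (0 + q * M) t) (fun j => tlog tau (INR j * (INR h / INR k))) <= INR Q * - ln tau).
  { eapply Rle_trans; [apply (Rsum_le_const (- ln tau)); intros j _; apply tlog_le; lra|].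
    rewrite length_seq. apply Rmult_le_compat_r; [lra|]. apply le_INR. lia. }
  enough (R1 : Rsum (seq 0 (q * M)) (fun j => tlog tau (INR j * (INR h / INR k))) <=
     ksine * INR k / (INR q * B) + INR n * L / INR Q) by lra.
  rewrite Rsum_blocks, Rsum_exchange.
  set (f := fun (r : nat) x => tlog tau (x + INR r * (IZR (sg * a) / INR q))).
  set (p := fun r l : nat => INR (l * q + r) * delta / INR q).
  assert (Fr : forall r, In r (seq 0 q) ->
     delta * Rsum (seq 0 M) (fun l => tlog tau (INR (l * q + r) * (INR h / INR k))) <=
     RInt (f r) 0 (INR M * delta) + INR M * (L * delta * delta)).
  { intros r Hr. apply in_seq in Hr.
    assert (Lf : lipschitz L (f r)) by (apply lipschitz_translate, tlog_lipschitz; lra).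
    pose proof (riemann_sum_lipschitz L delta (f r) (p r) M ltac:(lra) Hd Lf) as RS.
    assert (Hp : forall l, (l < M)%nat -> INR l * delta <= p r l <= INR (S l) * delta).
    { intros l _. unfold p. rewrite plus_INR, mult_INR, S_INR.
      assert (Hr0 : 0 <= INR r) by apply pos_INR.
      assert (Hr1 : INR r <= INR q) by (apply le_INR; lia).
      replace ((INR l * INR q + INR r) * delta / INR q) with (INR l * delta + INR r / INR q * delta) by (field; lra).
      assert (0 <= INR r / INR q <= 1).
      { split; [apply Rmult_le_pos; [exact Hr0 | left; now apply Rinv_0_lt_compat]|].
        apply Rmult_le_reg_r with (INR q); [lra|]. unfold Rdiv. rewrite Rmult_assoc, Rinv_l; lra. }
      nra. }
    specialize (RS Hp). apply Rabs_le_between in RS. destruct RS as [_ RS].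
    rewrite (Rsum_ext_in _ _ (fun l => f r (p r l))); [lra|].
    intros l _. rewrite Hx. unfold f, p.
    (* The part lq of j contributes the integer l sg a, a period of [tlog]. *)
    match goal with |- _ = tlog tau ?y => rewrite <- (tlog_period tau y (Z.of_nat l * (sg * a))) end.
    f_equal. rewrite (mult_IZR (Z.of_nat l)), <- INR_IZR_INZ, plus_INR, mult_INR. field. lra. }
  apply Rsum_le in Fr. rewrite Rsum_scal, Rsum_plus, Rsum_const, length_seq in Fr.
  pose proof (Rsum_RInt_tlog_le tau (sg * a) q (INR M * delta) Ht ltac:(lia) Hga
     ltac:(apply Rmult_le_pos; [apply pos_INR | lra])) as I.
  change (fun r => RInt (fun x => tlog tau (x + INR r * (IZR (sg * a) / INR q))) 0 (INR M * delta))
    with (fun r => RInt (f r) 0 (INR M * delta)) in I.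
  match type of Fr with delta * ?S <= _ => set (T0 := S) in * end.
  apply Rmult_le_reg_l with delta; [exact Hd|].
  apply Rle_trans with (ksine / INR q + INR q * (INR M * (L * delta * delta))); [lra|].
  rewrite Rmult_plus_distr_l. apply Rplus_le_compat.
  - apply Req_le. unfold delta. field. repeat split; lra.
  - assert (HqM : INR q * INR M <= INR n).
    { rewrite <- mult_INR. apply le_INR. lia. }
    replace (INR q * (INR M * (L * delta * delta))) with (delta * ((INR q * INR M) * L * delta)) by ring.
    apply Rmult_le_compat_l; [lra|]. unfold Rdiv.
    assert (0 <= INR q * INR M) by (apply Rmult_le_pos; apply pos_INR).
    apply Rmult_le_compat; [nra | lra | nra | exact HdQ].
Qed.

Lemma ksine_pos : 0 < ksine.
Proof.
  unfold ksine. pose proof Cl2_lower. pose proof PI_RGT_0. apply Rdiv_lt_0_compat; lra.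
Qed.

(** D is a lower bound for q |beta| over all approximations with beta nonzero. Half of eps k pays
    for the excess over the cut-off, through tau <= eps, and half for the Riemann error, through the
    choice of Q; C depends on eps alone. *)
Lemma sine_product_bound (eps : R) : 0 < eps -> exists C, forall h k m D : nat,
  (0 < k)%nat -> Nat.gcd h k = 1%nat -> (m < k)%nat -> (1 <= D)%nat ->
  (forall (q : nat) (a : Z), (1 <= q)%nat -> (Z.of_nat h * Z.of_nat q - a * Z.of_nat k <> 0)%Z ->
     (Z.of_nat D <= Z.of_nat q * Z.abs (Z.of_nat h * Z.of_nat q - a * Z.of_nat k))%Z) ->
  Rsum (seq 1 m) (fun j => - ln (chord (INR j * (INR h / INR k)))) <= (ksine / INR D + eps) * INR k + C.
Proof.
  intros He. pose proof PI_RGT_0 as HP. pose proof ksine_pos as HKs.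
  set (tau := Rmin (1 / 2) eps).
  assert (Ht : 0 < tau < 1).
  { pose proof (Rmin_l (1 / 2) eps). split; [apply Rmin_glb_lt|unfold tau]; lra. }
  assert (Hte : tau <= eps) by apply Rmin_r.
  set (L := 2 * PI / tau). assert (HL : 0 < L) by (apply Rdiv_lt_0_compat; lra).
  destruct (archimed_cor1 (eps / 2 / L)) as [Q [HQ1 HQ2]]; [apply Rdiv_lt_0_compat; lra|].
  assert (HQ0 : 0 < INR Q) by now apply lt_0_INR.
  assert (T : 0 < - ln tau) by (pose proof (ln_le_sub1 tau); lra).
  exists (INR Q * - ln tau). intros h k m D Hk Hg Hm HD Happ.
  assert (K : 0 < INR k) by now apply lt_0_INR.
  assert (HDp : 0 < INR D) by (apply lt_0_INR; lia).
  apply Rle_trans with (Rsum (seq 1 m) (fun j => tlog tau (INR j * (INR h / INR k)) +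
     ln (Rmax 1 (tau * INR k / 4 / INR (near h k j))))).
  { apply Rsum_le. intros j Hj. apply in_seq in Hj. apply neg_ln_chord_le; [lra | exact Hg | lia]. }
  rewrite Rsum_plus.
  assert (X : Rsum (seq 1 m) (fun j => ln (Rmax 1 (tau * INR k / 4 / INR (near h k j)))) <= eps / 2 * INR k).
  { eapply Rle_trans; [apply (Rsum_near_le h k m (fun r => ln (Rmax 1 (tau * INR k / 4 / INR r))) Hg Hm)|].
    - intros r. rewrite <- ln_1. apply ln_le; [lra | apply Rmax_l].
    - assert (0 <= tau * INR k / 4) by nra.
      pose proof (Rsum_ln_excess (tau * INR k / 4) (k / 2) H). nra. }
  enough (Y : Rsum (seq 1 m) (fun j => tlog tau (INR j * (INR h / INR k))) <=
     ksine / INR D * INR k + eps / 2 * INR k + INR Q * - ln tau) by lra.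
  assert (HDk : 0 <= ksine / INR D * INR k).
  { apply Rmult_le_pos; [left; apply Rdiv_lt_0_compat|]; lra. }
  (* For k <= Q there are fewer than Q terms, each at most -ln tau. For k > Q a denominator q <= Q
     cannot be a multiple of k, so beta is nonzero. *)
  destruct (le_lt_dec k Q) as [HkQ|HkQ].
  - assert (Rsum (seq 1 m) (fun j => tlog tau (INR j * (INR h / INR k))) <= INR m * - ln tau).
    { rewrite <- (length_seq m 1) at 2. apply Rsum_le_const. intros j _. apply tlog_le. lra. }
    assert (INR m <= INR Q) by (apply le_INR; lia). nra.
  - destruct (Dirichlet_approximation h k Q Hk HQ2) as [q [a [Hq [Hga Hb]]]].
    assert (Hnz : (Z.of_nat h * Z.of_nat q - a * Z.of_nat k <> 0)%Z).
    { intros Z0. assert (Dv : (Z.of_nat k | Z.of_nat h * Z.of_nat q)%Z) by (exists a; lia).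
      apply Z.gauss in Dv; [|rewrite Z.gcd_comm; now apply Zgcd_of_nat_1].
      apply Z.divide_pos_le in Dv; lia. }
    pose proof (Rsum_tlog_fraction_le tau h k (S m) q Q a Ht Hk Hq Hga Hnz Hb) as F.
    change (seq 0 (S m)) with (0%nat :: seq 1 m) in F. rewrite Rsum_cons in F.
    assert (F0 : 0 <= tlog tau (INR 0 * (INR h / INR k))).
    { rewrite Rmult_0_l. apply tlog_nonneg_small; lra. }
    specialize (Happ q a ltac:(lia) Hnz).
    set (B := Z.abs (Z.of_nat h * Z.of_nat q - a * Z.of_nat k)) in *.
    apply IZR_le in Happ. rewrite mult_IZR, <- !INR_IZR_INZ in Happ.
    assert (G1 : ksine * INR k / (INR q * IZR B) <= ksine / INR D * INR k).
    { unfold Rdiv. rewrite Rmult_assoc, (Rmult_comm (INR k)), <- Rmult_assoc.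
      apply Rmult_le_compat_r; [lra|]. apply Rmult_le_compat_l; [lra|]. apply Rinv_le_contravar; lra. }
    assert (G2 : INR (S m) * L / INR Q <= eps / 2 * INR k).
    { assert (S1 : INR (S m) <= INR k) by (apply le_INR; lia).
      assert (S0 : 0 <= INR (S m)) by apply pos_INR.
      assert (LQ : L * / INR Q <= eps / 2).
      { apply Rle_trans with (L * (eps / 2 / L)); [apply Rmult_le_compat_l; lra|].
        apply Req_le. field. lra. }
      unfold Rdiv at 1. rewrite Rmult_assoc, (Rmult_comm (eps / 2)).
      apply Rmult_le_compat; try assumption. apply Rmult_le_pos; [lra|]. left. now apply Rinv_0_lt_compat. }
    fold L in F. lra.
Qed.

(** * The bound for one residue *)

Lemma Cexp_plus (a b : C) : Cexp (a + b) = (Cexp a * Cexp b)%C.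
Proof.
  destruct a as [a1 a2], b as [b1 b2]. unfold Cexp, Cmult, Cplus; simpl.
  rewrite exp_plus, cos_plus, sin_plus. f_equal; ring.
Qed.

Lemma Cinv_0 : (/ RtoC 0)%C = 0.
Proof. unfold Cinv, RtoC. simpl. f_equal; unfold Rdiv; ring. Qed.

(** The default [/ 0 = 0] makes inversion multiplicative everywhere, so [Qfun] splits into factors
    at every point. *)
Lemma Cinv_mult_total (a b : C) : (/ (a * b))%C = (/ a * / b)%C.
Proof.
  destruct (Ceq_dec a 0) as [->|Ha]; [rewrite Cmult_0_l, Cinv_0; ring|].
  destruct (Ceq_dec b 0) as [->|Hb]; [rewrite Cmult_0_r, Cinv_0; ring|].
  field. now split.
Qed.

Lemma Cprod_app {A : Type} (l l' : list A) (f : A -> C) : Cprod (l ++ l') f = (Cprod l f * Cprod l' f)%C.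
Proof.
  unfold Cprod. induction l as [|a l IH]; simpl; [ring|]. rewrite IH. ring.
Qed.

Lemma Cprod_single {A : Type} (a : A) (f : A -> C) : Cprod [a] f = f a.
Proof. unfold Cprod. simpl. ring. Qed.

Lemma div_succ (N k : nat) : (0 < k)%nat ->
  (S N / k = N / k + (if S N mod k =? 0 then 1 else 0))%nat.
Proof.
  intros Hk. pose proof (Nat.div_mod_eq (S N) k) as E1. pose proof (Nat.div_mod_eq N k) as E2.
  pose proof (Nat.mod_upper_bound (S N) k ltac:(lia)). pose proof (Nat.mod_upper_bound N k ltac:(lia)).
  destruct (Nat.eqb_spec (S N mod k) 0) as [Z|Z]; nia.
Qed.

Lemma majorized_Cprod {A : Type} (l : list A) (F : A -> C -> C) (M : A -> R) (rho : R) :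
  0 < rho -> (forall a, In a l -> majorized (F a) rho (M a)) ->
  majorized (fun z => Cprod l (fun a => F a z)) rho (Rprod l M).
Proof.
  intros Hr. induction l as [|a l IH]; intros H.
  - apply (majorized_ext (fun _ => RtoC 1) _ rho (Cmod 1)); [reflexivity | | apply majorized_const].
    rewrite Cmod_1. apply Rle_refl.
  - apply (majorized_mult (F a) (fun z => Cprod l (fun a => F a z))); [exact Hr | apply H; now left |].
    apply IH. intros b Hb. apply H. now right.
Qed.

Definition frac_factor (h k j : nat) (z : C) : C :=
  (1 - Cexp (2 * RtoC PI * Ci * RtoC (INR j) * (RtoC (INR h / INR k) + z)))%C.

(** Exactly N/k of the indices up to N are multiples of k, and these are the factors that vanish at
    h/k; each of them receives one factor z. *)
Lemma Qfun_regularized (sigma : R) (N h k : nat) (z : C) : (0 < k)%nat ->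
  (z ^ (N / k) * Qfun sigma N (RtoC (INR h / INR k) + z))%C =
  (Cexp (2 * RtoC PI * Ci * RtoC sigma * (RtoC (INR h / INR k) + z)) *
   Cprod (seq 1 N) (fun j => if (j mod k =? 0)%nat then z / frac_factor h k j z else / frac_factor h k j z))%C.
Proof.
  intros Hk. unfold Qfun.
  change (fun j => 1 - Cexp (2 * RtoC PI * Ci * RtoC (INR j) * (RtoC (INR h / INR k) + z)))%C
    with (fun j => frac_factor h k j z).
  assert (E : (z ^ (N / k) * / Cprod (seq 1 N) (fun j => frac_factor h k j z))%C =
    Cprod (seq 1 N) (fun j => if (j mod k =? 0)%nat then z / frac_factor h k j z else / frac_factor h k j z)%C).
  { induction N as [|N IH].
    - rewrite Nat.Div0.div_0_l. unfold Cprod. simpl. field.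
    - rewrite seq_S, !Cprod_app, !Cprod_single, <- IH, Cinv_mult_total, div_succ by exact Hk.
      rewrite Cpow_add_r. change (1 + N)%nat with (S N). destruct (S N mod k =? 0)%nat; simpl Cpow; unfold Cdiv; ring. }
  rewrite <- E. unfold Cdiv. ring.
Qed.

Lemma Cexp_unit_root (t : R) : Cexp (2 * RtoC PI * Ci * RtoC t) = unit_root t.
Proof.
  unfold Cexp, unit_root. simpl.
  match goal with |- (exp ?a * cos ?b, _) = _ => replace a with 0 by ring; replace b with (2 * PI * t) by ring end.
  rewrite exp_0. f_equal; ring.
Qed.

Lemma Cmod_2PIi (t : R) : 0 <= t -> Cmod (2 * RtoC PI * Ci * RtoC t)%C = 2 * PI * t.
Proof.
  intros Ht. pose proof PI_RGT_0. rewrite !Cmod_mult, !Cmod_R.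
  rewrite !Rabs_pos_eq by lra. replace (Cmod Ci) with 1; [ring|].
  unfold Cmod, Ci. simpl. transitivity (sqrt 1); [symmetry; apply sqrt_1 | f_equal; ring].
Qed.

Lemma frac_factor_eq (h k j : nat) (z : C) :
  frac_factor h k j z = (1 - unit_root (INR j * (INR h / INR k)) * Cexp (2 * RtoC PI * Ci * RtoC (INR j) * z))%C.
Proof.
  unfold frac_factor. f_equal. f_equal.
  replace (2 * RtoC PI * Ci * RtoC (INR j) * (RtoC (INR h / INR k) + z))%C with
    (2 * RtoC PI * Ci * RtoC (INR j * (INR h / INR k)) + 2 * RtoC PI * Ci * RtoC (INR j) * z)%C
    by (rewrite RtoC_mult; ring).
  now rewrite Cexp_plus, Cexp_unit_root.
Qed.

(** * Majorants of the single factors *)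

Lemma near_mod (h k j : nat) : near h k j = near h k (j mod k).
Proof. unfold near. now rewrite Nat.Div0.mul_mod_idemp_l. Qed.

(** The logarithm of the loss factor 1/(1 - 1/(4r)) in [factor_bound]. *)
Definition tail_weight (r : nat) : R := - ln (1 - / (4 * INR r)).

(** With u = 2 pi i j and j <= N, the radius rho gives |u| rho <= 1/(k + 1), hence e^(|u| rho) - 1
    <= 1/k. Against a chord of at least 4 [near]/k this leaves the ratio 1/(4 [near]); for multiples
    of k the loss is 1/(1 - 1/(k + 1)) = 1 + 1/k. *)
Definition factor_bound (h k j : nat) : R :=
  if (j mod k =? 0)%nat then / (2 * PI * INR j) * (1 + / INR k)
  else / chord (INR j * (INR h / INR k)) * / (1 - / (4 * INR (near h k j))).

Lemma chord_lower_mod (h k j : nat) :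
  (0 < k)%nat -> Nat.gcd h k = 1%nat -> (j mod k <> 0)%nat ->
  0 < 4 * INR (near h k j) / INR k <= chord (INR j * (INR h / INR k)) /\ 1 <= INR (near h k j).
Proof.
  intros Hk Hg Hj. pose proof (Nat.mod_upper_bound j k ltac:(lia)).
  pose proof (chord_fraction_lower h k (j mod k) Hg ltac:(lia)) as L.
  rewrite chord_near in L by lia. rewrite chord_near, (near_mod h k j) by lia.
  destruct (near_pos h k (j mod k) Hg ltac:(lia)) as [P _].
  assert (0 < INR k) by now apply lt_0_INR.
  assert (1 <= INR (near h k (j mod k))) by (apply (le_INR 1); lia).
  split; [|assumption]. split; [apply Rdiv_lt_0_compat; lra | exact L].
Qed.

Lemma exp_le_inv (x : R) : x < 1 -> exp x <= / (1 - x).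
Proof.
  intros Hx. rewrite <- (Rinv_inv (exp x)), <- exp_Ropp. apply Rinv_le_contravar; [lra|].
  pose proof (exp_ineq1_le (- x)). lra.
Qed.

Lemma factor_majorized (h k N j : nat) :
  (2 <= k)%nat -> Nat.gcd h k = 1%nat -> (1 <= j <= N)%nat ->
  majorized (fun z => if (j mod k =? 0)%nat then z / frac_factor h k j z else / frac_factor h k j z)%C
    (/ (2 * PI * INR N * (INR k + 1))) (factor_bound h k j).
Proof.
  intros Hk Hg Hj. pose proof PI_RGT_0 as HP.
  assert (K : 2 <= INR k) by (apply (le_INR 2); lia).
  assert (J : 1 <= INR j) by (apply (le_INR 1); lia).
  assert (JN : INR j <= INR N) by (apply le_INR; lia).
  assert (DN : 0 < 2 * PI * INR N * (INR k + 1)) by (apply Rmult_lt_0_compat; [apply Rmult_lt_0_compat|]; lra).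
  set (rho := / (2 * PI * INR N * (INR k + 1))).
  assert (Hr : 0 < rho) by now apply Rinv_0_lt_compat.
  set (u := (2 * RtoC PI * Ci * RtoC (INR j))%C).
  assert (Hu : Cmod u = 2 * PI * INR j) by (apply Cmod_2PIi; lra).
  assert (Hur : Cmod u * rho <= / (INR k + 1)).
  { rewrite Hu. unfold rho.
    replace (2 * PI * INR j * / (2 * PI * INR N * (INR k + 1))) with (INR j / INR N * / (INR k + 1)) by (field; lra).
    rewrite <- (Rmult_1_l (/ (INR k + 1))) at 2. apply Rmult_le_compat_r; [left; apply Rinv_0_lt_compat; lra|].
    apply Rmult_le_reg_r with (INR N); [lra|]. unfold Rdiv. rewrite Rmult_assoc, Rinv_l; lra. }
  assert (I3 : / (INR k + 1) <= / 3) by (apply Rinv_le_contravar; lra).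
  assert (Hex : exp (Cmod u * rho) <= 1 + / INR k).
  { apply Rle_trans with (exp (/ (INR k + 1))).
    - now apply exp_le_compat.
    - eapply Rle_trans; [apply exp_le_inv; lra|]. apply Req_le. field. lra. }
  assert (Ik : 0 < / INR k <= / 2) by (split; [apply Rinv_0_lt_compat | apply Rinv_le_contravar]; lra).
  unfold factor_bound. destruct (Nat.eqb_spec (j mod k) 0) as [Z|Z].
  - apply majorized_ext with (F := (fun z => z / (1 - Cexp (u * z)))%C) (M := / Cmod u * / (1 - Cmod u * rho)).
    + intros z _. rewrite frac_factor_eq. fold u.
      replace (INR j * (INR h / INR k)) with (IZR (Z.of_nat (j / k * h))).
      * rewrite unit_root_IZR. f_equal. f_equal. ring.
      * rewrite <- INR_IZR_INZ, mult_INR. pose proof (Nat.div_mod_eq j k) as E.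
        rewrite Z, Nat.add_0_r in E. apply (f_equal INR) in E. rewrite mult_INR in E. rewrite E. field. lra.
    + rewrite Hu. apply Rmult_le_compat_l; [left; apply Rinv_0_lt_compat; nra|].
      rewrite <- Hu. apply Rle_trans with (/ (1 - / (INR k + 1))).
      * apply Rinv_le_contravar; lra.
      * apply Req_le. field. lra.
    + apply majorized_id_over_exp; [exact Hr | | lra | lra].
      intros E. rewrite E, Cmod_0 in Hu. nra.
  - destruct (chord_lower_mod h k j ltac:(lia) Hg Z) as [[L0 L1] L2].
    set (zeta := unit_root (INR j * (INR h / INR k))) in *. set (ch := chord (INR j * (INR h / INR k))) in *.
    assert (Hch : Cmod (1 - zeta)%C = ch) by apply Cmod_1_minus_unit_root.
    assert (Nz : (1 - zeta)%C <> 0) by (intros E; rewrite E, Cmod_0 in Hch; lra).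
    assert (Hc : Cmod (zeta / (1 - zeta))%C = / ch).
    { rewrite Cmod_div by exact Nz. unfold zeta at 1. rewrite Cmod_unit_root, Hch. unfold Rdiv. ring. }
    set (nr := INR (near h k j)) in *.
    assert (I4 : 0 < / (4 * nr) <= / 4) by (split; [apply Rinv_0_lt_compat | apply Rinv_le_contravar]; lra).
    apply majorized_ext with
      (F := (fun z => / (1 - zeta) * / (1 - zeta / (1 - zeta) * (Cexp (u * z) - 1)))%C)
      (M := Cmod (/ (1 - zeta))%C * / (1 - / (4 * nr))).
    + intros z _. rewrite frac_factor_eq. fold u. fold zeta. rewrite <- Cinv_mult_total. f_equal. field. exact Nz.
    + rewrite Cmod_inv, Hch by exact Nz. apply Rle_refl.
    + apply majorized_mult; [exact Hr | apply majorized_const |].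
      apply majorized_inv_exp; [exact Hr | lra |]. rewrite Hc.
      apply Rle_trans with (/ (4 * nr / INR k) * / INR k).
      * apply Rmult_le_compat.
        -- left. apply Rinv_0_lt_compat. lra.
        -- pose proof (exp_ineq1_le (Cmod u * rho)). pose proof (Cmod_ge_0 u). nra.
        -- apply Rinv_le_contravar; lra.
        -- lra.
      * apply Req_le. field. lra.
Qed.

Lemma factor_bound_pos (h k j : nat) :
  (2 <= k)%nat -> Nat.gcd h k = 1%nat -> (1 <= j)%nat -> 0 < factor_bound h k j.
Proof.
  intros Hk Hg Hj. pose proof PI_RGT_0 as HP.
  assert (K : 2 <= INR k) by (apply (le_INR 2); lia).
  assert (J : 1 <= INR j) by (apply (le_INR 1); lia).
  unfold factor_bound. destruct (Nat.eqb_spec (j mod k) 0) as [Z|Z].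
  - apply Rmult_lt_0_compat; [apply Rinv_0_lt_compat; nra|].
    pose proof (Rinv_0_lt_compat (INR k)). lra.
  - destruct (chord_lower_mod h k j ltac:(lia) Hg Z) as [[L0 L1] L2].
    apply Rmult_lt_0_compat; apply Rinv_0_lt_compat; [lra|].
    assert (/ (4 * INR (near h k j)) <= / 4) by (apply Rinv_le_contravar; lra). lra.
Qed.

(** The residue is the coefficient of index N/k - 1, which the extra factor rho expresses without a
    predecessor. The exponential has modulus 1 at h/k, and 2 PI rho <= 1 bounds its majorant by
    e^|sigma|. *)
Lemma Cmod_Q_le (sigma : R) (h k N : nat) :
  (2 <= k)%nat -> Nat.gcd h k = 1%nat -> (k <= N)%nat ->
  let rho := / (2 * PI * INR N * (INR k + 1)) in
  Cmod (Q h k sigma N) <=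
  2 * PI * exp (Rabs sigma) * (rho * (Rprod (seq 1 N) (factor_bound h k) / rho ^ (N / k))).
Proof.
  intros Hk Hg HN rho. pose proof PI_RGT_0 as HP.
  assert (K : 2 <= INR k) by (apply (le_INR 2); lia).
  assert (NN : 2 <= INR N) by (apply (le_INR 2); lia).
  assert (DN : 0 < 2 * PI * INR N * (INR k + 1)) by (apply Rmult_lt_0_compat; [apply Rmult_lt_0_compat|]; lra).
  assert (Hr : 0 < rho) by now apply Rinv_0_lt_compat.
  assert (Hr1 : 2 * PI * rho <= 1).
  { unfold rho. replace (2 * PI * / (2 * PI * INR N * (INR k + 1))) with (/ (INR N * (INR k + 1))) by (field; lra).
    rewrite <- Rinv_1. apply Rinv_le_contravar; nra. }
  assert (Hs : exists s, (N / k = S s)%nat).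
  { exists (N / k - 1)%nat. pose proof (Nat.Div0.div_le_mono k N k HN) as D.
    rewrite Nat.div_same in D by lia. lia. }
  destruct Hs as [s Hs]. rewrite Hs.
  unfold Q. rewrite Cmod_mult.
  assert (E : Cmod (2 * RtoC PI * Ci)%C = 2 * PI).
  { rewrite <- (Cmult_1_r (2 * RtoC PI * Ci)). rewrite Cmod_2PIi by lra. ring. }
  rewrite E, (Rmult_assoc (2 * PI) (exp _)). apply Rmult_le_compat_l; [lra|].
  set (u := (2 * RtoC PI * Ci * RtoC sigma)%C).
  assert (Hu : Cmod u = 2 * PI * Rabs sigma).
  { unfold u. rewrite Cmod_mult, E, Cmod_R. reflexivity. }
  set (z0 := RtoC (INR h / INR k)).
  assert (M : majorized (fun z => z ^ S s * Qfun sigma N (z0 + z))%C rho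
    (Cmod (Cexp (u * z0)) * exp (Cmod u * rho) * Rprod (seq 1 N) (factor_bound h k))).
  { apply majorized_ext with (F := (fun z => Cexp (u * z0) * Cexp (u * z) * Cprod (seq 1 N)
      (fun j => if (j mod k =? 0)%nat then z / frac_factor h k j z else / frac_factor h k j z))%C)
      (M := Cmod (Cexp (u * z0)) * exp (Cmod u * rho) * Rprod (seq 1 N) (factor_bound h k)); [|apply Rle_refl|].
    - intros z _. rewrite <- Hs. unfold z0. rewrite Qfun_regularized by lia.
      fold u. fold z0. now rewrite <- Cexp_plus, <- Cmult_plus_distr_l.
    - apply majorized_mult; [exact Hr | apply majorized_mult; [exact Hr | apply majorized_const | apply majorized_Cexp] |].
      apply majorized_Cprod; [exact Hr|]. intros j Hj. apply in_seq in Hj. apply factor_majorized; [exact Hk | exact Hg | lia]. }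
  apply Cmod_Res_le in M; [|exact Hr]. eapply Rle_trans; [exact M|].
  assert (U1 : Cmod (Cexp (u * z0)) = 1).
  { replace (u * z0)%C with (2 * RtoC PI * Ci * RtoC (sigma * (INR h / INR k)))%C
      by (unfold u, z0; rewrite (RtoC_mult sigma); ring).
    rewrite Cexp_unit_root. apply Cmod_unit_root. }
  rewrite U1, Rmult_1_l, Hu.
  assert (P0 : 0 <= Rprod (seq 1 N) (factor_bound h k)).
  { left. apply ln_Rprod. intros j Hj. apply in_seq in Hj. apply factor_bound_pos; [exact Hk | exact Hg | lia]. }
  assert (Hp : 0 < rho ^ s) by now apply pow_lt.
  replace (rho * (Rprod (seq 1 N) (factor_bound h k) / rho ^ S s)) with (Rprod (seq 1 N) (factor_bound h k) / rho ^ s)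
    by (simpl; field; lra).
  unfold Rdiv. rewrite Rmult_assoc. apply Rmult_le_compat_r.
  - apply Rmult_le_pos; [exact P0|]. left. now apply Rinv_0_lt_compat.
  - apply exp_le_compat. pose proof (Rabs_pos sigma). nra.
Qed.

(** * The total loss over a period *)

Lemma tail_weight_nonneg (r : nat) : 0 <= tail_weight r.
Proof.
  unfold tail_weight. destruct r as [|r].
  - simpl INR. rewrite Rmult_0_r, Rinv_0, Rminus_0_r, ln_1. lra.
  - assert (1 <= INR (S r)) by (apply (le_INR 1); lia).
    assert (0 < / (4 * INR (S r)) <= / 4) by (split; [apply Rinv_0_lt_compat | apply Rinv_le_contravar]; lra).
    pose proof (ln_le_sub1 (1 - / (4 * INR (S r)))). lra.
Qed.

(** For r > 1 the weight is at most (ln r - ln(r - 1))/4, which telescopes; r = 1 contributes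
    ln(4/3). *)
Lemma Rsum_tail_weight_le (R : nat) :
  (1 <= R)%nat -> Rsum (seq 1 R) tail_weight <= ln (4 / 3) + / 4 * ln (INR R).
Proof.
  intros HR. induction R as [|R IH]; [lia|].
  destruct (Nat.eq_dec R 0) as [->|N].
  - unfold Rsum, tail_weight. simpl. rewrite ln_1.
    replace (1 - / (4 * 1)) with (/ (4 / 3)) by field. rewrite ln_Rinv by lra. lra.
  - specialize (IH ltac:(lia)). rewrite seq_S, Rsum_app.
    change (Rsum [(1 + R)%nat] tail_weight) with (tail_weight (S R) + 0).
    enough (tail_weight (S R) <= / 4 * ln (INR (S R)) - / 4 * ln (INR R)) by lra.
    assert (H1 : 1 <= INR R) by (apply (le_INR 1); lia).
    unfold tail_weight. rewrite S_INR. set (y := INR R) in *.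
    assert (0 < / (4 * (y + 1)) <= / 8) by (split; [apply Rinv_0_lt_compat | apply Rinv_le_contravar]; lra).
    set (t := 1 - / (4 * (y + 1))) in *.
    assert (Ht : 0 < t) by (unfold t; lra).
    enough (ln (y / (y + 1)) <= 4 * ln t) by (rewrite ln_div in H0 by lra; lra).
    (* Bernoulli: [1 - 1/r <= (1 - 1/(4r))^4] *)
    replace (4 * ln t) with (ln (t ^ 4)) by (rewrite ln_pow by assumption; simpl; ring).
    apply ln_le; [apply Rdiv_lt_0_compat; lra|].
    replace (y / (y + 1)) with (1 - 4 * (1 - t)) by (unfold t; field; lra).
    assert (0 < 1 - t <= / 8) by (unfold t; lra). simpl.
    assert (1 - 2 * (1 - t) <= t * t) by nra. 
    nra.
Qed.

(** Twice the bound of [Rsum_tail_weight_le] at k/2, since [near] takes each value at most twice in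
    a period. *)
Definition block_weight (k : nat) : R := 2 * ln (4 / 3) + / 2 * ln (INR k / 2).

Lemma Rsum_tail_weight_near_le (h k m : nat) :
  (2 <= k)%nat -> Nat.gcd h k = 1%nat -> (m < k)%nat ->
  Rsum (seq 1 m) (fun j => tail_weight (near h k j)) <= block_weight k.
Proof.
  intros Hk Hg Hm.
  eapply Rle_trans; [apply (Rsum_near_le h k m tail_weight Hg Hm tail_weight_nonneg)|].
  assert (H2 : (1 <= k / 2)%nat) by (apply (Nat.div_le_lower_bound k 2 1); lia).
  pose proof (Rsum_tail_weight_le (k / 2) H2) as S.
  assert (L : ln (INR (k / 2)) <= ln (INR k / 2)).
  { apply ln_le; [apply lt_0_INR; lia|].
    assert (E : (2 * (k / 2) <= k)%nat) by apply Nat.Div0.mul_div_le.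
    apply le_INR in E. rewrite mult_INR in E. simpl INR in E at 1. lra. }
  unfold block_weight. lra.
Qed.

Lemma ln_factor_bound_generic (h k j : nat) :
  (2 <= k)%nat -> Nat.gcd h k = 1%nat -> (j mod k <> 0)%nat ->
  ln (factor_bound h k j) = - ln (chord (INR j * (INR h / INR k))) + tail_weight (near h k j).
Proof.
  intros Hk Hg Hj. destruct (chord_lower_mod h k j ltac:(lia) Hg Hj) as [[L0 L1] L2].
  assert (/ (4 * INR (near h k j)) <= / 4) by (apply Rinv_le_contravar; lra).
  unfold factor_bound. destruct (Nat.eqb_spec (j mod k) 0); [contradiction|].
  rewrite ln_mult by (apply Rinv_0_lt_compat; lra).
  rewrite !ln_Rinv by lra. reflexivity.
Qed.

Lemma chord_shift_block (h k l i : nat) : (0 < k)%nat ->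
  chord (INR (k * l + i) * (INR h / INR k)) = chord (INR i * (INR h / INR k)).
Proof.
  intros Hk. assert (0 < INR k) by now apply lt_0_INR.
  rewrite <- (chord_IZR_period (INR i * (INR h / INR k)) (Z.of_nat (l * h))).
  f_equal. rewrite <- INR_IZR_INZ, plus_INR, !mult_INR. field. lra.
Qed.

Lemma ln_factor_bound_block (h k l i : nat) :
  (2 <= k)%nat -> Nat.gcd h k = 1%nat -> (0 < i < k)%nat ->
  ln (factor_bound h k (k * l + i)) = - ln (chord (INR i * (INR h / INR k))) + tail_weight (near h k i).
Proof.
  intros Hk Hg Hi.
  assert (E : ((k * l + i) mod k = i)%nat).
  { rewrite Nat.add_comm, Nat.mul_comm, Nat.Div0.mod_add. apply Nat.mod_small. lia. }
  rewrite ln_factor_bound_generic by (rewrite ?E; assumption || lia).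
  now rewrite chord_shift_block, near_mod, E by lia.
Qed.

Lemma Rsum_ln_chord_full (h k : nat) :
  (2 <= k)%nat -> Nat.gcd h k = 1%nat ->
  Rsum (seq 1 (k - 1)) (fun j => - ln (chord (INR j * (INR h / INR k)))) = - ln (INR k).
Proof.
  intros Hk Hg.
  pose proof (prod_chord_nontrivial (Z.of_nat h) k ltac:(lia) (Zgcd_of_nat_1 h k Hg)) as P.
  rewrite <- INR_IZR_INZ in P.
  destruct (ln_Rprod (seq 1 (k - 1)) (fun r => chord (INR r * (INR h / INR k)))) as [_ E].
  { intros j Hj. apply in_seq in Hj. pose proof (chord_fraction_lower h k j Hg ltac:(lia)).
    destruct (near_pos h k j Hg ltac:(lia)) as [N _]. apply lt_0_INR in N.
    assert (0 < INR k) by (apply lt_0_INR; lia).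
    apply Rlt_le_trans with (2 := H). apply Rdiv_lt_0_compat; lra. }
  rewrite P in E. rewrite E.
  rewrite <- (Rmult_1_l (Rsum _ (fun r => ln _))), Ropp_mult_distr_l, <- Rsum_scal.
  apply Rsum_ext_in. intros j _. ring.
Qed.

(** Each period gives -ln k + [block_weight k] from the k - 1 regular factors, whose chords multiply
    to k, and at most -ln(2 PI k l) + 1/k from the pole factor j = kl. *)
Lemma Rsum_ln_factor_bound_le (h k s : nat) :
  (2 <= k)%nat -> Nat.gcd h k = 1%nat ->
  Rsum (seq 1 (k * s)) (fun j => ln (factor_bound h k j)) <=
  INR s * (block_weight k - 2 * ln (INR k) - ln (2 * PI) + / INR k) - ln (INR (fact s)).
Proof.
  intros Hk Hg. pose proof PI_RGT_0 as HP.
  assert (K : 2 <= INR k) by (apply (le_INR 2); lia).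
  induction s as [|s IH].
  - rewrite Nat.mul_0_r. unfold Rsum. simpl. rewrite ln_1. lra.
  - rewrite Nat.mul_succ_r, seq_app, Rsum_app.
    replace (seq (1 + k * s) k) with (seq (k * s + 1) (k - 1) ++ [(k * S s)%nat]).
    2:{ replace (1 + k * s)%nat with (k * s + 1)%nat by lia.
        replace k with (S (k - 1)) at 5 by lia. rewrite seq_S. do 2 f_equal. nia. }
    rewrite Rsum_app, <- map_add_seq, Rsum_map.
    assert (B1 : Rsum (seq 1 (k - 1)) (fun i => ln (factor_bound h k (k * s + i))) <= - ln (INR k) + block_weight k).
    { rewrite (Rsum_ext_in _ _ (fun i => - ln (chord (INR i * (INR h / INR k))) + tail_weight (near h k i))).
      - rewrite Rsum_plus, Rsum_ln_chord_full by assumption. apply Rplus_le_compat_l.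
        apply Rsum_tail_weight_near_le; try assumption. lia.
      - intros i Hi. apply in_seq in Hi. apply ln_factor_bound_block; [assumption | assumption | lia]. }
    assert (B2 : Rsum [(k * S s)%nat] (fun j => ln (factor_bound h k j)) <=
       - ln (INR (S s)) - ln (2 * PI) - ln (INR k) + / INR k).
    { change (ln (factor_bound h k (k * S s)) + 0 <= - ln (INR (S s)) - ln (2 * PI) - ln (INR k) + / INR k).
      unfold factor_bound. rewrite Nat.mul_comm, Nat.Div0.mod_mul, Nat.eqb_refl, mult_INR.
      assert (Sp : 0 < INR (S s)) by (apply lt_0_INR; lia).
      assert (Kp : 0 < / INR k) by (apply Rinv_0_lt_compat; lra).
      assert (0 < 2 * PI * (INR (S s) * INR k)) by (apply Rmult_lt_0_compat; [|apply Rmult_lt_0_compat]; lra).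
      assert (0 < INR (S s) * INR k) by (apply Rmult_lt_0_compat; lra).
      rewrite ln_mult by (try apply Rinv_0_lt_compat; lra).
      rewrite ln_Rinv by assumption. rewrite (ln_mult (2 * PI)), (ln_mult (INR (S s))) by lra.
      pose proof (ln_le_sub1 (1 + / INR k)). lra. }
    rewrite fact_simpl, mult_INR, (ln_mult (INR (S s)) _ (lt_0_INR (S s) (Nat.lt_0_succ s)) (INR_fact_lt_0 s)).
    rewrite (S_INR s) at 1. lra.
Qed.

(** With s the integer part of N/k, rho^(-s) brings s (ln(2 PI) + ln N + ln(k + 1)) and the full
    periods bring -s (ln(2 PI) + 2 ln k) - ln s!. What remains is s ln(N/k) - ln s! <= N/k and, per
    period, the block weight, 1/k from the pole factor and 1/k from ln(k + 1) - ln k. *)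
Lemma Q_exp_bound (sigma : R) (h k N : nat) :
  (101 <= k)%nat -> Nat.gcd h k = 1%nat -> (k <= N)%nat ->
  Cmod (Q h k sigma N) <=
  exp (Rabs sigma + INR N / INR k * (1 + 3 / INR k + block_weight k) +
       Rsum (seq 1 (N mod k)) (fun j => - ln (chord (INR j * (INR h / INR k))))).
Proof.
  intros Hk Hg HN. pose proof PI_RGT_0 as HP.
  eapply Rle_trans; [apply Cmod_Q_le; [lia | exact Hg | exact HN]|].
  assert (K : 101 <= INR k) by (apply (le_INR 101) in Hk; simpl in Hk; lra).
  assert (NN : INR k <= INR N) by now apply le_INR.
  set (rho := / (2 * PI * INR N * (INR k + 1))).
  assert (DN : 0 < 2 * PI * INR N * (INR k + 1)) by (apply Rmult_lt_0_compat; [apply Rmult_lt_0_compat|]; lra).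
  assert (Hr : 0 < rho) by now apply Rinv_0_lt_compat.
  assert (Lr : ln rho = - (ln (2 * PI) + ln (INR N) + ln (INR k + 1))).
  { unfold rho. rewrite ln_Rinv by assumption. rewrite !ln_mult by (try apply Rmult_lt_0_compat; lra). ring. }
  set (s := (N / k)%nat). set (m := (N mod k)%nat).
  assert (En : N = (k * s + m)%nat) by apply Nat.div_mod_eq.
  assert (Hm : (m < k)%nat) by (apply Nat.mod_upper_bound; lia).
  destruct (ln_Rprod (seq 1 N) (factor_bound h k)) as [PP PE].
  { intros j Hj. apply in_seq in Hj. apply factor_bound_pos; [lia | exact Hg | lia]. }
  set (T := Rsum (seq 1 m) (fun j => - ln (chord (INR j * (INR h / INR k))))).
  assert (PL : ln (Rprod (seq 1 N) (factor_bound h k)) <=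
     INR s * (block_weight k - 2 * ln (INR k) - ln (2 * PI) + / INR k) - ln (INR (fact s)) + (T + block_weight k)).
  { rewrite PE. rewrite En at 1. rewrite seq_app, Rsum_app.
    apply Rplus_le_compat; [apply Rsum_ln_factor_bound_le; [lia | exact Hg]|].
    replace (1 + k * s)%nat with (k * s + 1)%nat by lia.
    rewrite <- map_add_seq, Rsum_map.
    rewrite (Rsum_ext_in _ _ (fun i => - ln (chord (INR i * (INR h / INR k))) + tail_weight (near h k i))).
    - rewrite Rsum_plus. apply Rplus_le_compat_l. apply Rsum_tail_weight_near_le; [lia | exact Hg | exact Hm].
    - intros i Hi. apply in_seq in Hi. apply ln_factor_bound_block; [lia | exact Hg | lia]. }
  assert (Hrs : 0 < rho ^ s) by now apply pow_lt.
  set (P := Rprod (seq 1 N) (factor_bound h k)) in *.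
  assert (TP : 0 < 2 * PI * (rho * (P / rho ^ s))).
  { apply Rmult_lt_0_compat; [lra|]. apply Rmult_lt_0_compat; [exact Hr|]. now apply Rdiv_lt_0_compat. }
  replace (2 * PI * exp (Rabs sigma) * (rho * (P / rho ^ s))) with
    (exp (Rabs sigma) * (2 * PI * (rho * (P / rho ^ s)))) by ring.
  rewrite <- (exp_ln _ TP), <- exp_plus.
  apply exp_le_compat. rewrite Rplus_assoc. apply Rplus_le_compat_l.
  rewrite (ln_mult (2 * PI) (rho * _)); [|lra | apply Rmult_lt_0_compat; [lra | now apply Rdiv_lt_0_compat]].
  rewrite (ln_mult rho); [|lra | now apply Rdiv_lt_0_compat].
  rewrite ln_div by assumption. rewrite ln_pow by assumption.
  assert (Sp : 0 < INR s).
  { apply lt_0_INR. unfold s. pose proof (Nat.Div0.div_le_mono k N k HN) as D.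
    rewrite Nat.div_same in D by lia. lia. }
  assert (SN : INR s <= INR N / INR k).
  { apply Rmult_le_reg_r with (INR k); [lra|]. unfold Rdiv. rewrite Rmult_assoc, Rinv_l by lra.
    rewrite <- mult_INR, Rmult_1_r. apply le_INR. lia. }
  set (y := INR N / INR k) in *.
  assert (Hy : 0 < y) by (apply Rdiv_lt_0_compat; lra).
  assert (Ly : ln y = ln (INR N) - ln (INR k)) by (apply ln_div; lra).
  assert (ST : INR s * ln y - ln (INR (fact s)) <= y).
  { pose proof (INR_fact_lt_0 s). assert (0 < y ^ s) by now apply pow_lt.
    rewrite <- ln_pow by exact Hy. rewrite <- ln_div by assumption.
    rewrite <- (ln_exp y) at 2. apply ln_le; [now apply Rdiv_lt_0_compat|].
    apply pow_fact_le_exp. lra. }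
  assert (L1 : ln (INR k + 1) <= ln (INR k) + / INR k).
  { replace (INR k + 1) with (INR k * (1 + / INR k)) by (field; lra).
    assert (0 < / INR k) by (apply Rinv_0_lt_compat; lra).
    rewrite ln_mult by lra. pose proof (ln_le_sub1 (1 + / INR k)). lra. }
  assert (L43 : 0 <= ln (4 / 3)) by (rewrite <- ln_1; apply ln_le; lra).
  assert (Lk2 : 0 <= ln (INR k / 2)) by (rewrite <- ln_1; apply ln_le; lra).
  (* The loss of the partial period is paid for by the spare factor rho, for 2 PI rho is at most
     1/(k + 1). *)
  assert (BW : block_weight k <= ln (INR k)).
  { unfold block_weight.
    replace (2 * ln (4 / 3) + / 2 * ln (INR k / 2)) with (/ 2 * (ln ((4 / 3) ^ 4 * (INR k / 2)))).
    - replace (ln (INR k)) with (/ 2 * ln (INR k ^ 2)) by (rewrite ln_pow by lra; simpl; field).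
      apply Rmult_le_compat_l; [lra|]. apply ln_le; simpl; nra.
    - rewrite ln_mult by (simpl; lra). rewrite ln_pow by lra. simpl. field. }
  assert (BW0 : 0 <= block_weight k) by (unfold block_weight; lra).
  assert (LN : 0 <= ln (INR N)) by (rewrite <- ln_1; apply ln_le; lra).
  assert (Lk1 : ln (INR k) <= ln (INR k + 1)) by (apply ln_le; lra).
  assert (M1 : INR s * (2 * / INR k + block_weight k) <= y * (2 * / INR k + block_weight k))
    by (apply Rmult_le_compat_r; lra).
  assert (M2 : INR s * ln (INR k + 1) <= INR s * (ln (INR k) + / INR k)) by (apply Rmult_le_compat_l; lra).
  rewrite Lr. unfold Rdiv. rewrite Ly in ST.
  assert (0 <= y * / INR k) by (apply Rmult_le_pos; lra).
  clear - PL ST L1 BW BW0 LN Lk1 M1 M2 H.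
  nra.
Qed.

(** * Summation over the Farey fractions *)

Lemma congr_any_false (h k : nat) (l : list Z) (b a : Z) :
  negb (congr_any h k l) = true -> In b l -> (Z.of_nat h - b <> a * Z.of_nat k)%Z.
Proof.
  intros H Hb E. apply Bool.negb_true_iff in H. unfold congr_any in H.
  assert (X : existsb (congr_mod k (Z.of_nat h)) l = true); [|congruence].
  apply existsb_exists. exists b. split; [exact Hb|]. unfold congr_mod. apply Z.eqb_eq.
  rewrite E. destruct (Z.eq_dec (Z.of_nat k) 0) as [->|N]; [now rewrite Z.mul_0_r | now apply Z.mod_mul].
Qed.

(** Take D = 1, 2, 3 according as k <= N/3, N/3 < k <= N/2, N/2 < k. A nonzero q |beta| < D would
    need q = 1 and h = +-1 or +-2 mod k, or q = 2 and |2h - ak| = 1, that is h = (k +- 1)/2; these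
    are the excluded classes. *)
Lemma B_spec (N h k : nat) : In (h, k) (B 101 N) ->
  (101 <= k <= N)%nat /\ Nat.gcd h k = 1%nat /\
  exists D : nat, (1 <= D)%nat /\ INR k / INR D <= INR N / 3 /\
    forall (q : nat) (a : Z), (1 <= q)%nat -> (Z.of_nat h * Z.of_nat q - a * Z.of_nat k <> 0)%Z ->
      (Z.of_nat D <= Z.of_nat q * Z.abs (Z.of_nat h * Z.of_nat q - a * Z.of_nat k))%Z.
Proof.
  intros Hin. apply filter_In in Hin. destruct Hin as [_ Hin]. unfold inB in Hin.
  rewrite !Bool.andb_true_iff in Hin.
  destruct Hin as [[[[[H1 H2] H3] H4] H5] H6].
  apply Nat.leb_le in H1. apply Nat.leb_le in H2. apply Nat.ltb_lt in H3. apply Nat.eqb_eq in H4.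
  split; [lia|]. split; [exact H4|].
  destruct (Nat.ltb_spec N (3 * k)) as [A3|A3].
  - destruct (Nat.leb_spec (2 * k) N) as [A2|A2].
    + cbn [andb] in H5. exists 2%nat. split; [lia|]. split.
      * apply le_INR in A2. rewrite mult_INR in A2. replace (INR 2) with 2 in * by (simpl; ring).
        pose proof (pos_INR k). lra.
      * intros q a Hq Hnz.
        assert (C1 := fun a => congr_any_false h k _ 1 a H5 ltac:(simpl; auto 10)).
        assert (C2 := fun a => congr_any_false h k _ (-1) a H5 ltac:(simpl; auto 10)).
        specialize (C1 a). specialize (C2 a).
        destruct (Z_le_gt_dec 2 (Z.of_nat q)); [nia|]. replace q with 1%nat in * by lia.
        change (Z.of_nat 1) with 1%Z in *. change (Z.of_nat 2) with 2%Z. rewrite Z.mul_1_r in *. lia.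
    + destruct (Nat.ltb_spec N (2 * k)) as [_|]; [|lia]. destruct (Nat.leb_spec k N) as [_|]; [|lia].
      cbn [andb] in H6. exists 3%nat. split; [lia|]. split.
      * apply le_INR in H2. replace (INR 3) with 3 by (simpl; ring). lra.
      * intros q a Hq Hnz.
        assert (C1 := fun a => congr_any_false h k _ 1 a H6 ltac:(simpl; auto 10)).
        assert (C2 := fun a => congr_any_false h k _ (-1) a H6 ltac:(simpl; auto 10)).
        assert (C3 := fun a => congr_any_false h k _ 2 a H6 ltac:(simpl; auto 10)).
        assert (C4 := fun a => congr_any_false h k _ (-2) a H6 ltac:(simpl; auto 10)).
        specialize (C1 a). specialize (C2 a). specialize (C3 a). specialize (C4 a).
        change (Z.of_nat 3) with 3%Z.
        destruct (Z_le_gt_dec 3 (Z.of_nat q)); [nia|].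
        assert (Hq2 : q = 1%nat \/ q = 2%nat) by lia. destruct Hq2 as [-> | ->].
        -- change (Z.of_nat 1) with 1%Z in *. rewrite Z.mul_1_r in *. lia.
        -- change (Z.of_nat 2) with 2%Z in *.
           set (beta := (Z.of_nat h * 2 - a * Z.of_nat k)%Z) in *.
           destruct (Z_le_gt_dec 2 (Z.abs beta)); [lia|]. exfalso.
           (* Since 0 <= h < k, the other candidates are a = 0 and a = 2, where 2h - ak is even and
              cannot be +-1. *)
           assert (Ha : a = 1%Z) by (unfold beta in *; nia). subst a.
           assert (Hodd : Nat.odd k = true).
           { destruct (Nat.odd k) eqn:O; [reflexivity|]. exfalso.
             assert (Ev : Nat.even k = true) by (rewrite <- Nat.negb_odd, O; reflexivity).
             apply Nat.even_spec in Ev. destruct Ev as [c Hc]. unfold beta in *. lia. }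
           unfold half_residues in H6. rewrite Hodd in H6.
           assert (C5 := congr_any_false h k _ ((Z.of_nat k - 1) / 2) 0 H6 ltac:(simpl; auto 10)).
           assert (C6 := congr_any_false h k _ ((Z.of_nat k + 1) / 2) 0 H6 ltac:(simpl; auto 10)).
           unfold beta in *. rewrite Z.mul_0_l in C5, C6.
           pose proof (Z.div_mod (Z.of_nat k - 1) 2). pose proof (Z.mod_pos_bound (Z.of_nat k - 1) 2).
           pose proof (Z.div_mod (Z.of_nat k + 1) 2). pose proof (Z.mod_pos_bound (Z.of_nat k + 1) 2). lia.
  - exists 1%nat. split; [lia|]. split.
    + apply le_INR in A3. rewrite mult_INR in A3. replace (INR 3) with 3 in A3 by (simpl; ring).
      replace (INR 1) with 1 by reflexivity. lra.
    + intros q a Hq Hnz. nia.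
Qed.

(** The tangent to the logarithm at 1/t. *)
Lemma ln_le_linear (t x : R) : 0 < t -> 0 < x -> ln x <= t * x - 1 - ln t.
Proof.
  intros Ht Hx. pose proof (ln_le_sub1 (t * x)) as H. rewrite ln_mult in H by assumption.
  assert (0 < t * x) by now apply Rmult_lt_0_compat. lra.
Qed.

(** The coefficient of N that the full periods contribute in [Q_exp_bound]. *)
Definition pole_exponent (k : nat) : R := (1 + 3 / INR k + block_weight k) / INR k.

Lemma pole_exponent_le (k : nat) : (101 <= k)%nat -> pole_exponent k <= ksine / 3.
Proof.
  intros Hk. assert (K : 101 <= INR k) by (apply (le_INR 101) in Hk; simpl in Hk; lra).
  pose proof PI_bounds as HP. pose proof Cl2_lower as HC.
  apply Rle_trans with 0.042.
  - unfold pole_exponent, block_weight.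
    apply Rmult_le_reg_r with (INR k); [lra|]. unfold Rdiv at 1. rewrite Rmult_assoc, Rinv_l, Rmult_1_r by lra.
    pose proof (ln_le_sub1 (4 / 3)) as L1.
    pose proof (ln_le_linear (/ 35) (INR k / 2)) as L2. rewrite ln_Rinv in L2 by lra.
    assert (L3 : ln 35 <= 4).
    { rewrite <- (ln_exp 4). apply ln_le; [lra|].
      pose proof (exp_quarter_lower 16) as E. simpl in E. replace (_ / 4) with 4 in E by field. lra. }
    assert (I : 3 / INR k <= 3 / 101).
    { apply Rmult_le_compat_l; [lra|]. apply Rinv_le_contravar; lra. }
    lra.
  - unfold ksine. unfold Rdiv.
    apply Rmult_le_reg_r with (2 * PI * 3); [lra|]. field_simplify; lra.
Qed.

Lemma pole_exponent_small (eps : R) : 0 < eps -> exists k0 : nat, forall k, (k0 <= k)%nat -> (101 <= k)%nat ->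
  pole_exponent k <= eps.
Proof.
  intros He.
  set (A := 4 + Rabs (ln eps)).
  destruct (INR_unbounded (A * (2 / eps))) as [k0 Hk0]. exists k0. intros k Hk1 Hk2.
  assert (K : 101 <= INR k) by (apply (le_INR 101) in Hk2; simpl in Hk2; lra).
  apply le_INR in Hk1.
  unfold pole_exponent, block_weight.
  apply Rmult_le_reg_r with (INR k); [lra|]. unfold Rdiv at 1. rewrite Rmult_assoc, Rinv_l, Rmult_1_r by lra.
  pose proof (ln_le_sub1 (4 / 3)) as L1.
  pose proof (ln_le_linear eps (INR k / 2) He) as L2.
  assert (L4 : - ln eps <= Rabs (ln eps)) by (rewrite <- Rabs_Ropp; apply Rle_abs).
  assert (I : 3 / INR k <= 3 / 101).
  { apply Rmult_le_compat_l; [lra|]. apply Rinv_le_contravar; lra. }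
  assert (L5 : A <= eps / 2 * INR k).
  { apply Rle_trans with (eps / 2 * (A * (2 / eps))).
    - apply Req_le. field. lra.
    - apply Rmult_le_compat_l; lra. }
  unfold A in L5. nra.
Qed.

(** For k >= k0 the full periods cost at most eps N and the partial period at most (ksine/3 + eps) N
    up to a constant, as k/D <= N/3. For k < k0 the partial period is bounded, and the full periods
    cost at most ksine N/3. *)
Lemma Q_uniform_bound (sigma eps : R) : 0 < eps -> exists C : R, forall N h k : nat,
  In (h, k) (B 101 N) -> Cmod (Q h k sigma N) <= exp ((ksine / 3 + 2 * eps) * INR N + C).
Proof.
  intros He. pose proof ksine_pos as HK.
  destruct (sine_product_bound eps He) as [C0 HC0].
  destruct (pole_exponent_small eps He) as [k0 Hk0].
  exists (Rabs sigma + C0 + (ksine + eps) * INR k0).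
  intros N h k Hin. destruct (B_spec N h k Hin) as [Hk [Hg [D [HD [HDN Happ]]]]].
  eapply Rle_trans; [apply Q_exp_bound; [lia | exact Hg | lia]|].
  assert (Hm : (N mod k < k)%nat) by (apply Nat.mod_upper_bound; lia).
  pose proof (HC0 h k (N mod k)%nat D ltac:(lia) Hg Hm HD Happ) as S.
  assert (K : 101 <= INR k) by (destruct Hk as [Hk _]; apply (le_INR 101) in Hk; simpl in Hk; lra).
  assert (NN : INR k <= INR N) by (apply le_INR; lia).
  assert (Dp : 1 <= INR D) by (apply (le_INR 1); lia).
  apply exp_le_compat.
  replace (INR N / INR k * (1 + 3 / INR k + block_weight k)) with (INR N * pole_exponent k)
    by (unfold pole_exponent; field; lra).
  assert (K0 : 0 <= INR k0) by apply pos_INR.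
  destruct (le_lt_dec k0 k) as [H|H].
  - specialize (Hk0 k H ltac:(lia)).
    assert (INR N * pole_exponent k <= INR N * eps) by (apply Rmult_le_compat_l; lra).
    assert (ksine / INR D * INR k <= ksine / 3 * INR N).
    { replace (ksine / INR D * INR k) with (ksine * (INR k / INR D)) by (field; lra).
      replace (ksine / 3 * INR N) with (ksine * (INR N / 3)) by field. apply Rmult_le_compat_l; lra. }
    assert (eps * INR k <= eps * INR N) by (apply Rmult_le_compat_l; lra).
    assert (0 <= (ksine + eps) * INR k0) by (apply Rmult_le_pos; lra). lra.
  - pose proof (pole_exponent_le k ltac:(lia)) as PE.
    assert (INR N * pole_exponent k <= INR N * (ksine / 3)) by (apply Rmult_le_compat_l; lra).
    assert (INR k <= INR k0) by (apply le_INR; lia).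
    assert (ksine / INR D <= ksine).
    { unfold Rdiv. rewrite <- (Rmult_1_r ksine) at 2. apply Rmult_le_compat_l; [lra|].
      rewrite <- Rinv_1. apply Rinv_le_contravar; lra. }
    assert ((ksine / INR D + eps) * INR k <= (ksine + eps) * INR k0).
    { apply Rmult_le_compat; try lra. apply Rplus_le_le_0_compat; [|lra].
      apply Rmult_le_pos; [lra|]. left. apply Rinv_0_lt_compat. lra. }
    assert (0 <= eps * INR N) by (apply Rmult_le_pos; lra). lra.
Qed.

Lemma Cmod_Csum_le {A : Type} (l : list A) (f : A -> C) (M : R) :
  (forall a, In a l -> Cmod (f a) <= M) -> Cmod (Csum l f) <= INR (length l) * M.
Proof.
  induction l as [|a l IH]; intros H.
  - unfold Csum. simpl. rewrite Cmod_0. lra.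
  - change (Csum (a :: l) f) with (f a + Csum l f)%C. simpl length. rewrite S_INR.
    eapply Rle_trans; [apply Cmod_triangle|].
    specialize (IH ltac:(intros b Hb; apply H; now right)).
    specialize (H a ltac:(now left)). lra.
Qed.

Lemma length_B_le (K N : nat) : (length (B K N) <= S N * S N)%nat.
Proof.
  unfold B. eapply Nat.le_trans; [apply filter_length_le|]. now rewrite length_prod, !length_seq.
Qed.

(** The gap W - ksine/3 is 3 eps: two go to the residue bound, the third absorbs the number of
    fractions, at most (N + 1)^2. *)
Lemma sum_is_O_exp_of_gt (sigma W : R) : Cl2 (PI / 3) / (6 * PI) < W -> sum_is_O_exp sigma W.
Proof.
  intros HW. pose proof PI_RGT_0 as HP.
  replace (Cl2 (PI / 3) / (6 * PI)) with (ksine / 3) in HW by (unfold ksine; field; lra).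
  set (eps := (W - ksine / 3) / 3). assert (He : 0 < eps) by (unfold eps; lra).
  destruct (Q_uniform_bound sigma eps He) as [C HC].
  set (T := 1 + 2 / eps).
  assert (HT : 0 < 2 / eps) by (apply Rdiv_lt_0_compat; lra).
  exists (T * T * exp C), 0%nat. intros N _.
  eapply Rle_trans; [apply Cmod_Csum_le with (M := exp ((ksine / 3 + 2 * eps) * INR N + C))|].
  - intros [h k] Hin. simpl. now apply HC.
  - assert (NN : 0 <= INR N) by apply pos_INR.
    pose proof (le_INR _ _ (length_B_le 101 N)) as HL. rewrite mult_INR, !S_INR in HL.
    replace (W * INR N) with (eps / 2 * INR N + eps / 2 * INR N + (ksine / 3 + 2 * eps) * INR N) by (unfold eps; field).
    rewrite !exp_plus.
    set (X := exp (eps / 2 * INR N)). set (Y := exp ((ksine / 3 + 2 * eps) * INR N)).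
    assert (HX : 1 + eps / 2 * INR N <= X) by apply exp_ineq1_le.
    assert (HN : INR N + 1 <= T * X).
    { apply Rle_trans with (T * (1 + eps / 2 * INR N)); [|apply Rmult_le_compat_l; unfold T in *; lra].
      unfold T. replace ((1 + 2 / eps) * (1 + eps / 2 * INR N)) with (1 + 2 / eps + eps / 2 * INR N + INR N) by (field; lra).
      assert (0 <= eps / 2 * INR N) by (apply Rmult_le_pos; lra). lra. }
    assert (0 < Y) by apply exp_pos. assert (0 < exp C) by apply exp_pos.
    apply Rle_trans with ((INR N + 1) * (INR N + 1) * (Y * exp C)).
    + apply Rmult_le_compat_r; [|exact HL]. left. now apply Rmult_lt_0_compat.
    + replace (T * T * exp C * (X * X * Y)) with ((T * X) * (T * X) * (Y * exp C)) by ring.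
      apply Rmult_le_compat_r; [left; now apply Rmult_lt_0_compat|]. apply Rmult_le_compat; lra.
Qed.

(** * Zeros of the dilogarithm equation *)

Lemma cos_2_atan (T : R) : cos (2 * atan T) = (1 - T ^ 2) / (1 + T ^ 2).
Proof.
  rewrite cos_2a_cos, cos_atan.
  assert (H : 0 < 1 + T²) by (unfold Rsqr; nra).
  assert (E : 1 / sqrt (1 + T²) * (1 / sqrt (1 + T²)) = / (1 + T²)).
  { pose proof (sqrt_lt_R0 _ H) as S. pose proof (sqrt_sqrt (1 + T²) ltac:(lra)) as E.
    rewrite <- E at 3. field. lra. }
  rewrite Rmult_assoc, E. unfold Rsqr. simpl. field. unfold Rsqr in H. nra.
Qed.

Lemma atan_nonneg (x : R) : 0 <= x -> 0 <= atan x.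
Proof.
  intros [H | <-]; [|rewrite atan_0; lra]. rewrite <- atan_0. left. now apply atan_increasing.
Qed.

Lemma Arg_unique (z : C) (phi : R) :
  Re z / Cmod z = cos phi -> - PI <= phi <= PI -> (0 <= Im z -> 0 <= phi) -> (Im z < 0 -> phi <= 0) ->
  Arg z = phi.
Proof.
  intros E Hphi H1 H2. unfold Arg. rewrite E. destruct (Rle_dec 0 (Im z)) as [I|I].
  - apply acos_cos. specialize (H1 I). lra.
  - rewrite <- cos_neg, acos_cos by (specialize (H2 ltac:(lra)); lra). ring.
Qed.

(** tan(arg(z)/2) = Im z/(|z| + Re z) is a single formula on the whole slit plane, differentiable
    there, in place of the case distinction in [Arg]. *)
Lemma Arg_half_angle (z : C) : 0 < Cmod z + Re z -> Arg z = 2 * atan (Im z / (Cmod z + Re z)).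
Proof.
  intros H. set (T := Im z / (Cmod z + Re z)).
  assert (M2 : Cmod z ^ 2 = Re z ^ 2 + Im z ^ 2).
  { replace (Cmod z ^ 2) with (Cmod z * Cmod z) by ring. unfold Cmod, Re, Im. apply sqrt_sqrt.
    apply Rplus_le_le_0_compat; apply pow2_ge_0. }
  assert (M0 : 0 < Cmod z).
  { pose proof (Cmod_ge_0 z). destruct (Req_dec (Cmod z) 0) as [E|]; [|lra].
    exfalso. rewrite E in M2, H. nra. }
  assert (E : Re z / Cmod z = cos (2 * atan T)).
  { rewrite cos_2_atan. unfold T.
    assert (N : Im z ^ 2 = (Cmod z - Re z) * (Cmod z + Re z)) by (simpl in *; nra).
    replace ((Im z / (Cmod z + Re z)) ^ 2) with ((Cmod z - Re z) / (Cmod z + Re z)).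
    - field. lra.
    - unfold Rdiv. rewrite Rpow_mult_distr, N. field. lra. }
  assert (I : 0 < / (Cmod z + Re z)) by now apply Rinv_0_lt_compat.
  pose proof (atan_bound T) as Bd. apply Arg_unique; [exact E | lra | |]; intros Hz.
  - assert (0 <= atan T) by (apply atan_nonneg, Rmult_le_pos; lra). lra.
  - assert (0 <= atan (- T)); [|rewrite atan_opp in *; lra].
    apply atan_nonneg. unfold T, Rdiv. rewrite Ropp_mult_distr_l. apply Rmult_le_pos; lra.
Qed.

(** For w = p + iq this is |1 - tw|^2; [logmod] and [argm] are the real and imaginary parts of log(1
    - tw). *)
Definition modsq (p q t : R) : R := (1 - t * p) ^ 2 + (t * q) ^ 2.

Definition logmod (p q t : R) : R := ln (modsq p q t) / 2.

Definition argm (p q t : R) : R := 2 * atan (- (t * q) / (sqrt (modsq p q t) + (1 - t * p))).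

Lemma modsq_pos (p q t : R) : ~ (q = 0 /\ 1 <= p) -> 0 <= t <= 1 -> 0 < modsq p q t.
Proof.
  intros Hd Ht. unfold modsq.
  assert (0 <= (1 - t * p) ^ 2) by apply pow2_ge_0. assert (0 <= (t * q) ^ 2) by apply pow2_ge_0.
  destruct (Rlt_dec 0 ((1 - t * p) ^ 2 + (t * q) ^ 2)) as [|N]; [assumption|]. exfalso. apply Hd.
  assert (E1 : 1 - t * p = 0) by (apply Rsqr_0_uniq; unfold Rsqr; simpl in *; lra).
  assert (E2 : t * q = 0) by (apply Rsqr_0_uniq; unfold Rsqr; simpl in *; lra).
  split; [apply Rmult_integral in E2; destruct E2 as [->|]; [lra | assumption]|].
  apply Rnot_lt_le. intros P. assert (T : 0 < t) by (destruct (Req_dec t 0) as [->|]; lra).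
  pose proof (Rmult_lt_compat_l t p 1 T P). lra.
Qed.

Lemma slit_pos (p q t : R) : ~ (q = 0 /\ 1 <= p) -> 0 <= t <= 1 -> 0 < sqrt (modsq p q t) + (1 - t * p).
Proof.
  intros Hd Ht. pose proof (modsq_pos p q t Hd Ht) as M.
  pose proof (sqrt_lt_R0 _ M) as S. pose proof (sqrt_sqrt _ (Rlt_le _ _ M)) as E.
  destruct (Rle_dec 0 (1 - t * p)) as [|N]; [lra|].
  unfold modsq in E at 3. assert (0 < (t * q) ^ 2); [|simpl in *; nra].
  destruct (Req_dec q 0) as [->|Q].
  - exfalso. apply Hd. split; [reflexivity|].
    apply Rnot_lt_le. intros P. assert (T : 0 < t) by (destruct (Req_dec t 0) as [->|]; lra).
    pose proof (Rmult_lt_compat_l t p 1 T P). lra.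
  - assert (t <> 0) by (intros ->; lra). apply pow2_gt_0. now apply Rmult_integral_contrapositive.
Qed.

Lemma Cmod_1_minus (w : C) (t : R) : Cmod (1 - RtoC t * w)%C = sqrt (modsq (Re w) (Im w) t).
Proof.
  unfold Cmod, modsq. f_equal. destruct w as [p q]. simpl. ring.
Qed.

Lemma Re_1_minus (w : C) (t : R) : Re (1 - RtoC t * w)%C = 1 - t * Re w.
Proof. destruct w as [p q]. simpl. ring. Qed.

Lemma Im_1_minus (w : C) (t : R) : Im (1 - RtoC t * w)%C = - (t * Im w).
Proof. destruct w as [p q]. simpl. ring. Qed.

Lemma Li2_eq (w : C) : dilog_domain w ->
  Li2 w = (- RInt (fun t => logmod (Re w) (Im w) t / t) 0 1, - RInt (fun t => argm (Re w) (Im w) t / t) 0 1).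
Proof.
  intros Hd. unfold Li2, CRInt.
  assert (D : forall (x : C) t, t <> 0 -> (x / RtoC t)%C = (Re x / t, Im x / t)).
  { intros [a b] t Ht. unfold Cdiv, Cinv, Cmult, RtoC. simpl. f_equal; field; assumption. }
  assert (S : forall a b a' b', a = a' -> b = b' -> (- (a, b))%C = (- a', - b')) by (intros; subst; reflexivity).
  apply S.
  - apply RInt_ext. intros t Ht. rewrite Rmin_left, Rmax_right in Ht by lra.
    rewrite D by lra. unfold Clog. simpl. f_equal. unfold logmod.
    rewrite Cmod_1_minus. pose proof (modsq_pos (Re w) (Im w) t Hd ltac:(lra)) as M.
    rewrite <- (sqrt_sqrt (modsq (Re w) (Im w) t)) at 2 by lra.
    rewrite ln_mult by now apply sqrt_lt_R0. field.
  - apply RInt_ext. intros t Ht. rewrite Rmin_left, Rmax_right in Ht by lra.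
    rewrite D by lra. unfold Clog. simpl. f_equal. unfold argm.
    rewrite Arg_half_angle; rewrite ?Cmod_1_minus, ?Re_1_minus, ?Im_1_minus; [reflexivity|].
    apply slit_pos; [exact Hd | lra].
Qed.

(** The singularity at 0 is removable: the quotient extends by the derivative of f. *)
Lemma ex_RInt_quotient (f : R -> R) (l : R) :
  f 0 = 0 -> is_derive f 0 l -> (forall t, 0 < t <= 1 -> continuous f t) -> ex_RInt (fun t => f t / t) 0 1.
Proof.
  intros H0 Hl Hc.
  set (g := fun t => if Req_EM_T t 0 then l else f t / t).
  apply (ex_RInt_ext g).
  { intros t Ht. rewrite Rmin_left, Rmax_right in Ht by lra. unfold g.
    destruct (Req_EM_T t 0); [lra | reflexivity]. }
  apply (ex_RInt_continuous (V := R_CompleteNormedModule)). intros t Ht.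
  rewrite Rmin_left, Rmax_right in Ht by lra.
  destruct (Req_dec t 0) as [->|N].
  - apply (filterlim_locally (U := R_UniformSpace)). intros eps.
    apply is_derive_Reals in Hl. destruct (Hl eps (cond_pos eps)) as [d Hd].
    exists d. intros y Hy. change (Rabs (y - 0) < d) in Hy. rewrite Rminus_0_r in Hy.
    change (Rabs (g y - g 0) < eps). unfold g. destruct (Req_EM_T 0 0) as [_|]; [|lra].
    destruct (Req_EM_T y 0) as [_|Ny]; [rewrite Rminus_eq_0, Rabs_R0; apply cond_pos|].
    specialize (Hd y Ny Hy). now rewrite Rplus_0_l, H0, Rminus_0_r in Hd.
  - apply continuous_ext_loc with (fun t => f t / t).
    + exists (mkposreal (Rabs t) (Rabs_pos_lt t N)). intros y Hy. change (Rabs (y - t) < Rabs t) in Hy.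
      unfold g. destruct (Req_EM_T y 0) as [->|]; [|reflexivity].
      exfalso. rewrite Rminus_0_l, Rabs_Ropp in Hy. lra.
    + apply (continuous_mult (K := R_AbsRing) f (fun t => / t)); [apply Hc; lra|].
      apply (ex_derive_continuous (fun t => / t)). auto_derive. lra.
Qed.

Lemma modsq_0 (p q : R) : modsq p q 0 = 1.
Proof. unfold modsq. ring. Qed.

Lemma ex_RInt_logmod (p q : R) : ~ (q = 0 /\ 1 <= p) -> ex_RInt (fun t => logmod p q t / t) 0 1.
Proof.
  intros Hd. apply ex_RInt_quotient with (- p).
  - unfold logmod. rewrite modsq_0, ln_1. lra.
  - unfold logmod, modsq. auto_derive; [lra|]. field.
  - intros t Ht. pose proof (modsq_pos p q t Hd ltac:(lra)) as M.
    apply (ex_derive_continuous (logmod p q)). unfold logmod, modsq in *. auto_derive. exact M.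
Qed.

Lemma ex_RInt_argm (p q : R) : ~ (q = 0 /\ 1 <= p) -> ex_RInt (fun t => argm p q t / t) 0 1.
Proof.
  intros Hd. apply ex_RInt_quotient with (- q).
  - unfold argm. rewrite Rmult_0_l. unfold Rdiv. rewrite Ropp_0, Rmult_0_l, atan_0. ring.
  - assert (E0 : sqrt ((1 - 0 * p) ^ 2 + (0 * q) ^ 2) = 1).
    { transitivity (sqrt 1); [f_equal; ring | apply sqrt_1]. }
    unfold argm, modsq. auto_derive.
    + change (1 + - (0 * p)) with (1 - 0 * p). simpl in E0. rewrite E0.
      split; [lra|]. split; [lra | trivial].
    + change (1 + - (0 * p)) with (1 - 0 * p). simpl in E0. rewrite E0.
      replace (- (0 * q) * / (1 + (1 - 0 * p))) with 0 by (field; lra). field.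
  - intros t Ht. pose proof (modsq_pos p q t Hd ltac:(lra)) as M. pose proof (slit_pos p q t Hd ltac:(lra)) as S.
    apply (ex_derive_continuous (argm p q)). unfold argm, modsq in *. auto_derive.
    split; [exact M|]. split; [apply Rgt_not_eq; exact S | trivial].
Qed.

(** Multiplication by i exchanges the roles: the integral of log |1 - tw|/t is tied to arg w, that
    of arg(1 - tw)/t to log |w|. *)
Lemma dilog_zero_system (w : C) : is_dilog_zero w ->
  ~ (Im w = 0 /\ 1 <= Re w) /\ 0 < Cmod w /\
  RInt (fun t => logmod (Re w) (Im w) t / t) 0 1 = 2 * PI * Arg w /\
  RInt (fun t => argm (Re w) (Im w) t / t) 0 1 = - (2 * PI * ln (Cmod w)).
Proof.
  intros [W0 [Hd E]]. split; [exact Hd|]. split; [now apply Cmod_gt_0|].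
  rewrite (Li2_eq w Hd) in E. unfold Clog in E.
  injection E as E1 E2. split; [|]; ring_simplify in E1; ring_simplify in E2; lra.
Qed.

(** * Elementary inequalities and a quadrature *)

Lemma nonneg_of_derive (g g' : R -> R) (b x : R) :
  g 0 = 0 -> (forall t, 0 <= t <= b -> is_derive g t (g' t)) -> (forall t, 0 <= t <= b -> 0 <= g' t) ->
  0 <= x <= b -> 0 <= g x.
Proof.
  intros H0 Hd Hp Hx. destruct (MVT_gen g 0 x g') as [c [Hc E]].
  - intros t Ht. rewrite Rmin_left, Rmax_right in Ht by lra. apply Hd. lra.
  - intros t Ht. rewrite Rmin_left, Rmax_right in Ht by lra.
    apply continuity_pt_filterlim. apply (ex_derive_continuous g). eexists. apply Hd. lra.
  - rewrite Rmin_left, Rmax_right in Hc by lra. rewrite H0, !Rminus_0_r in E. rewrite E.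
    apply Rmult_le_pos; [apply Hp|]; lra.
Qed.

(** A Pade approximant of the arctangent; the derivative of the difference is 4y^4/((1 + y^2)(3 +
    y^2)^2). *)
Lemma atan_lower (y : R) : 0 <= y -> 3 * y / (3 + y ^ 2) <= atan y.
Proof.
  intros Hy.
  enough (H : 0 <= atan y - 3 * y / (3 + y ^ 2)) by lra.
  apply (nonneg_of_derive (fun y => atan y - 3 * y / (3 + y ^ 2))
    (fun y => 4 * y ^ 4 / ((1 + y ^ 2) * (3 + y ^ 2) ^ 2)) y); [rewrite atan_0; field | | | lra].
  - intros t Ht. assert (0 <= t ^ 2) by apply pow2_ge_0. auto_derive.
    + simpl in *. lra.
    + simpl in H. unfold Rsqr. field. simpl. split; nra.
  - intros t _. assert (0 <= t ^ 2) by apply pow2_ge_0. apply Rmult_le_pos.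
    + apply Rmult_le_pos; [lra|]. replace (t ^ 4) with (t ^ 2 * t ^ 2) by ring. now apply Rmult_le_pos.
    + left. apply Rinv_0_lt_compat. apply Rmult_lt_0_compat; [lra|]. apply pow_lt. lra.
Qed.

Lemma neg_ln_lower (v : R) : 0 <= v < 1 -> v + v ^ 2 / 2 + v ^ 3 / 3 + v ^ 4 / 4 <= - ln (1 - v).
Proof.
  intros Hv.
  enough (H : 0 <= - ln (1 - v) - (v + v ^ 2 / 2 + v ^ 3 / 3 + v ^ 4 / 4)) by lra.
  apply (nonneg_of_derive (fun v => - ln (1 - v) - (v + v ^ 2 / 2 + v ^ 3 / 3 + v ^ 4 / 4))
    (fun v => v ^ 4 / (1 - v)) v); [rewrite Rminus_0_r, ln_1; field | | | lra].
  - intros t Ht. auto_derive; [lra|]. field. lra.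
  - intros t Ht. apply Rmult_le_pos; [apply pow_le; lra|]. left. apply Rinv_0_lt_compat. lra.
Qed.

Lemma cos_ge_quadratic (x : R) : 1 - x ^ 2 / 2 <= cos x.
Proof.
  replace x with (2 * (x / 2)) at 2 by field. rewrite cos_2a_sin.
  assert (H : Rabs (sin (x / 2)) <= Rabs (x / 2)).
  { pose proof (sin_lipschitz (x / 2) 0) as H. now rewrite sin_0, !Rminus_0_r in H. }
  apply Rsqr_le_abs_1 in H. unfold Rsqr in H. simpl. lra.
Qed.

Lemma two_atan_half (X Y : R) : 0 < X -> 2 * atan (Y / (sqrt (X ^ 2 + Y ^ 2) + X)) = atan (Y / X).
Proof.
  intros HX.
  pose proof (Arg_half_angle (X, Y)) as A1.
  change (Cmod (X, Y)) with (sqrt (X ^ 2 + Y ^ 2)) in A1. simpl Re in A1. simpl Im in A1.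
  rewrite <- A1 by (pose proof (sqrt_pos (X ^ 2 + Y ^ 2)); lra). clear A1.
  assert (M : 0 < X ^ 2 + Y ^ 2) by (pose proof (pow2_ge_0 Y); pose proof (pow_lt X 2 HX); lra).
  assert (E : X / sqrt (X ^ 2 + Y ^ 2) = cos (atan (Y / X))).
  { rewrite cos_atan. replace (1 + (Y / X)²) with ((X ^ 2 + Y ^ 2) / X ^ 2) by (unfold Rsqr; field; lra).
    rewrite sqrt_div_alt, sqrt_pow2 by (try apply pow_lt; lra). field.
    split; [lra|]. apply Rgt_not_eq, sqrt_lt_R0, M. }
  pose proof (atan_bound (Y / X)) as Bd.
  assert (IX : 0 < / X) by now apply Rinv_0_lt_compat.
  apply Arg_unique; [exact E | lra | |]; simpl; intros HY.
  - apply atan_nonneg, Rmult_le_pos; lra.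
  - assert (0 <= atan (- (Y / X))); [|rewrite atan_opp in *; lra].
    apply atan_nonneg. unfold Rdiv. rewrite Ropp_mult_distr_l. apply Rmult_le_pos; lra.
Qed.

Lemma RInt_ge_linear (f : R -> R) (a b al be : R) :
  a <= b -> ex_RInt f a b -> (forall t, a < t < b -> al + be * t <= f t) ->
  al * (b - a) + be * (b ^ 2 - a ^ 2) / 2 <= RInt f a b.
Proof.
  intros Hab Hf H.
  assert (I : is_RInt (fun t => al + be * t) a b (al * (b - a) + be * (b ^ 2 - a ^ 2) / 2)).
  { replace (al * (b - a) + be * (b ^ 2 - a ^ 2) / 2) with
      (minus (al * b + be * b ^ 2 / 2) (al * a + be * a ^ 2 / 2)).
    - apply (is_RInt_derive (fun t => al * t + be * t ^ 2 / 2)).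
      + intros t _. auto_derive; [trivial | field].
      + intros t _. apply (ex_derive_continuous (fun t => al + be * t)). auto_derive. trivial.
    - change (al * b + be * b ^ 2 / 2 - (al * a + be * a ^ 2 / 2) = al * (b - a) + be * (b ^ 2 - a ^ 2) / 2). field. }
  rewrite <- (is_RInt_unique _ _ _ _ I). apply RInt_le; [exact Hab | eexists; exact I | exact Hf | exact H].
Qed.

(* 0.1497 and 0.9279 are 0.94 sin 0.16 and 0.94 cos 0.16, rounded down. *)
Lemma linear_below_quadrature (a b al be t : R) :
  0 <= a -> a <= t <= b -> b <= 1 ->
  (forall u v : R, 0 <= u -> 0 <= v -> t = a + u -> t = b - v ->
     (al + be * t) * (3 * (1 - 0.9279 * t) ^ 2 + (0.1497 * t) ^ 2) <= 3 * 0.1497 * (1 - 0.9279 * t)) ->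
  0 < t ->
  al + be * t <= 3 * (0.1497 * t / (1 - 0.9279 * t)) / (3 + (0.1497 * t / (1 - 0.9279 * t)) ^ 2) / t.
Proof.
  intros Ha Ht Hb H Hp. specialize (H (t - a) (b - t) ltac:(lra) ltac:(lra) ltac:(lra) ltac:(lra)).
  assert (X : 0 < 1 - 0.9279 * t) by lra.
  assert (D : 0 < 3 * (1 - 0.9279 * t) ^ 2 + (0.1497 * t) ^ 2).
  { pose proof (pow_lt _ 2 X). pose proof (pow2_ge_0 (0.1497 * t)). lra. }
  replace (3 * (0.1497 * t / (1 - 0.9279 * t)) / (3 + (0.1497 * t / (1 - 0.9279 * t)) ^ 2) / t) with
    (3 * 0.1497 * (1 - 0.9279 * t) / (3 * (1 - 0.9279 * t) ^ 2 + (0.1497 * t) ^ 2)).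
  - apply Rmult_le_reg_r with (3 * (1 - 0.9279 * t) ^ 2 + (0.1497 * t) ^ 2); [exact D|].
    unfold Rdiv. rewrite (Rmult_assoc _ (/ _)), Rinv_l, Rmult_1_r by lra. exact H.
  - field. repeat split; try lra.
Qed.

(** On each of four intervals a line lies below the rational minorant from [atan_lower]. Clearing
    denominators turns this into a cubic polynomial inequality, and the integrals of the four lines
    add up to more than 0.345. *)
Lemma RInt_atan_quadrature (f : R -> R) :
  ex_RInt f 0 1 ->
  (forall t, 0 < t < 1 -> atan (0.1497 * t / (1 - 0.9279 * t)) / t <= f t) ->
  0.345 <= RInt f 0 1.
Proof.
  intros Hf H.
  assert (EX : forall a b, 0 <= a <= b -> b <= 1 -> ex_RInt f a b).
  { intros a b Ha Hb. apply (ex_RInt_Chasles_1 f a b 1); [lra|].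
    apply (ex_RInt_Chasles_2 f 0 a 1); [lra | exact Hf]. }
  assert (L : forall a b al be, 0 <= a <= b -> b <= 1 ->
    (forall t u v : R, 0 <= u -> 0 <= v -> t = a + u -> t = b - v ->
      (al + be * t) * (3 * (1 - 0.9279 * t) ^ 2 + (0.1497 * t) ^ 2) <= 3 * 0.1497 * (1 - 0.9279 * t)) ->
    al * (b - a) + be * (b ^ 2 - a ^ 2) / 2 <= RInt f a b).
  { intros a b al be Ha Hb Hl. apply RInt_ge_linear; [lra | now apply EX |].
    intros t Ht. eapply Rle_trans; [|apply H; lra].
    eapply Rle_trans; [apply (linear_below_quadrature a b); try lra; now apply Hl|].
    apply Rmult_le_compat_r; [left; apply Rinv_0_lt_compat; lra|].
    apply atan_lower. apply Rmult_le_pos; [lra|]. left. apply Rinv_0_lt_compat. lra. }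
  (* The cubic monomials in the distances u, v to the endpoints, a Bernstein basis up to constants,
     are the positivity hints for [nra]. *)
  assert (P : forall u v : R, 0 <= u -> 0 <= v ->
    0 <= u ^ 3 /\ 0 <= u ^ 2 * v /\ 0 <= u * v ^ 2 /\ 0 <= v ^ 3).
  { intros u v Hu Hv. repeat split; repeat apply Rmult_le_pos; lra. }
  pose proof (L 0 (35 / 100) 0.137 0.216) as L1.
  pose proof (L (35 / 100) (62 / 100) 0.019 0.505) as L2.
  pose proof (L (62 / 100) (79 / 100) (-0.409) 1.163) as L3.
  pose proof (L (79 / 100) 1 (-0.678) 1.523) as L4.
  assert (CH : forall a b, 0 <= a <= b -> b <= 1 -> RInt f a 1 = RInt f a b + RInt f b 1).
  { intros a b Ha Hb. symmetry. apply (RInt_Chasles f a b 1); apply EX; lra. }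
  pose proof (CH 0 (35 / 100)) as C1. pose proof (CH (35 / 100) (62 / 100)) as C2.
  pose proof (CH (62 / 100) (79 / 100)) as C3.
  specialize (L1 ltac:(lra) ltac:(lra)). specialize (L2 ltac:(lra) ltac:(lra)).
  specialize (L3 ltac:(lra) ltac:(lra)). specialize (L4 ltac:(lra) ltac:(lra)).
  lapply L1; [clear L1; intros L1|
    intros t u v Hu Hv E1 E2; destruct (P u v Hu Hv) as [P1 [P2 [P3 P4]]];
    replace v with (35 / 100 - 0 - u) in * by lra; subst t; nra].
  lapply L2; [clear L2; intros L2|
    intros t u v Hu Hv E1 E2; destruct (P u v Hu Hv) as [P1 [P2 [P3 P4]]];
    replace v with (62 / 100 - 35 / 100 - u) in * by lra; subst t; nra].
  lapply L3; [clear L3; intros L3|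
    intros t u v Hu Hv E1 E2; destruct (P u v Hu Hv) as [P1 [P2 [P3 P4]]];
    replace v with (79 / 100 - 62 / 100 - u) in * by lra; subst t; nra].
  lapply L4; [clear L4; intros L4|
    intros t u v Hu Hv E1 E2; destruct (P u v Hu Hv) as [P1 [P2 [P3 P4]]];
    replace v with (1 - 79 / 100 - u) in * by lra; subst t; nra].
  lra.
Qed.

Lemma ln_ge_1_minus_inv (x : R) : 0 < x -> 1 - / x <= ln x.
Proof.
  intros Hx. pose proof (ln_le_sub1 (/ x) (Rinv_0_lt_compat x Hx)) as H.
  rewrite ln_Rinv in H by exact Hx. lra.
Qed.

Lemma logmod_le (p q t y : R) : 0 < y -> 0 < modsq p q t -> modsq p q t <= y ^ 2 -> logmod p q t <= ln y.
Proof.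
  intros Hy Hm H. unfold logmod. apply ln_le in H; [|exact Hm].
  rewrite ln_pow in H by exact Hy. simpl in H. lra.
Qed.

Lemma logmod_ge (p q t y : R) : 0 < y -> y ^ 2 <= modsq p q t -> ln y <= logmod p q t.
Proof.
  intros Hy H. unfold logmod. apply ln_le in H; [|now apply pow_lt].
  rewrite ln_pow in H by exact Hy. simpl in H. lra.
Qed.

(** * The open lower half plane *)

Lemma modsq_polar (r psi t : R) :
  modsq (r * cos psi) (- (r * sin psi)) t = 1 - 2 * (t * r) * cos psi + (t * r) ^ 2.
Proof.
  pose proof (sin2_cos2 psi) as SC. unfold Rsqr in SC. unfold modsq.
  replace ((1 - t * (r * cos psi)) ^ 2 + (t * - (r * sin psi)) ^ 2) with
    (1 - 2 * (t * r) * cos psi + (t * r) ^ 2 * (sin psi * sin psi + cos psi * cos psi)) by ring.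
  rewrite SC. ring.
Qed.

(** Here w = r e^(-i psi). An angle of at least 0.5 has cosine at most 0.88, so |1 - tw| >= 1 -
    0.88t; with ln x >= 1 - 1/x the integral is at least ln 0.12 >= -3, whereas -2 PI psi <= -PI. *)
Lemma lower_angle_upper (r psi : R) :
  0.9458 <= r <= 1 -> 0 < psi <= PI -> ~ (- (r * sin psi) = 0 /\ 1 <= r * cos psi) ->
  RInt (fun t => logmod (r * cos psi) (- (r * sin psi)) t / t) 0 1 = - (2 * PI * psi) -> psi < 0.5.
Proof.
  intros Hr Hpsi Hd I. set (p := r * cos psi) in *. set (q := - (r * sin psi)) in *.
  apply Rnot_le_lt. intros Hp. pose proof PI_bounds as HP.
  assert (C5 : cos psi <= 0.88).
  { apply Rle_trans with (cos 0.5).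
    - destruct (Req_dec psi 0.5) as [->|]; [lra|]. left. apply cos_decreasing_1; lra.
    - replace 0.5 with (2 * 0.25) by lra. rewrite cos_2a_sin. pose proof (sin_lower 0.25). simpl in H. nra. }
  assert (J : is_RInt (fun t => - (0.88 / (1 - 0.88 * t))) 0 1 (ln 0.12)).
  { replace (ln 0.12) with (minus (ln (1 - 0.88 * 1)) (ln (1 - 0.88 * 0))).
    - apply (is_RInt_derive (fun t => ln (1 - 0.88 * t))); intros t Ht; rewrite Rmin_left, Rmax_right in Ht by lra.
      + auto_derive; [lra|]. field. lra.
      + apply (ex_derive_continuous (fun t => - (0.88 / (1 - 0.88 * t)))). auto_derive. lra.
    - change (ln (1 - 0.88 * 1) - ln (1 - 0.88 * 0) = ln 0.12). rewrite Rmult_0_r, Rminus_0_r, ln_1.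
      replace (1 - 0.88 * 1) with 0.12 by lra. ring. }
  assert (L : ln 0.12 <= RInt (fun t => logmod p q t / t) 0 1).
  { rewrite <- (is_RInt_unique _ _ _ _ J). apply RInt_le; [lra | eexists; exact J | now apply ex_RInt_logmod |].
    intros t Ht. assert (Ht1 : 0 <= t * r <= t) by nra.
    assert (G : ln (1 - 0.88 * t) <= logmod p q t).
    { apply logmod_ge; [lra|]. unfold p, q. rewrite modsq_polar.
      apply Rle_trans with ((1 - 0.88 * (t * r)) ^ 2); simpl; nra. }
    pose proof (ln_ge_1_minus_inv (1 - 0.88 * t) ltac:(lra)) as G2.
    apply Rmult_le_reg_r with t; [lra|].
    replace (- (0.88 / (1 - 0.88 * t)) * t) with (1 - / (1 - 0.88 * t)) by (field; lra).
    replace (logmod p q t / t * t) with (logmod p q t) by (field; lra). lra. }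
  assert (L2 : -3 <= ln 0.12).
  { rewrite <- (ln_exp (-3)). apply ln_le; [apply exp_pos|].
    replace (-3) with (- (3)) by ring. rewrite exp_Ropp.
    assert (E3 : 14 <= exp 3).
    { pose proof (exp_quarter_lower 12) as E. simpl in E. replace (_ / 4) with 3 in E by field. lra. }
    apply Rle_trans with (/ 14); [apply Rinv_le_contravar|]; lra. }
  nra.
Qed.

(** If psi <= 0.16, then |1 - tw| <= 1 - 0.794t, where 0.794 is just below 0.9458 (1 - 0.16). Four
    terms of the logarithmic series put the integral below -1.03, whereas 2 PI 0.16 < 1.01. *)
Lemma lower_angle_lower (r psi : R) :
  0.9458 <= r <= 1 -> 0 < psi <= PI -> ~ (- (r * sin psi) = 0 /\ 1 <= r * cos psi) ->
  RInt (fun t => logmod (r * cos psi) (- (r * sin psi)) t / t) 0 1 = - (2 * PI * psi) -> 0.16 < psi.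
Proof.
  intros Hr Hpsi Hd I. set (p := r * cos psi) in *. set (q := - (r * sin psi)) in *.
  apply Rnot_le_lt. intros Hp. pose proof PI_bounds as HP.
  pose proof (cos_ge_quadratic psi) as Cq.
  set (g' := fun t => - (0.794 + 0.794 ^ 2 * t / 2 + 0.794 ^ 3 * t ^ 2 / 3 + 0.794 ^ 4 * t ^ 3 / 4)).
  set (c := 0.794 + 0.794 ^ 2 / 4 + 0.794 ^ 3 / 9 + 0.794 ^ 4 / 16).
  assert (J : is_RInt g' 0 1 (- c)).
  { set (g := fun t => - (0.794 * t + 0.794 ^ 2 * t ^ 2 / 4 + 0.794 ^ 3 * t ^ 3 / 9 + 0.794 ^ 4 * t ^ 4 / 16)).
    replace (- c) with (minus (g 1) (g 0)).
    - apply (is_RInt_derive g); intros t _; unfold g, g'.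
      + auto_derive; [trivial | field].
      + apply (ex_derive_continuous g'). unfold g'. auto_derive. trivial.
    - change (g 1 - g 0 = - c). unfold g, c. field. }
  assert (L : RInt (fun t => logmod p q t / t) 0 1 <= - c).
  { rewrite <- (is_RInt_unique _ _ _ _ J). apply RInt_le; [lra | now apply ex_RInt_logmod | eexists; exact J |].
    intros t Ht. assert (Ht1 : 0 < t * r <= 1) by nra.
    assert (G : logmod p q t <= ln (1 - 0.794 * t)).
    { apply logmod_le; [lra | apply modsq_pos; [exact Hd | lra] |]. unfold p, q. rewrite modsq_polar.
      (* Geometrically, |1 - s e^(-i psi)| <= (1 - s) + s psi for s = tr <= 1. *)
      apply Rle_trans with ((1 - t * r * (1 - psi)) ^ 2).
      - assert (t * r * (1 - psi ^ 2 / 2) <= t * r * cos psi) by (apply Rmult_le_compat_l; lra).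
        assert (0 <= t * r * psi * (1 - t * r)) by (repeat apply Rmult_le_pos; lra).
        simpl in *. nra.
      - assert (0.794 <= r * (1 - psi)) by nra.
        assert (0.794 * t <= t * r * (1 - psi)) by nra.
        assert (t * r * (1 - psi) <= 1) by nra.
        apply pow_incr. lra. }
    pose proof (neg_ln_lower (0.794 * t) ltac:(lra)) as G2.
    apply Rmult_le_reg_r with t; [lra|].
    replace (logmod p q t / t * t) with (logmod p q t) by (field; lra).
    eapply Rle_trans; [exact G|].
    unfold g'. replace (- (0.794 + 0.794 ^ 2 * t / 2 + 0.794 ^ 3 * t ^ 2 / 3 + 0.794 ^ 4 * t ^ 3 / 4) * t) with
      (- (0.794 * t + (0.794 * t) ^ 2 / 2 + (0.794 * t) ^ 3 / 3 + (0.794 * t) ^ 4 / 4)) by field. lra. }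
  rewrite I in L. unfold c in L. nra.
Qed.

(** The argument of 1 - tw is arctan(tr sin psi/(1 - tr cos psi)). Lowering r to 0.94 and after that
    psi to 0.16 does not increase it, and what remains is the quadrature. *)
Lemma lower_arg_integral (r psi : R) :
  0.9458 <= r <= 1 -> ~ (- (r * sin psi) = 0 /\ 1 <= r * cos psi) ->
  0.16 < psi < 0.5 -> 0.345 <= RInt (fun t => argm (r * cos psi) (- (r * sin psi)) t / t) 0 1.
Proof.
  intros Hr Hd Hp. set (p := r * cos psi) in *. set (q := - (r * sin psi)) in *. pose proof PI_bounds as HP.
  apply RInt_atan_quadrature; [now apply ex_RInt_argm|].
  intros t Ht. apply Rmult_le_compat_r; [left; apply Rinv_0_lt_compat; lra|].
  assert (Sp : 0 < sin psi) by (apply sin_gt_0; lra).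
  assert (Cp : 0 < cos psi) by (apply cos_gt_0; lra).
  assert (C1 : cos psi <= 1) by apply COS_bound.
  assert (X : 0 < 1 - t * p).
  { unfold p. assert (t * (r * cos psi) < 1); [|lra].
    apply Rle_lt_trans with (t * 1); [|lra]. apply Rmult_le_compat_l; nra. }
  assert (E : argm p q t = atan (t * (r * sin psi) / (1 - t * p))).
  { unfold argm, modsq. rewrite <- (two_atan_half (1 - t * p) (t * (r * sin psi)) X).
    replace (t * q) with (- (t * (r * sin psi))) by (unfold q; ring).
    rewrite Ropp_involutive. do 4 f_equal. f_equal. ring. }
  rewrite E.
  set (S0 := sin 0.16). set (C0 := cos 0.16).
  assert (HS0 : 0.1593 <= S0) by (pose proof (sin_lower 0.16 ltac:(lra)) as H; simpl in H; unfold S0; lra).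
  assert (HC0 : 0.9872 <= C0 <= 1) by (pose proof (cos_ge_quadratic 0.16) as H; simpl in H; unfold C0; pose proof (COS_bound 0.16); lra).
  set (u := 0.94 * t). assert (Hu : 0 < u < 0.94) by (unfold u; lra).
  (* For fixed modulus u, the argument of 1 - u exp(-i psi) is increasing in psi as long as u < cos psi. *)
  assert (K : u * (sin psi * C0 - S0 * cos psi) <= sin psi - S0).
  (* Half sum and half difference of the angles: after cancelling 2 sin ta the claim is u cos ta <=
     cos sg, and cos sg >= 0.945. *)
  { set (sg := (psi + 0.16) / 2). set (ta := (psi - 0.16) / 2).
    assert (E1 : psi = sg + ta) by (unfold sg, ta; field).
    assert (E2 : 0.16 = sg - ta) by (unfold sg, ta; field).
    replace (sin psi * C0 - S0 * cos psi) with (sin (2 * ta)).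
    2:{ unfold S0, C0. replace (2 * ta) with (psi - 0.16) by (unfold ta; field). rewrite sin_minus. ring. }
    replace (sin psi - S0) with (2 * cos sg * sin ta).
    2:{ unfold S0. replace (sin psi) with (sin (sg + ta)) by now rewrite <- E1.
        replace (sin 0.16) with (sin (sg - ta)) by now rewrite <- E2.
        rewrite sin_plus, sin_minus. ring. }
    rewrite sin_2a.
    assert (0 < sin ta) by (apply sin_gt_0; unfold ta; lra).
    pose proof (cos_ge_quadratic sg) as Q. assert (sg ^ 2 <= 0.11) by (unfold sg; simpl; nra).
    pose proof (COS_bound ta) as [_ Q2].
    assert (u * cos ta <= cos sg) by nra. nra. }
  assert (X0 : 0 < 1 - u * C0) by nra.
  assert (M1 : u * sin psi / (1 - u * cos psi) <= t * (r * sin psi) / (1 - t * p)).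
  { assert (0 < 1 - u * cos psi) by nra.
    apply Rmult_le_compat.
    - apply Rmult_le_pos; lra.
    - left. now apply Rinv_0_lt_compat.
    - replace (t * (r * sin psi)) with (r * t * sin psi) by ring. unfold u.
      apply Rmult_le_compat_r; [lra|]. apply Rmult_le_compat_r; lra.
    - apply Rinv_le_contravar; [exact X|]. unfold p, u. assert (0.94 * (t * cos psi) <= r * (t * cos psi)) by (apply Rmult_le_compat_r; nra). lra. }
  assert (M2 : u * S0 / (1 - u * C0) <= u * sin psi / (1 - u * cos psi)).
  { assert (0 < 1 - u * cos psi) by nra.
    apply Rmult_le_reg_r with ((1 - u * C0) * (1 - u * cos psi)); [nra|].
    replace (u * S0 / (1 - u * C0) * ((1 - u * C0) * (1 - u * cos psi))) with (u * (S0 * (1 - u * cos psi))) by (field; lra).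
    replace (u * sin psi / (1 - u * cos psi) * ((1 - u * C0) * (1 - u * cos psi))) with
      (u * (sin psi * (1 - u * C0))) by (field; lra).
    apply Rmult_le_compat_l; lra. }
  assert (M3 : 0.1497 * t / (1 - 0.9279 * t) <= u * S0 / (1 - u * C0)).
  { apply Rmult_le_compat.
    - lra.
    - left. apply Rinv_0_lt_compat. lra.
    - unfold u. nra.
    - apply Rinv_le_contravar; [exact X0|]. unfold u. nra. }
  assert (M : 0.1497 * t / (1 - 0.9279 * t) <= t * (r * sin psi) / (1 - t * p)) by lra.
  destruct M as [M|M]; [left; now apply atan_increasing | rewrite M; apply Rle_refl].
Qed.

Lemma argm_sign (p q t : R) : ~ (q = 0 /\ 1 <= p) -> 0 < t < 1 -> q <= 0 -> 0 <= argm p q t / t.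
Proof.
  intros Hd Ht Hq. pose proof (slit_pos p q t Hd ltac:(lra)) as S.
  apply Rmult_le_pos; [|left; apply Rinv_0_lt_compat; lra].
  unfold argm. apply Rmult_le_pos; [lra|].
  apply atan_nonneg, Rmult_le_pos; [nra | left; now apply Rinv_0_lt_compat].
Qed.

(** Below the real axis arg(1 - tw) is nonnegative, so the second equation gives |w| <= 1. The first
    equation then confines psi = -arg w to (0.16, 0.5), where the integral in the second is at least
    0.345, against the assumed 0.34. *)
Lemma no_zero_lower_half_plane (w : C) : is_dilog_zero w -> Im w < 0 -> 0.9458 <= Cmod w ->
  - (2 * PI * ln (Cmod w)) <= 0.34 -> False.
Proof.
  intros Hw Hq Hr HW. pose proof PI_bounds as HP.
  destruct (dilog_zero_system w Hw) as [Hd [R0 [I1 I2]]].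
  set (p := Re w) in *. set (q := Im w) in *. set (r := Cmod w) in *.
  assert (R1 : r <= 1).
  { apply Rnot_lt_le. intros H.
    assert (0 <= RInt (fun t => argm p q t / t) 0 1).
    { apply RInt_ge_0; [lra | now apply ex_RInt_argm |]. intros t Ht. apply argm_sign; [exact Hd | lra | lra]. }
    assert (0 < ln r) by (rewrite <- ln_1; apply ln_increasing; lra). nra. }
  assert (R2 : r ^ 2 = p ^ 2 + q ^ 2).
  { unfold r, p, q, Re, Im, Cmod. apply pow2_sqrt. apply Rplus_le_le_0_compat; apply pow2_ge_0. }
  set (psi := acos (p / r)).
  assert (EA : Arg w = - psi).
  { unfold Arg. destruct (Rle_dec 0 (Im w)) as [H|]; [exfalso; fold q in H; lra | reflexivity]. }
  assert (Hpr : -1 < p / r < 1).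
  { assert (q2 : 0 < q ^ 2) by (apply pow2_gt_0; lra).
    split; (apply Rmult_lt_reg_r with r; [lra|]); unfold Rdiv; rewrite Rmult_assoc, Rinv_l by lra; simpl in *; nra. }
  pose proof (acos_bound_lt (p / r) Hpr) as Bp. fold psi in Bp.
  assert (Ec : p = r * cos psi) by (unfold psi; rewrite cos_acos by lra; field; lra).
  assert (Es : q = - (r * sin psi)).
  { pose proof (sin_gt_0 psi ltac:(lra) ltac:(lra)) as S. pose proof (sin2_cos2 psi) as SC. unfold Rsqr in SC.
    assert (Q : (r * sin psi) ^ 2 = (- q) ^ 2).
    { replace ((- q) ^ 2) with (r ^ 2 - p ^ 2) by (rewrite R2; ring). rewrite Ec.
      replace (r ^ 2 - (r * cos psi) ^ 2) with (r ^ 2 * (1 - cos psi * cos psi)) by ring. rewrite <- SC. ring. }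
    assert (r * sin psi = - q); [|lra].
    apply Rsqr_inj; [apply Rmult_le_pos; lra | lra | unfold Rsqr; simpl in Q; lra]. }
  rewrite EA in I1. rewrite Ec, Es in I1, I2, Hd.
  rewrite <- Ropp_mult_distr_r in I1.
  pose proof (lower_angle_upper r psi ltac:(lra) ltac:(lra) Hd I1).
  pose proof (lower_angle_lower r psi ltac:(lra) ltac:(lra) Hd I1).
  pose proof (lower_arg_integral r psi ltac:(lra) Hd ltac:(lra)). lra.
Qed.

(** * The closed upper half plane *)

Lemma ln_19_lower : 0.637 <= ln 1.9.
Proof.
  rewrite <- (ln_exp 0.637). apply ln_le; [apply exp_pos|].
  (* The bound for e^0.637 is reached from one for e^(0.637/64) by six squarings. *)
  assert (D : forall x y z, exp x <= y -> 0 <= y -> y * y <= z -> exp (2 * x) <= z).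
  { intros x y z H1 H2 H3. replace (2 * x) with (x + x) by ring. rewrite exp_plus.
    apply Rle_trans with (2 := H3). apply Rmult_le_compat; try assumption; left; apply exp_pos. }
  assert (E0 : exp (0.637 / 64) <= 1.01006).
  { eapply Rle_trans; [apply exp_le_inv; lra|].
    rewrite <- (Rinv_inv 1.01006). apply Rinv_le_contravar; lra. }
  pose proof (D _ _ 1.02023 E0 ltac:(lra) ltac:(lra)) as E1.
  pose proof (D _ _ 1.04087 E1 ltac:(lra) ltac:(lra)) as E2.
  pose proof (D _ _ 1.08342 E2 ltac:(lra) ltac:(lra)) as E3.
  pose proof (D _ _ 1.17380 E3 ltac:(lra) ltac:(lra)) as E4.
  pose proof (D _ _ 1.37781 E4 ltac:(lra) ltac:(lra)) as E5.
  pose proof (D _ _ 1.9 E5 ltac:(lra) ltac:(lra)) as E6.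
  replace (2 * (2 * (2 * (2 * (2 * (2 * (0.637 / 64))))))) with 0.637 in E6 by field. exact E6.
Qed.

Lemma atan_le_id (x : R) : 0 <= x -> atan x <= x.
Proof.
  intros Hx. enough (0 <= x - atan x) by lra.
  apply (nonneg_of_derive (fun x => x - atan x) (fun x => x ^ 2 / (1 + x ^ 2)) x); [rewrite atan_0; ring | | | lra].
  - intros t _. auto_derive; [trivial|]. unfold Rsqr. field. nra.
  - intros t _. pose proof (pow2_ge_0 t). apply Rmult_le_pos; [assumption|]. left. apply Rinv_0_lt_compat. lra.
Qed.

(** The distance from 1 to the line through 0 and w is q/|w|, hence tq/|1 - tw| <= t |w|; as 1 - tp
    >= 0, this bounds the quotient inside the half-angle formula. *)
Lemma neg_argm_le (p q t : R) : ~ (q = 0 /\ 1 <= p) -> 0 <= q -> 0 < t < 1 -> t * p <= 1 ->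
  - argm p q t <= 2 * (t * sqrt (p ^ 2 + q ^ 2)).
Proof.
  intros Hd Hq Ht Hp. pose proof (modsq_pos p q t Hd ltac:(lra)) as M.
  pose proof (sqrt_lt_R0 _ M) as S. set (m := sqrt (modsq p q t)) in *.
  unfold argm. fold m. rewrite Ropp_mult_distr_r, <- atan_opp.
  apply Rmult_le_compat_l; [lra|].
  replace (- (- (t * q) / (m + (1 - t * p)))) with (t * q / (m + (1 - t * p))) by (field; lra).
  assert (I : 0 < / (m + (1 - t * p))) by (apply Rinv_0_lt_compat; lra).
  eapply Rle_trans; [apply atan_le_id; apply Rmult_le_pos; [nra | lra]|].
  apply Rle_trans with (t * q / m).
  - apply Rmult_le_compat_l; [nra|]. apply Rinv_le_contravar; lra.
  - unfold Rdiv. rewrite Rmult_assoc. apply Rmult_le_compat_l; [lra|].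
    apply Rmult_le_reg_r with m; [exact S|]. rewrite Rmult_assoc, Rinv_l, Rmult_1_r by lra.
    unfold m. rewrite <- sqrt_mult_alt by (pose proof (pow2_ge_0 p); pose proof (pow2_ge_0 q); lra).
    rewrite <- (sqrt_pow2 q) at 1 by exact Hq. apply sqrt_le_1_alt.
    replace ((p ^ 2 + q ^ 2) * modsq p q t) with (q ^ 2 + (t * (p ^ 2 + q ^ 2) - p) ^ 2) by (unfold modsq; ring).
    pose proof (pow2_ge_0 (t * (p ^ 2 + q ^ 2) - p)). lra.
Qed.

Lemma neg_argm_lt_PI (p q t : R) : - argm p q t <= PI.
Proof. unfold argm. pose proof (atan_bound (- (t * q) / (sqrt (modsq p q t) + (1 - t * p)))). lra. Qed.

Lemma Cmod_sq (w : C) : Cmod w ^ 2 = Re w ^ 2 + Im w ^ 2.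
Proof. unfold Re, Im, Cmod. apply pow2_sqrt. apply Rplus_le_le_0_compat; apply pow2_ge_0. Qed.

(** For r = |w| > 1 split at t = 1/r. Below it, -arg(1 - tw) <= 2tr contributes at most 2; above it,
    the trivial bound PI contributes PI ln r. So 2 PI ln r <= 2 + PI ln r, and ln r <= 2/PI < ln
    1.9. *)
Lemma upper_modulus (w : C) : is_dilog_zero w -> 0 <= Im w -> Cmod w <= 1.9.
Proof.
  intros Hw Hq. pose proof PI_bounds as HP.
  destruct (dilog_zero_system w Hw) as [Hd [R0 [_ I2]]]. pose proof (Cmod_sq w) as R2.
  pose proof (re_le_Cmod w) as Rp. apply Rabs_le_between in Rp.
  set (p := Re w) in *. set (q := Im w) in *. set (r := Cmod w) in *.
  destruct (Rle_dec r 1) as [|R1]; [lra|].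
  assert (Ir : 0 < / r < 1) by (split; [apply Rinv_0_lt_compat | rewrite <- Rinv_1; apply Rinv_lt_contravar]; lra).
  assert (Er : sqrt (p ^ 2 + q ^ 2) = r) by (rewrite <- R2; apply sqrt_pow2; lra).
  set (f := fun t => - (argm p q t / t)).
  pose proof (ex_RInt_argm p q Hd) as EX0.
  assert (EX : ex_RInt f 0 1) by exact (ex_RInt_opp (V := R_NormedModule) _ _ _ EX0).
  assert (EX1 : ex_RInt f 0 (/ r)) by (apply (ex_RInt_Chasles_1 f 0 (/ r) 1); [lra | exact EX]).
  assert (EX2 : ex_RInt f (/ r) 1) by (apply (ex_RInt_Chasles_2 f 0 (/ r) 1); [lra | exact EX]).
  pose proof (RInt_Chasles f 0 (/ r) 1 EX1 EX2) as CH. change (RInt f 0 (/ r) + RInt f (/ r) 1 = RInt f 0 1) in CH.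
  assert (F : RInt f 0 1 = 2 * PI * ln r).
  { apply is_RInt_unique. replace (2 * PI * ln r) with (opp (RInt (fun t => argm p q t / t) 0 1)).
    - apply (is_RInt_opp (V := R_NormedModule)), (RInt_correct (V := R_CompleteNormedModule)), EX0.
    - rewrite I2. change (- - (2 * PI * ln r) = 2 * PI * ln r). ring. }
  assert (B1 : RInt f 0 (/ r) <= 2).
  { replace 2 with (RInt (fun _ => 2 * r) 0 (/ r)).
    - apply RInt_le; [lra | exact EX1 | apply ex_RInt_const |]. intros t Ht. unfold f.
      assert (Hp : t * p <= 1).
      { apply Rle_trans with (/ r * r); [|rewrite Rinv_l; lra]. apply Rle_trans with (t * r); [|]; 
        [apply Rmult_le_compat_l | apply Rmult_le_compat_r]; lra. }
      pose proof (neg_argm_le p q t Hd Hq ltac:(lra) Hp) as A. rewrite Er in A.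
      apply Rmult_le_reg_r with t; [lra|].
      replace (- (argm p q t / t) * t) with (- argm p q t) by (field; lra). lra.
    - rewrite RInt_const. change ((/ r - 0) * (2 * r) = 2). field. lra. }
  assert (J : is_RInt (fun t => PI / t) (/ r) 1 (PI * ln r)).
  { replace (PI * ln r) with (minus (PI * ln 1) (PI * ln (/ r))).
    - apply (is_RInt_derive (fun t => PI * ln t)); intros t Ht; rewrite Rmin_left, Rmax_right in Ht by lra.
      + auto_derive; [lra|]. field. lra.
      + apply (ex_derive_continuous (fun t => PI / t)). auto_derive. lra.
    - rewrite ln_1, ln_Rinv by lra. change (PI * 0 - PI * - ln r = PI * ln r). ring. }
  assert (B2 : RInt f (/ r) 1 <= PI * ln r).
  { rewrite <- (is_RInt_unique _ _ _ _ J). apply RInt_le; [lra | exact EX2 | eexists; exact J |].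
    intros t Ht. unfold f. replace (- (argm p q t / t)) with (- argm p q t / t) by (field; lra).
    apply Rmult_le_compat_r; [left; apply Rinv_0_lt_compat; lra | apply neg_argm_lt_PI]. }
  apply Rnot_lt_le. intros R3. pose proof ln_19_lower.
  assert (ln 1.9 < ln r) by (apply ln_increasing; lra). nra.
Qed.

(** The angle theta is bootstrapped: |1 - tw| <= 1 + tr gives 2 PI theta <= 1.9, so cos theta >=
    0.954; now tr <= 1.9 <= 2 cos theta makes |1 - tw| <= 1, and the first integral is at most 0,
    against theta > 0. If theta = 0, the second equation gives w = 1, which lies on the cut. *)
Lemma no_zero_upper_half_plane (w : C) : is_dilog_zero w -> 0 <= Im w -> False.
Proof.
  intros Hw Hq. pose proof PI_bounds as HP. pose proof (upper_modulus w Hw Hq) as R1.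
  destruct (dilog_zero_system w Hw) as [Hd [R0 [I1 I2]]]. pose proof (Cmod_sq w) as R2.
  pose proof (re_le_Cmod w) as Rp. apply Rabs_le_between in Rp.
  assert (EA : Arg w = acos (Re w / Cmod w)).
  { unfold Arg. destruct (Rle_dec 0 (Im w)); [reflexivity | contradiction]. }
  set (p := Re w) in *. set (q := Im w) in *. set (r := Cmod w) in *.
  rewrite EA in I1. set (theta := acos (p / r)) in *.
  assert (Hpr : -1 <= p / r <= 1).
  { split; (apply Rmult_le_reg_r with r; [lra|]); unfold Rdiv; rewrite Rmult_assoc, Rinv_l; lra. }
  assert (Ec : cos theta = p / r) by (apply cos_acos; lra).
  pose proof (acos_bound (p / r)) as Bt. fold theta in Bt.
  assert (Ep : p = r * cos theta) by (rewrite Ec; field; lra).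
  assert (MS : forall t, modsq p q t = 1 - 2 * t * p + (t * r) ^ 2).
  { intros t. rewrite Rpow_mult_distr, R2. unfold modsq. ring. }
  assert (T0 : 0 < theta).
  { destruct (Rle_lt_or_eq_dec 0 theta ltac:(lra)) as [|T0]; [assumption|]. exfalso.
    rewrite <- T0, cos_0 in Ep. assert (Q0 : q = 0) by (apply Rsqr_0_uniq; unfold Rsqr; simpl in R2; nra).
    assert (Z : RInt (fun t => argm p q t / t) 0 1 = 0).
    { transitivity (RInt (fun _ => 0) 0 1).
      - apply RInt_ext. intros t _. unfold argm. rewrite Q0, Rmult_0_r, Ropp_0. unfold Rdiv at 2.
        rewrite Rmult_0_l, atan_0, Rmult_0_r. apply Rmult_0_l.
      - rewrite RInt_const. apply Rmult_0_r. }
    rewrite Z in I2. assert (L0 : ln r = 0) by nra.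
    assert (r = 1) by (rewrite <- ln_1 in L0; apply ln_inv in L0; lra).
    apply Hd. split; [exact Q0 | lra]. }
  pose proof (ex_RInt_logmod p q Hd) as EX.
  assert (B1 : 2 * PI * theta <= 1.9).
  { rewrite <- I1. replace 1.9 with (RInt (fun _ => 1.9) 0 1) by (rewrite RInt_const; change ((1 - 0) * 1.9 = 1.9); ring).
    apply RInt_le; [lra | exact EX | apply ex_RInt_const |]. intros t Ht.
    assert (L : logmod p q t <= ln (1 + t * r)).
    { apply logmod_le; [nra | apply modsq_pos; [exact Hd | lra] |]. rewrite MS.
      assert (t * - r <= t * p) by (apply Rmult_le_compat_l; lra). simpl. lra. }
    pose proof (ln_le_sub1 (1 + t * r) ltac:(nra)).
    apply Rmult_le_reg_r with t; [lra|].
    replace (logmod p q t / t * t) with (logmod p q t) by (field; lra). nra. }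
  pose proof (cos_ge_quadratic theta) as Cq.
  assert (C1 : 0.954 <= cos theta) by (simpl in Cq; nra).
  assert (B2 : 2 * PI * theta <= 0).
  { rewrite <- I1. replace 0 with (RInt (fun _ => 0) 0 1) at 2 by (rewrite RInt_const; apply Rmult_0_r).
    apply RInt_le; [lra | exact EX | apply ex_RInt_const |]. intros t Ht.
    assert (L : logmod p q t <= ln 1).
    { apply logmod_le; [lra | apply modsq_pos; [exact Hd | lra] |]. rewrite MS.
      assert (X : 0 < t * r <= 1.9) by nra.
      replace (2 * t * p) with (2 * (t * r * cos theta)) by (rewrite Ep at 1; ring). simpl. nra. }
    rewrite ln_1 in L. unfold Rdiv. assert (0 < / t) by (apply Rinv_0_lt_compat; lra). nra. }
  nra.
Qed.

(** If the inequality failed, then -2 PI ln |w| <= Cl2(PI/3)/3 <= 0.34, and |w| >= 1 + ln |w| >= 1 -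
    0.34/(2 PI) >= 0.9458. These are the constants of [no_zero_lower_half_plane]. *)
Lemma Cl2_lt_dilog_zero (w : C) : is_dilog_zero w -> Cl2 (PI / 3) / (6 * PI) < - ln (Cmod w).
Proof.
  intros Hw. pose proof PI_bounds as HP. pose proof Cl2_upper as HC.
  destruct (Rlt_dec (Im w) 0) as [Hq|Hq]; [|exfalso; apply (no_zero_upper_half_plane w Hw); lra].
  apply Rnot_le_lt. intros H.
  destruct (dilog_zero_system w Hw) as [_ [R0 _]].
  assert (H1 : 2 * PI * - ln (Cmod w) <= 0.34).
  { apply Rle_trans with (2 * PI * (Cl2 (PI / 3) / (6 * PI))).
    - apply Rmult_le_compat_l; lra.
    - replace (2 * PI * (Cl2 (PI / 3) / (6 * PI))) with (Cl2 (PI / 3) / 3) by (field; lra). lra. }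
  apply (no_zero_lower_half_plane w Hw Hq); [|lra].
  rewrite <- (exp_ln (Cmod w)) by exact R0.
  eapply Rle_trans; [|apply exp_ineq1_le]. nra.
Qed.

Theorem theorem3p5 (sigma : R) :
  (forall w0 : C, is_dilog_zero w0 ->
     exists W : R, W < - ln (Cmod w0) /\ sum_is_O_exp sigma W) /\
  (forall W : R, Cl2 (PI / 3) / (6 * PI) < W -> sum_is_O_exp sigma W).
Proof.
  split; [|intros W; apply sum_is_O_exp_of_gt].
  intros w0 Hw. pose proof (Cl2_lt_dilog_zero w0 Hw) as H.
  exists ((Cl2 (PI / 3) / (6 * PI) + - ln (Cmod w0)) / 2).
  split; [lra|]. apply sum_is_O_exp_of_gt. lra.
Qed.
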